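(* Let $X$ be a generalized metric space. Given any other generalized metric space $Y$, there is (for each $n\in\mathbb{N}$) in each length grading $0\le\ell<\infty$ a short exact sequence $$0\to\bigoplus_{\substack{r+s=\ell\\ j+k=n}}MH_j^r(X)\otimes_{\mathbb{Z}}MH_k^s(Y)\to MH_n^\ell(X\otimes Y)\to\bigoplus_{\substack{r+s=\ell\\ j+k=n}}\mathrm{Tor}\left(MH_j^r(X),MH_{k-1}^s(Y)\right)\to0$$ natural in $X$ and $Y$. The sequence splits, but the splitting is not natural.
   Context: A generalized metric space is a set $X$ with a function $d:X\times X\to[0,\infty]$ satisfying $d(x,x)=0$ and $d(x,y)+d(y,z)\ge d(x,z)$ (not necessarily symmetric, separated or finite). Equivalently it is a category enriched in $([0,\infty],+,0)$, where $[0,\infty]$ is the poset category with an arrow $u\to v$ iff $u\ge v$. Morphisms are short maps: $d_Y(f(x),f(x'))\le d_X(x,x')$. $X\otimes Y$ is the set $X\times Y$ with the $\ell^1$ metric $d((x,y),(x',y'))=d_X(x,x')+d_Y(y,y')$. $\mathbf{Ab}^{[0,\infty)}$ is the category of abelian groups graded by $[0,\infty)$ (''length grading''), with convolution tensor product $(A\circledast B)^\ell=\bigoplus_{r+s=\ell}A^r\otimes_{\mathbb{Z}}B^s$ and unit $\mathbb{Z}$ concentrated in length grading $0$. The strong symmetric monoidal functor $\Sigma^*:[0,\infty]\to\mathbf{Ab}^{[0,\infty)}$ has $\Sigma^*(\infty)=0$ and, for $t<\infty$, $\Sigma^\ell(t)=\mathbb{Z}$ if $\ell=t$ and $0$ otherwise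 (non-identity arrows are sent to $0$). The magnitude nerve of $X$ is the simplicial object $MB(X)$ of $\mathbf{Ab}^{[0,\infty)}$ with $MB_n(X)=\bigoplus_{x_0,\dots,x_n\in X}\Sigma^*(d(x_0,x_1))\circledast\cdots\circledast\Sigma^*(d(x_{n-1},x_n))$; so $MB_n^\ell(X)$ is free abelian on tuples $(x_0,\dots,x_n)$ with $\sum_i d(x_i,x_{i+1})=\ell$; a face map $\delta_i$ deletes $x_i$ if this preserves the total length and otherwise is $0$ on that tuple; degeneracies repeat an entry. $MH_n^\ell(X)$ is the degree-$n$ homology, in length grading $\ell$, of the associated chain complex with differential $\sum_i(-1)^i\delta_i$ (equivalently of its normalization, the quotient by degenerate tuples). $\mathrm{Tor}=\mathrm{Tor}_1^{\mathbb{Z}}$. In the sums, $r,s\geq 0$ are real, and homology in negative degrees is $0$. *)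

(* Defs.v *)
From HB Require Import structures.
From mathcomp.multinomials Require Import freeg.
From mathcomp Require Import all_boot all_order all_algebra.
From mathcomp Require Import boolp classical_sets cardinality.
From mathcomp Require Import constructive_ereal reals.

Set Implicit Arguments.
Unset Strict Implicit.
Unset Printing Implicit Defensive.

Import Order.TTheory GRing.Theory Num.Theory.

Local Open Scope ring_scope.
Local Open Scope quotient_scope.

Section FreeLift.
Variables (K : choiceType) (A : zmodType) (f : K -> A).

Definition flift (D : {freeg K}) : A := fglift (f : K -> zmodule A) D.

Fact flift_is_additive : zmod_morphism flift.
Proof. exact: (@lift_is_additive int K (zmodule A) f). Qed.

HB.instance Definition _ :=
  GRing.isZmodMorphism.Build {freeg K} A flift flift_is_additive.

Lemma fliftU k : flift << k >> = f k.
Proof. by rewrite /flift liftU [LHS]scale1r. Qed.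
End FreeLift.

Lemma freeg_additive_eq (K : choiceType) (A : zmodType)
    (g h : {additive {freeg K} -> A}) :
  (forall k, g << k >> = h << k >>) -> g =1 h.
Proof.
move=> gh D; rewrite -[D]freeg_sumE !raddf_sum; apply: eq_bigr => k _.
rewrite -[coeff k D]intz -freegU_mulz.
by rewrite !raddfMz gh.
Qed.

Section Kernel.
Variables (A B : zmodType) (f : {additive A -> B}).

Definition kernel_pred : {pred A} := fun x => f x == 0.

Fact kernel_zmod_closed : zmod_closed kernel_pred.
Proof.
split=> [|x y /eqP fx /eqP fy]; apply/eqP; first exact: raddf0.
by rewrite raddfB fx fy subrr.
Qed.
HB.instance Definition _ :=
  GRing.isZmodClosed.Build A kernel_pred kernel_zmod_closed.

Record kernel := Kernel { kernel_val : A; _ : kernel_val \in kernel_pred }.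
HB.instance Definition _ := [isSub for kernel_val].
HB.instance Definition _ := [Choice of kernel by <:].
HB.instance Definition _ := [SubChoice_isSubZmodule of kernel by <:].

Lemma kernelP (x : kernel) : f (val x) = 0.
Proof. by case: x => x /= /eqP. Qed.
End Kernel.

Definition ker_incl (A B : zmodType) (f : {additive A -> B}) :
  {additive kernel f -> A} := \val.

Section KernelMap.
Variables (A B A' B' : zmodType).
Variables (f : {additive A -> B}) (f' : {additive A' -> B'}).
Variables (u : {additive A -> A'}) (uf : forall x, f x = 0 -> f' (u x) = 0).

Fact ker_map_subproof (x : kernel f) : u (val x) \in kernel_pred f'.
Proof. by apply/eqP/uf/kernelP. Qed.

Definition ker_map (x : kernel f) : kernel f' := Kernel (ker_map_subproof x).

Fact ker_map_is_additive : zmod_morphism ker_map.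
Proof. by move=> x y; apply: val_inj; rewrite /= !raddfB. Qed.
HB.instance Definition _ :=
  GRing.isZmodMorphism.Build (kernel f) (kernel f') ker_map ker_map_is_additive.
End KernelMap.

Definition qproj (A : zmodType) (I : zmodClosed A) :
  {additive A -> Quotient.quot I} := \pi_(Quotient.quot I).

Lemma qproj_eq0 (A : zmodType) (I : zmodClosed A) (x : A) :
  (qproj I x == 0) = (x \in I).
Proof.
by rewrite /qproj /= -[RHS]subr0 -{2}[x]subr0 Quotient.idealrBE subr0 -(raddf0 (qproj I)).
Qed.

Definition qlift (A C : zmodType) (I : zmodClosed A) (f : {additive A -> C})
  & (forall x, x \in I -> f x = 0) := fun x : Quotient.quot I => f (repr x).

Section QuotientLift.
Variables (A C : zmodType) (I : zmodClosed A) (f : {additive A -> C}).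
Hypothesis fI : forall x, x \in I -> f x = 0.

Local Notation qlift := (qlift fI).

Lemma qlift_proj x : qlift (qproj I x) = f x.
Proof.
apply/eqP; rewrite /qlift -subr_eq0 -raddfB; apply/eqP/fI.
by rewrite Quotient.idealrBE reprK.
Qed.

Fact qlift_is_additive : zmod_morphism qlift.
Proof.
move=> x y; rewrite -[x]reprK -[y]reprK.
by rewrite -[_ - _](raddfB (qproj I)) !qlift_proj raddfB.
Qed.
HB.instance Definition _ :=
  GRing.isZmodMorphism.Build (Quotient.quot I) C qlift qlift_is_additive.
End QuotientLift.

Section Span.
Variables (A : zmodType) (S : set A).

Definition span : {pred A} := fun x =>
  `[< forall I : zmodClosed A, (forall y, S y -> y \in I) -> x \in I >].

Fact span_zmod_closed : zmod_closed span.
Proof.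
split=> [|x y /asboolP xS /asboolP yS]; apply/asboolP => I SI.
  exact: rpred0.
by apply: rpredB; [apply: xS|apply: yS].
Qed.
HB.instance Definition _ := GRing.isZmodClosed.Build A span span_zmod_closed.

Lemma mem_span x : S x -> x \in span.
Proof. by move=> Sx; apply/asboolP => I; apply. Qed.

Lemma span_kills (B : zmodType) (f : {additive A -> B}) :
  (forall x, S x -> f x = 0) -> forall x, x \in span -> f x = 0.
Proof.
move=> fS x /asboolP/(_ (kernel_pred f)) xf; apply/eqP/xf => y Sy.
exact/eqP/fS.
Qed.
End Span.

Inductive tensor_relator (A B : zmodType) : set {freeg (A * B)%type} :=
| TensorDl a a' b :
    tensor_relator (<< (a + a', b) >> - << (a, b) >> - << (a', b) >>)
| TensorDr a b b' :
    tensor_relator (<< (a, b + b') >> - << (a, b) >> - << (a, b') >>).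

Definition tensor (A B : zmodType) : zmodType :=
  Quotient.quot (span (@tensor_relator A B)).

Definition tens (A B : zmodType) (a : A) (b : B) : tensor A B :=
  qproj (span (@tensor_relator A B)) << (a, b) >>.

Lemma tensDl (A B : zmodType) (a a' : A) (b : B) :
  tens (a + a') b = tens a b + tens a' b.
Proof.
apply/eqP; rewrite -subr_eq0 opprD addrA /tens -!raddfB qproj_eq0.
exact/mem_span/TensorDl.
Qed.

Lemma tensDr (A B : zmodType) (a : A) (b b' : B) :
  tens a (b + b') = tens a b + tens a b'.
Proof.
apply/eqP; rewrite -subr_eq0 opprD addrA /tens -!raddfB qproj_eq0.
exact/mem_span/TensorDr.
Qed.

Section TensorMap.
Variables (A B A' B' : zmodType).
Variables (f : {additive A -> A'}) (g : {additive B -> B'}).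

Fact tensor_map_subproof x : x \in span (@tensor_relator A B) ->
  flift (fun p : A * B => tens (f p.1) (g p.2)) x = 0.
Proof.
apply: span_kills => {}x [a a' b|a b b']; rewrite !raddfB /= !fliftU /= raddfD.
  by rewrite tensDl addrAC addrK subrr.
by rewrite tensDr addrAC addrK subrr.
Qed.

Definition tensor_map : {additive tensor A B -> tensor A' B'} :=
  qlift tensor_map_subproof.

Lemma tensor_mapE a b : tensor_map (tens a b) = tens (f a) (g b).
Proof. exact: etrans (qlift_proj _ _) (fliftU _ _). Qed.
End TensorMap.

Lemma tensor_additive_eq (A B C : zmodType) (g h : {additive tensor A B -> C}) :
  (forall a b, g (tens a b) = h (tens a b)) -> g =1 h.
Proof.
move=> gh x; rewrite -[x]reprK.
apply: (freeg_additive_eq (g := g \o qproj _) (h := h \o qproj _)) => -[a b].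
exact: gh.
Qed.

(* [Tor A B] is computed from the free resolution
   [0 -> kernel (free_aug A) -> {freeg A} -> A -> 0]. *)
Definition free_aug (A : zmodType) : {additive {freeg A} -> A} := flift id.

Definition free_map (A B : zmodType) (f : A -> B) :
  {additive {freeg A} -> {freeg B}} := flift (fun a => << f a >>).

Lemma free_aug_map (A B : zmodType) (f : {additive A -> B}) x :
  free_aug B (free_map f x) = f (free_aug A x).
Proof.
apply: (freeg_additive_eq (g := free_aug B \o free_map f)
                          (h := f \o free_aug A)) => a /=.
by rewrite !fliftU.
Qed.

Definition syzygy (A : zmodType) : zmodType := kernel (free_aug A).

Section SyzygyMap.
Variables (A B : zmodType) (f : {additive A -> B}).

Fact syzygy_map_subproof x :
  free_aug A x = 0 -> free_aug B (free_map f x) = 0.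
Proof. by rewrite free_aug_map => ->; rewrite raddf0. Qed.

Definition syzygy_map : {additive syzygy A -> syzygy B} :=
  ker_map syzygy_map_subproof.
End SyzygyMap.

Definition tor_diff (A B : zmodType) :
  {additive tensor (syzygy A) B -> tensor {freeg A} B} :=
  tensor_map (ker_incl (free_aug A)) idfun.

Definition Tor (A B : zmodType) : zmodType := kernel (tor_diff A B).

Section TorMap.
Variables (A B A' B' : zmodType).
Variables (f : {additive A -> A'}) (g : {additive B -> B'}).

Fact Tor_map_subproof x :
  tor_diff A B x = 0 -> tor_diff A' B' (tensor_map (syzygy_map f) g x) = 0.
Proof.
move=> x0; have -> : tor_diff A' B' (tensor_map (syzygy_map f) g x) =
    tensor_map (free_map f) g (tor_diff A B x).
  apply: (tensor_additive_eq
    (g := tor_diff A' B' \o tensor_map (syzygy_map f) g)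
    (h := tensor_map (free_map f) g \o tor_diff A B)) => a b.
  change (tor_diff A' B' (tensor_map (syzygy_map f) g (tens a b)) =
          tensor_map (free_map f) g (tor_diff A B (tens a b))).
  by rewrite /tor_diff !tensor_mapE.
by rewrite x0 raddf0.
Qed.

Definition Tor_map : {additive Tor A B -> Tor A' B'} :=
  ker_map Tor_map_subproof.
End TorMap.

Section DirectProduct.
Variables (I : Type) (A : I -> zmodType).

Definition dprod := forall i, A i.

HB.instance Definition _ := gen_eqMixin dprod.
HB.instance Definition _ := gen_choiceMixin dprod.

Definition dprod_add (x y : dprod) : dprod := fun i => x i + y i.
Definition dprod_opp (x : dprod) : dprod := fun i => - x i.

Fact dprod_addA : associative dprod_add.
Proof. by move=> x y z; apply: functional_extensionality_dep => i; apply: addrA. Qed.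
Fact dprod_addC : commutative dprod_add.
Proof. by move=> x y; apply: functional_extensionality_dep => i; apply: addrC. Qed.
Fact dprod_add0 : left_id (fun=> 0) dprod_add.
Proof. by move=> x; apply: functional_extensionality_dep => i; apply: add0r. Qed.
Fact dprod_addN : left_inverse (fun=> 0) dprod_opp dprod_add.
Proof. by move=> x; apply: functional_extensionality_dep => i; apply: addNr. Qed.
HB.instance Definition _ := GRing.isZmodule.Build dprod
  dprod_addA dprod_addC dprod_add0 dprod_addN.

Definition fin_supp : {pred dprod} := fun x =>
  `[< finite_set [set i | x i <> 0]%classic >].

Fact fin_supp_zmod_closed : zmod_closed fin_supp.
Proof.
split=> [|x y /asboolP xf /asboolP yf]; apply/asboolP.
  by apply: (@sub_finite_set _ _ set0) => // i /=.
apply: (@sub_finite_set _ _ ([set i | x i <> 0] `|` [set i | y i <> 0])%classic).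
  move=> i /= xy; apply: contrapT => /not_orP[/contrapT x0 /contrapT y0].
  by apply: xy; change (x i - y i = 0); rewrite x0 y0 subrr.
by rewrite finite_setU.
Qed.
HB.instance Definition _ :=
  GRing.isZmodClosed.Build dprod fin_supp fin_supp_zmod_closed.

Record dsum := DSum { dsum_val : dprod; _ : dsum_val \in fin_supp }.
HB.instance Definition _ := [isSub for dsum_val].
HB.instance Definition _ := [Choice of dsum by <:].
HB.instance Definition _ := [SubChoice_isSubZmodule of dsum by <:].
End DirectProduct.

Section DirectSumMap.
Variables (I : Type) (A B : I -> zmodType).
Variable f : forall i, {additive A i -> B i}.

Fact dsum_map_subproof (x : dsum A) :
  (fun i => f i (dsum_val x i)) \in @fin_supp I B.
Proof.
case: x => x /= /asboolP xf; apply/asboolP; apply: sub_finite_set xf => i /= fx.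
by move=> x0; apply: fx; rewrite x0 raddf0.
Qed.

Definition dsum_map (x : dsum A) : dsum B := DSum (dsum_map_subproof x).

Fact dsum_map_is_additive : zmod_morphism dsum_map.
Proof.
move=> x y; apply: val_inj; apply: functional_extensionality_dep => i /=.
exact: raddfB.
Qed.
HB.instance Definition _ :=
  GRing.isZmodMorphism.Build (dsum A) (dsum B) dsum_map dsum_map_is_additive.
End DirectSumMap.

Definition short_exact (A B C : zmodType)
    (f : {additive A -> B}) (g : {additive B -> C}) : Prop :=
  [/\ injective f,
      forall b, g b = 0 <-> exists a, f a = b
    & forall c, exists b, g b = c].

Section UnitZmodule.
Let add (_ _ : unit) := tt.
Let opp (_ : unit) := tt.
Fact unit_addA : associative add. Proof. by []. Qed.
Fact unit_addC : commutative add. Proof. by []. Qed.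
Fact unit_add0 : left_id tt add. Proof. by case. Qed.
Fact unit_addN : left_inverse tt opp add. Proof. by []. Qed.
HB.instance Definition _ :=
  GRing.isZmodule.Build unit unit_addA unit_addC unit_add0 unit_addN.
End UnitZmodule.

(* Distances lie in [0, +oo]. Any type can serve as the set of points,
   as [{classic T}]. *)
Record gmetric (R : realType) := GMetric {
  gpoint :> choiceType;
  gdist : gpoint -> gpoint -> \bar R;
  gdist_ge0 : forall x y, (0 <= gdist x y)%E;
  gdistxx : forall x, gdist x x = 0%E;
  gdist_triangle : forall x y z, (gdist x z <= gdist x y + gdist y z)%E
}.

Record short_map (R : realType) (X Y : gmetric R) := ShortMap {
  short_fun :> X -> Y;
  short_funP : forall x x', (gdist (short_fun x) (short_fun x') <= gdist x x')%E
}.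

Section GProd.
Variables (R : realType) (X Y : gmetric R).

Definition gprod_dist (p q : X * Y) : \bar R :=
  (gdist p.1 q.1 + gdist p.2 q.2)%E.

Fact gprod_dist_ge0 p q : (0 <= gprod_dist p q)%E.
Proof. by rewrite adde_ge0 ?gdist_ge0. Qed.
Fact gprod_distxx p : gprod_dist p p = 0%E.
Proof. by rewrite /gprod_dist !gdistxx adde0. Qed.
Fact gprod_dist_triangle p q r :
  (gprod_dist p r <= gprod_dist p q + gprod_dist q r)%E.
Proof.
rewrite /gprod_dist addeACA.
by rewrite leeD ?gdist_triangle.
Qed.

Definition gprod : gmetric R :=
  @GMetric R (X * Y)%type gprod_dist
    gprod_dist_ge0 gprod_distxx gprod_dist_triangle.
End GProd.

Section GProdMap.
Variables (R : realType) (X Y X' Y' : gmetric R).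
Variables (f : short_map X X') (g : short_map Y Y').

Definition gprod_fun (p : gprod X Y) : gprod X' Y' := (f p.1, g p.2).

Fact gprod_funP p q : (gdist (gprod_fun p) (gprod_fun q) <= gdist p q)%E.
Proof. by rewrite /gdist/= /gprod_dist leeD ?short_funP. Qed.

Definition gprod_map : short_map (gprod X Y) (gprod X' Y') :=
  ShortMap gprod_funP.
End GProdMap.

Section Tuples.
Variables (R : realType) (X : gmetric R).

(* [widen_ord (leqnSn n) i] and [lift ord0 i] have values [i] and [i.+1]. *)
Definition tuple_length n (x : {ffun 'I_n.+1 -> X}) : \bar R :=
  (\sum_(i < n) gdist (x (widen_ord (leqnSn n) i)) (x (lift ord0 i)))%E.

Definition tuple_delete n (i : 'I_n.+2) (x : {ffun 'I_n.+2 -> X}) :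
  {ffun 'I_n.+1 -> X} := [ffun j => x (lift i j)].

Definition msimplex n (l : R) :=
  {x : {ffun 'I_n.+1 -> X} | tuple_length x == l%:E}.

Definition MB n (l : R) : zmodType := {freeg (msimplex n l)}.

(* A tuple is sent to [0] when its length is not [l]: faces and short maps
   never increase length, and they act as [0] on a tuple that they shorten. *)
Definition mbasis n l (x : {ffun 'I_n.+1 -> X}) : MB n l :=
  if insub x is Some u then << (u : msimplex n l) >> else 0.

Definition mface n l (i : 'I_n.+2) : {additive MB n.+1 l -> MB n l} :=
  flift (fun u : msimplex n.+1 l => mbasis l (tuple_delete i (val u))).

Definition mbnd n l (c : MB n.+1 l) : MB n l :=
  \sum_(i < n.+2) mface l i c *~ (-1) ^+ i.

Fact mbnd_is_additive n l : zmod_morphism (@mbnd n l).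
Proof.
move=> x y; rewrite /mbnd -sumrB; apply: eq_bigr => i _.
by rewrite raddfB mulrzBl.
Qed.
HB.instance Definition _ n l :=
  GRing.isZmodMorphism.Build (MB n.+1 l) (MB n l) (@mbnd n l)
    (@mbnd_is_additive n l).

Definition mdiff n l : {additive MB n l -> MB n.-1 l} :=
  match n return {additive MB n l -> MB n.-1 l} with
  | 0 => \0
  | m.+1 => @mbnd m l
  end.

Definition mcycle n l : zmodType := kernel (mdiff n l).

Definition mboundary n l : {pred mcycle n l} := fun z =>
  `[< exists c : MB n.+1 l, mdiff n.+1 l c = val z >].

Fact mboundary_zmod_closed n l : zmod_closed (@mboundary n l).
Proof.
split=> [|x y /asboolP[a ax] /asboolP[b bY]]; apply/asboolP.
  by exists 0; rewrite raddf0.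
by exists (a - b); rewrite raddfB ax bY.
Qed.
HB.instance Definition _ n l := GRing.isZmodClosed.Build (mcycle n l)
  (@mboundary n l) (@mboundary_zmod_closed n l).

Definition MH n l : zmodType := Quotient.quot (@mboundary n l).

(* Magnitude homology in degree [k - 1], which is [0] for [k = 0]. *)
Definition MHpred k l : zmodType := if k is k'.+1 then MH k' l else unit.

Lemma tuple_lengthS n (x : {ffun 'I_n.+2 -> X}) :
  tuple_length x =
  (gdist (x ord0) (x (lift ord0 ord0)) + tuple_length (tuple_delete ord0 x))%E.
Proof.
rewrite /tuple_length big_ord_recl; congr (gdist (x _) _ + _)%E.
  exact: ord_inj.
apply: eq_bigr => i _; rewrite !ffunE; congr (gdist (x _) _).
exact: ord_inj.
Qed.

Lemma tuple_length_delete n (i : 'I_n.+2) (x : {ffun 'I_n.+2 -> X}) :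
  (tuple_length (tuple_delete i x) <= tuple_length x)%E.
Proof.
case: (unliftP ord0 i) => [j ->|->]; last first.
  by rewrite tuple_lengthS leeDr ?gdist_ge0.
elim: n j i x => [|n IHn] j _ x.
  rewrite /tuple_length big_ord0 sume_ge0 // => k _; exact: gdist_ge0.
have comm : tuple_delete ord0 (tuple_delete (lift ord0 j) x) =
            tuple_delete j (tuple_delete ord0 x).
  apply/ffunP => k; rewrite !ffunE; congr (x _); apply: ord_inj => /=.
  by rewrite /bump /= !add1n ltnS addnS.
rewrite tuple_lengthS comm [leRHS]tuple_lengthS !ffunE.
have -> : lift (lift ord0 j) ord0 = ord0 by exact: ord_inj.
case: (unliftP ord0 j) => [k ->|->].
  have -> : lift (lift ord0 (lift ord0 k)) (lift ord0 ord0) = lift ord0 ord0.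
    exact: ord_inj.
  by rewrite leeD // IHn.
rewrite [in leRHS]tuple_lengthS addeA leeD //.
have -> : lift (lift ord0 ord0) (lift ord0 ord0) = lift ord0 (lift ord0 ord0)
    :> 'I_n.+3 by exact: ord_inj.
by rewrite !ffunE; exact: gdist_triangle.
Qed.
End Tuples.

Section Functoriality.
Variables (R : realType) (X Y : gmetric R) (f : short_map X Y).

Definition tuple_map n (x : {ffun 'I_n.+1 -> X}) : {ffun 'I_n.+1 -> Y} :=
  [ffun j => f (x j)].

Lemma tuple_length_map n (x : {ffun 'I_n.+1 -> X}) :
  (tuple_length (tuple_map x) <= tuple_length x)%E.
Proof. by apply: lee_sum => i _; rewrite !ffunE short_funP. Qed.

Definition MB_map n l : {additive MB X n l -> MB Y n l} :=
  flift (fun u : msimplex X n l => mbasis l (tuple_map (val u))).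

Lemma MB_map_face n l (i : 'I_n.+2) c :
  mface Y l i (MB_map n.+1 l c) = MB_map n l (mface X l i c).
Proof.
apply: (freeg_additive_eq (g := mface Y l i \o MB_map n.+1 l)
                          (h := MB_map n l \o mface X l i)) => u /=.
rewrite /MB_map /mface /= !fliftU /mbasis.
have lu : tuple_length (val u) = l%:E by apply/eqP/(valP u).
have dm : tuple_map (tuple_delete i (val u)) =
          tuple_delete i (tuple_map (val u)).
  by apply/ffunP => j; rewrite !ffunE.
have le1 := tuple_length_map (val u).
have le2 := tuple_length_delete i (val u).
have le3 := tuple_length_map (tuple_delete i (val u)).
have le4 := tuple_length_delete i (tuple_map (val u)).
rewrite lu in le1 le2; rewrite dm in le3.
case: insubP => [v _ vE|nv]; case: insubP => [w _ wE|nw].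
- by rewrite !fliftU /= vE wE dm.
- rewrite fliftU raddf0 /= vE insubN //; apply: contraNN nw => /eqP q.
  by move: le3; rewrite q eq_le le2.
- rewrite raddf0 fliftU /= wE dm insubN //; apply: contraNN nv => /eqP q.
  by move: le4; rewrite q eq_le le1.
- by rewrite !raddf0.
Qed.

Lemma MB_map_bnd n l c : mbnd (MB_map n.+1 l c) = MB_map n l (mbnd c).
Proof.
rewrite /mbnd raddf_sum; apply: eq_bigr => i _.
by rewrite raddfMz MB_map_face.
Qed.

Fact mcycle_map_subproof n l c :
  mdiff X n l c = 0 -> mdiff Y n l (MB_map n l c) = 0.
Proof. by case: n c => //= n c c0; rewrite MB_map_bnd c0 raddf0. Qed.

Definition mcycle_map n l : {additive mcycle X n l -> mcycle Y n l} :=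
  ker_map (@mcycle_map_subproof n l).

Fact MH_map_subproof n l z : z \in @mboundary R X n l ->
  (qproj (@mboundary R Y n l) \o mcycle_map n l) z = 0.
Proof.
move=> /asboolP[c cz]; apply/eqP; rewrite qproj_eq0; apply/asboolP.
by exists (MB_map n.+1 l c); rewrite /= MB_map_bnd cz.
Qed.

Definition MH_map n l : {additive MH X n l -> MH Y n l} :=
  qlift (@MH_map_subproof n l).

Definition MHpred_map k l : {additive MHpred X k l -> MHpred Y k l} :=
  match k return {additive MHpred X k l -> MHpred Y k l} with
  | 0 => idfun
  | k'.+1 => MH_map k' l
  end.
End Functoriality.

(* The proof fields are equalities in [eqType]s, hence irrelevant: each
   [(r, s, j, k)] occurs once as an index. *)
Record kunneth_index (R : realType) (n : nat) (l : R) := KunnethIndex {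
  kr : R; ks : R; kj : nat; kk : nat;
  kr_ge0 : 0 <= kr;
  ks_ge0 : 0 <= ks;
  krsE : kr + ks = l;
  kjkE : (kj + kk)%N = n
}.

Section Kunneth.
Variables (R : realType) (n : nat) (l : R).

Definition kunneth_tensor (X Y : gmetric R) : zmodType :=
  dsum (fun i : kunneth_index n l =>
          tensor (MH X (kj i) (kr i)) (MH Y (kk i) (ks i))).

Definition kunneth_Tor (X Y : gmetric R) : zmodType :=
  dsum (fun i : kunneth_index n l =>
          Tor (MH X (kj i) (kr i)) (MHpred Y (kk i) (ks i))).

Section Maps.
Variables (X Y X' Y' : gmetric R) (f : short_map X X') (g : short_map Y Y').

Definition kunneth_tensor_map :
    {additive kunneth_tensor X Y -> kunneth_tensor X' Y'} :=
  dsum_map (fun i : kunneth_index n l =>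
    tensor_map (MH_map f (kj i) (kr i)) (MH_map g (kk i) (ks i))).

Definition kunneth_Tor_map :
    {additive kunneth_Tor X Y -> kunneth_Tor X' Y'} :=
  dsum_map (fun i : kunneth_index n l =>
    Tor_map (MH_map f (kj i) (kr i)) (MHpred_map g (kk i) (ks i))).
End Maps.
End Kunneth.

(* Main.v *)
From HB Require Import structures.
From mathcomp.multinomials Require Import freeg.
From mathcomp Require Import all_boot all_order all_algebra.
From mathcomp Require Import boolp classical_sets cardinality wochoice.
From mathcomp Require Import constructive_ereal reals.
From mathcomp Require Import ssrAC.
Require Import Defs.

(** Up to chain homotopy, the magnitude chains of a product are the tensor
    product of the magnitude chains of the factors; the sequence is then the
    algebraic Kunneth sequence of two complexes of free abelian groups.

    The homotopy equivalence is built on all tuples of points, without regard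
    to lengths. There the chains are contractible, towards any point, by the
    cone that prefixes the point; so are the pairs of tuples, see [bd_cone] and
    [bd2_cone2]. Hence the maps of Eilenberg and Zilber, of Alexander and
    Whitney, and the homotopies between their composites and the identity can be
    defined by recursion over the boundary, always with a cone over the first
    point of the given tuple ([cmp_bd], [htpy_bd]). Deletion of a point and
    repetition of the first point do not make a tuple longer, by the triangle
    inequality and since points have distance zero to themselves ([shrinks]).
    So all these maps respect the filtration by length, and they act on the
    graded pieces, among which are the magnitude chains ([gr_proj],
    [mproj_bd]). The recursion involves no choice and is strictly natural.

    For the algebraic part, a subgroup of a free abelian group is free, so
    boundaries split off and there is a retraction [ret] of chains to cycles; it
    induces a chain map [hproj] from the chains to the homology. The tensor
    product of two such maps is a retraction of the map [alpha] from the tensor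
    part. This gives the injectivity of [alpha] and the splitting at once. The
    map [beta] applies to the component of a cycle in bidegree [(j + 1, k)] the
    class on the right, and on the left the differential followed by a lift
    [lam] to the standard free resolution of homology. That [beta] is onto, with
    the image of [alpha] as kernel, is proved in two steps: a cycle of the tensor
    product is given, up to boundaries, by cycles with coefficients in the
    homology of the second factor ([hproj0_boundary]), and for these the
    universal coefficient sequence compares the resolution by boundaries and
    cycles with the standard one ([uct_injective], [uct_surjective]). Other
    retractions change the chain map that underlies [beta] by terms that vanish
    on cycles, whence its naturality ([bcomp_natural]).

    No splitting is natural already in length zero, where the magnitude chains
    of a poset are those of its nerve. Let a projective plane map to a sphere
    with degree one modulo two. With a loop in the plane and a disk whose
    boundary is twice the loop, the sum of disk times loop and loop times disk
    is a cycle on the square of the plane, of degree three. Its torsion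
    component dies in the product of the sphere and the plane, so a natural
    splitting would move it by an element of the tensor part to a class that
    dies there as well. But its image there is the class of the sphere times the
    loop, which does not come from the tensor part, because the plane has no
    integral homology in degree two. *)

Set Implicit Arguments.
Unset Strict Implicit.
Unset Printing Implicit Defensive.

Import Order.TTheory GRing.Theory Num.Theory.

Local Open Scope ring_scope.

(** * Subgroups, kernels and generators *)

Section SpanInd.
Variables (A : zmodType) (S : set A) (P : A -> Prop).
Hypotheses (P0 : P 0) (PB : forall x y, P x -> P y -> P (x - y)).

Let asP : {pred A} := fun x => `[< P x >].
Fact asP_closed : zmod_closed asP.
Proof.
split=> [|x y /asboolP Px /asboolP Py]; apply/asboolP => //; exact: PB.
Qed.
HB.instance Definition _ := GRing.isZmodClosed.Build A asP asP_closed.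

Lemma span_ind : (forall x, S x -> P x) -> forall x, x \in span S -> P x.
Proof.
move=> PS x /asboolP /(_ asP) xS; apply/asboolP/xS => y Sy.
exact/asboolP/PS.
Qed.
End SpanInd.

Lemma span_incl (A : zmodType) (S S' : set A) :
  (forall x, S x -> S' x) -> forall x, x \in span S -> x \in span S'.
Proof.
move=> SS'; apply: span_ind; first exact: rpred0.
- by move=> x y; apply: rpredB.
- by move=> x Sx; apply: mem_span; apply: SS'.
Qed.

Lemma freeg_ind (K : choiceType) (P : {freeg K} -> Prop) :
  P 0 -> (forall x y, P x -> P y -> P (x - y)) -> (forall k, P << k >>) ->
  forall x, P x.
Proof.
move=> P0 PB PU x.
have PN y : P y -> P (- y) by move=> Py; rewrite -sub0r; apply: PB.
have PD y z : P y -> P z -> P (y + z).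
  by move=> Py Pz; rewrite -[z]opprK; apply: PB => //; apply: PN.
rewrite -[x]freeg_sumE; apply: big_ind => // k _.
rewrite -[coeff k x]intz -freegU_mulz.
have PM n : P (<< k >> *+ n).
  by elim: n => [|n IHn]; rewrite ?mulr0n // mulrS; exact: PD.
by case: (coeff k x) => n; [apply: PM | apply: PN; apply: PM].
Qed.

Section KernelLift.
Variables (A B C : zmodType) (f : {additive B -> C}) (g : {additive A -> B}).
Hypothesis fg0 : forall a, f (g a) = 0.

Fact ker_lift_subproof a : g a \in kernel_pred f.
Proof. exact/eqP/fg0. Qed.

Definition ker_lift_fun a : kernel f := Kernel (ker_lift_subproof a).

Fact ker_lift_is_additive : zmod_morphism ker_lift_fun.
Proof. by move=> x y; apply: val_inj; rewrite /= raddfB. Qed.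
HB.instance Definition _ :=
  GRing.isZmodMorphism.Build A (kernel f) ker_lift_fun ker_lift_is_additive.

Definition ker_lift : {additive A -> kernel f} := ker_lift_fun.

Lemma ker_liftE a : val (ker_lift a) = g a. Proof. by []. Qed.
End KernelLift.

(** A function that is only known to satisfy a defining property that is
    additive and has unique solutions is itself additive: this is how additive
    maps are obtained from pointwise choices. *)
Lemma additive_choice (A B : zmodType) (P : A -> B -> Prop) :
  (forall a, exists b, P a b) ->
  (forall a b b', P a b -> P a b' -> b = b') ->
  (forall a a' b b', P a b -> P a' b' -> P (a - a') (b - b')) ->
  exists f : {additive A -> B}, forall a, P a (f a).
Proof.
move=> exP uniqP addP; pose f a := projT1 (cid (exP a)).
have fP a : P a (f a) by rewrite /f; case: cid.
have fB : zmod_morphism f.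
  by move=> x y; apply: uniqP (fP (x - y)) _; apply: addP.
pose fA := HB.pack_for {additive A -> B} f
  (GRing.isZmodMorphism.Build A B f fB).
by exists fA.
Qed.

Lemma additive_factor (A Q C : zmodType) (q : {additive A -> Q})
    (g : {additive A -> C}) :
  (forall y, exists x, q x = y) -> (forall x, q x = 0 -> g x = 0) ->
  exists h : {additive Q -> C}, forall x, h (q x) = g x.
Proof.
move=> q_surj qg0.
have [|||h hP] :=
    @additive_choice Q C (fun y c => exists2 x, q x = y & g x = c).
- by move=> y; have [x <-] := q_surj y; exists (g x), x.
- move=> y c c' [x xy <-] [x' x'y <-]; apply/eqP; rewrite -subr_eq0 -raddfB.
  by apply/eqP/qg0; rewrite raddfB xy x'y subrr.
- move=> y y' c c' [x <- <-] [x' <- <-].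
  by exists (x - x'); rewrite raddfB.
exists h => x; have [x' xx' <-] := hP (q x).
by apply/eqP; rewrite -subr_eq0 -raddfB; apply/eqP/qg0; rewrite raddfB xx' subrr.
Qed.

(** * Tensor products *)

Section TensorLift.
Variables (A B C : zmodType) (phi : A -> B -> C).
Hypotheses (phiBl : forall b, zmod_morphism (phi ^~ b))
           (phiBr : forall a, zmod_morphism (phi a)).

Fact tensor_lift_subproof x : x \in span (@tensor_relator A B) ->
  flift (fun p : A * B => phi p.1 p.2) x = 0.
Proof.
have phiDl a a' b : phi (a + a') b = phi a b + phi a' b.
  have phi0 : phi 0 b = 0 by rewrite -{1}(subrr 0) phiBl subrr.
  have phiN : phi (- a') b = - phi a' b by rewrite -sub0r phiBl phi0 sub0r.
  by rewrite -[in LHS](opprK a') phiBl phiN opprK.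
have phiDr a b b' : phi a (b + b') = phi a b + phi a b'.
  have phi0 : phi a 0 = 0 by rewrite -{1}(subrr 0) phiBr subrr.
  have phiN : phi a (- b') = - phi a b' by rewrite -sub0r phiBr phi0 sub0r.
  by rewrite -[in LHS](opprK b') phiBr phiN opprK.
apply: span_kills => {}x [a a' b|a b b']; rewrite !raddfB /= !fliftU /=.
  by rewrite phiDl addrAC addrK subrr.
by rewrite phiDr addrAC addrK subrr.
Qed.

Definition tensor_lift : {additive tensor A B -> C} :=
  qlift tensor_lift_subproof.

Lemma tensor_liftE a b : tensor_lift (tens a b) = phi a b.
Proof. exact: etrans (qlift_proj _ _) (fliftU _ _). Qed.
End TensorLift.

Section TensTheory.
Variables (A B : zmodType).
Implicit Types (a : A) (b : B).

Lemma tens0l b : tens (0 : A) b = 0.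
Proof. by apply: (addrI (tens 0 b)); rewrite -tensDl !addr0. Qed.

Lemma tens0r a : tens a (0 : B) = 0.
Proof. by apply: (addrI (tens a 0)); rewrite -tensDr !addr0. Qed.

Lemma tensBl b : zmod_morphism ((@tens A B) ^~ b).
Proof.
move=> a a'; apply/eqP; rewrite eq_sym subr_eq -tensDl subrK; exact/eqP.
Qed.

Lemma tensBr a : zmod_morphism (@tens A B a).
Proof.
move=> b b'; apply/eqP; rewrite eq_sym subr_eq -tensDr subrK; exact/eqP.
Qed.

Definition tensl b a := tens a b.
HB.instance Definition _ b :=
  GRing.isZmodMorphism.Build A (tensor A B) (tensl b) (tensBl b).
HB.instance Definition _ a :=
  GRing.isZmodMorphism.Build B (tensor A B) (tens a) (tensBr a).

Lemma tensMzl z a b : tens (a *~ z) b = tens a b *~ z.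
Proof. exact: (raddfMz (tensl b) z a). Qed.

Lemma tensMzr z a b : tens a (b *~ z) = tens a b *~ z.
Proof. exact: raddfMz. Qed.

Lemma tens_suml (I : Type) (r : seq I) (F : I -> A) b :
  tens (\sum_(i <- r) F i) b = \sum_(i <- r) tens (F i) b.
Proof. exact: (raddf_sum (tensl b)). Qed.

Lemma tensor_ind (P : tensor A B -> Prop) :
  P 0 -> (forall x y, P x -> P y -> P (x - y)) -> (forall a b, P (tens a b)) ->
  forall x, P x.
Proof.
move=> P0 PB PU x; rewrite -[x]reprK.
apply: (@freeg_ind _ (fun D => P (qproj (span (@tensor_relator A B)) D))).
- by rewrite raddf0.
- by move=> D D' PD PD'; rewrite raddfB; apply: PB.
- by case=> a b; apply: PU.
Qed.
End TensTheory.

Section TensorMapTheory.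
Variables (A B A' B' A'' B'' : zmodType).

Lemma tensor_map_comp (f : {additive A -> A'}) (g : {additive B -> B'})
    (f' : {additive A' -> A''}) (g' : {additive B' -> B''}) x :
  tensor_map f' g' (tensor_map f g x) = tensor_map (f' \o f) (g' \o g) x.
Proof.
move: x; apply: tensor_ind => [|x y xE yE|a b]; first by rewrite !raddf0.
  by rewrite !raddfB xE yE.
by rewrite !tensor_mapE.
Qed.

Lemma tensor_map_ext (f f' : {additive A -> A'}) (g g' : {additive B -> B'}) :
  f =1 f' -> g =1 g' -> tensor_map f g =1 tensor_map f' g'.
Proof.
move=> ff' gg'; apply: tensor_ind => [|x y xE yE|a b]; first by rewrite !raddf0.
  by rewrite !raddfB xE yE.
by rewrite !tensor_mapE ff' gg'.
Qed.

Lemma tensor_map0l (f : {additive A -> A'}) (g : {additive B -> B'}) x :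
  (forall a, f a = 0) -> tensor_map f g x = 0.
Proof.
move=> f0; move: x; apply: tensor_ind => [|x y xE yE|a b].
- exact: raddf0.
- by rewrite raddfB xE yE subrr.
- by rewrite tensor_mapE f0 tens0l.
Qed.

Lemma tensor_map0r (f : {additive A -> A'}) (g : {additive B -> B'}) x :
  (forall b, g b = 0) -> tensor_map f g x = 0.
Proof.
move=> g0; move: x; apply: tensor_ind => [|x y xE yE|a b].
- exact: raddf0.
- by rewrite raddfB xE yE subrr.
- by rewrite tensor_mapE g0 tens0r.
Qed.

Lemma tensor_map_surj (f : {additive A -> A'}) (g : {additive B -> B'}) :
  (forall a', exists a, f a = a') -> (forall b', exists b, g b = b') ->
  forall y, exists x, tensor_map f g x = y.
Proof.
move=> f_surj g_surj; apply: tensor_ind.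
- by exists 0; rewrite raddf0.
- by move=> _ _ [x <-] [y <-]; exists (x - y); rewrite raddfB.
- move=> a' b'; have [a <-] := f_surj a'; have [b <-] := g_surj b'.
  by exists (tens a b); rewrite tensor_mapE.
Qed.

(** Right exactness in both variables. The inverse of the map induced on the
    quotient by the span sends [tens a' b'] to the class of [tens a b] for any
    preimages [a] and [b]. *)
Lemma tensor_map_ker (f : {additive A -> A'}) (g : {additive B -> B'}) :
  (forall a', exists a, f a = a') -> (forall b', exists b, g b = b') ->
  forall x, tensor_map f g x = 0 ->
  x \in span (fun y => exists a b, (f a = 0 \/ g b = 0) /\ y = tens a b).
Proof.
move=> f_surj g_surj x x0; set S := fun y => _; rewrite -qproj_eq0; apply/eqP.
pose sf a' := projT1 (cid (f_surj a')); pose sg b' := projT1 (cid (g_surj b')).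
have sfK a' : f (sf a') = a' by rewrite /sf; case: cid.
have sgK b' : g (sg b') = b' by rewrite /sg; case: cid.
pose Q := Quotient.quot (span S); pose pi := qproj (span S).
have kill a b : f a = 0 \/ g b = 0 -> pi (tens a b) = 0.
  by move=> ab; apply/eqP; rewrite qproj_eq0; apply: mem_span; exists a, b.
have eql a a' b : f a = f a' -> pi (tens a b) = pi (tens a' b).
  move=> aa'; apply/eqP; rewrite -subr_eq0 -raddfB -tensBl; apply/eqP/kill.
  by left; rewrite raddfB aa' subrr.
have eqr a b b' : g b = g b' -> pi (tens a b) = pi (tens a b').
  move=> bb'; apply/eqP; rewrite -subr_eq0 -raddfB -tensBr; apply/eqP/kill.
  by right; rewrite raddfB bb' subrr.
pose phi a' b' : Q := pi (tens (sf a') (sg b')).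
have phiBl b' : zmod_morphism (phi ^~ b').
  move=> a1 a2; rewrite /phi -raddfB -tensBl; apply: eql.
  by rewrite raddfB !sfK.
have phiBr a' : zmod_morphism (phi a').
  move=> b1 b2; rewrite /phi -raddfB -tensBr; apply: eqr.
  by rewrite raddfB !sgK.
suff inv y : tensor_lift phiBl phiBr (tensor_map f g y) = pi y.
  by rewrite -[LHS]inv x0 raddf0.
move: y; apply: tensor_ind => [|y z yE zE|a b]; first by rewrite !raddf0.
  by rewrite !raddfB yE zE.
rewrite tensor_mapE tensor_liftE /phi (@eql _ a) ?sfK //.
by apply: eqr; rewrite sgK.
Qed.
End TensorMapTheory.

Section Swap.
Variables (A B : zmodType).

Definition tensor_swap : {additive tensor A B -> tensor B A} :=
  tensor_lift (phi := fun a b => tens b a)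
    (fun b => @tensBr B A b) (fun a => @tensBl B A a).

Lemma tensor_swapE a b : tensor_swap (tens a b) = tens b a.
Proof. exact: tensor_liftE. Qed.
End Swap.
Arguments tensor_swap {A B}.

Lemma tensor_swapK (A B : zmodType) : cancel (@tensor_swap A B) (@tensor_swap B A).
Proof.
apply: tensor_ind => [|x y xE yE|a b]; first by rewrite !raddf0.
  by rewrite !raddfB xE yE.
by rewrite !tensor_swapE.
Qed.

Lemma tensor_swap_map (A B A' B' : zmodType) (f : {additive A -> A'})
    (g : {additive B -> B'}) x :
  tensor_swap (tensor_map f g x) = tensor_map g f (tensor_swap x).
Proof.
move: x; apply: tensor_ind => [|x y xE yE|a b]; first by rewrite !raddf0.
  by rewrite !raddfB xE yE.
by rewrite !(tensor_mapE, tensor_swapE).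
Qed.

Section Coordinates.
Variables (K : choiceType) (A : zmodType).

Definition tcoord_fun (u : K) (D : {freeg K}) (a : A) : A := a *~ coeff u D.

Fact tcoordBl u a : zmod_morphism ((tcoord_fun u) ^~ a).
Proof. by move=> D D'; rewrite /tcoord_fun raddfB mulrzBr. Qed.

Fact tcoordBr u D : zmod_morphism (tcoord_fun u D).
Proof. by move=> a a'; rewrite /tcoord_fun mulrzBl. Qed.

Definition tcoord u : {additive tensor {freeg K} A -> A} :=
  tensor_lift (tcoordBl u) (tcoordBr u).

Lemma tcoordE u D a : tcoord u (tens D a) = a *~ coeff u D.
Proof. exact: tensor_liftE. Qed.

Lemma freeg_sum_superset (D : {freeg K}) s :
  uniq s -> {subset dom D <= s} -> \sum_(u <- s) << u >> *~ coeff u D = D.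
Proof.
move=> s_uniq Ds; rewrite -[RHS]freeg_sumE.
rewrite (bigID (mem (dom D))) /= [X in _ + X]big1 ?addr0 => [|u uD]; last first.
  by rewrite coeff_outdom.
rewrite -big_filter (perm_big (dom D)) /=.
  by apply: eq_bigr => u _; rewrite freegU_mulz intz.
apply: uniq_perm; rewrite ?filter_uniq ?uniq_dom // => u.
by rewrite mem_filter andb_idr //; apply: Ds.
Qed.

(** Any finite set of indices that contains the relevant ones serves, so that two
    elements can be written over a common one. *)
Lemma tensor_coords (x : tensor {freeg K} A) :
  exists s : seq K, forall s', uniq s' -> {subset s <= s'} ->
    x = \sum_(u <- s') tens << u >> (tcoord u x).
Proof.
move: x; apply: tensor_ind.
- exists [::] => s' _ _; rewrite big1 // => u _.
  by rewrite raddf0 tens0r.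
- move=> x y [s sE] [t tE]; exists (s ++ t) => s' s'_uniq sub.
  rewrite [x in LHS](sE s') // => [|u us]; last by rewrite sub ?mem_cat ?us.
  rewrite [y in LHS](tE s') // => [|u ut]; last by rewrite sub ?mem_cat ?ut ?orbT.
  by rewrite -sumrB; apply: eq_bigr => u _; rewrite raddfB tensBr.
- move=> D a; exists (dom D) => s' s'_uniq sub.
  rewrite -[D in LHS](freeg_sum_superset s'_uniq sub) tens_suml.
  by apply: eq_bigr => u _; rewrite tcoordE tensMzr tensMzl.
Qed.

Lemma tcoord_eq0 x : (forall u, tcoord u x = 0) -> x = 0.
Proof.
move=> x0; have [s sE] := tensor_coords x.
rewrite (sE (undup s)) ?undup_uniq // => [|u]; last by rewrite mem_undup.
by rewrite big1 // => u _; rewrite x0 tens0r.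
Qed.
End Coordinates.
Arguments tcoord {K A} u.

Lemma tcoord_map (K : choiceType) (A B : zmodType) (g : {additive A -> B}) u x :
  tcoord u (tensor_map (idfun : {additive {freeg K} -> {freeg K}}) g x) =
  g (tcoord u x).
Proof.
move: x; apply: tensor_ind => [|x y xE yE|D a]; first by rewrite !raddf0.
  by rewrite !raddfB xE yE.
by rewrite tensor_mapE !tcoordE raddfMz.
Qed.

(** Flatness of a free group, in the form that applies to the joint kernel of
    two maps: the coordinates of [x] satisfy the hypothesis. *)
Lemma free_tensor_detect (K : choiceType) (B C C' : zmodType)
    (g : {additive B -> C}) (g' : {additive B -> C'}) :
  (forall b, g b = 0 -> g' b = 0 -> b = 0) ->
  forall x : tensor {freeg K} B,
  tensor_map idfun g x = 0 -> tensor_map idfun g' x = 0 -> x = 0.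
Proof.
move=> gg' x gx g'x; apply: tcoord_eq0 => u; apply: gg'.
  by rewrite -tcoord_map gx raddf0.
by rewrite -tcoord_map g'x raddf0.
Qed.

Lemma free_tensor_kills (K : choiceType) (A B C : zmodType)
    (f : {additive A -> B}) (g : {additive A -> C}) :
  (forall a, f a = 0 -> g a = 0) ->
  forall x : tensor A {freeg K},
  tensor_map f idfun x = 0 -> tensor_map g idfun x = 0.
Proof.
move=> fg x fx; apply: (can_inj (@tensor_swapK _ _)).
rewrite raddf0 tensor_swap_map; apply: tcoord_eq0 => u.
by rewrite tcoord_map fg // -tcoord_map -tensor_swap_map fx !raddf0.
Qed.

(** * Direct sums *)

Section DirectSum.
Variables (I : choiceType) (A : I -> zmodType).

Definition dproj i (x : dsum A) : A i := dsum_val x i.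
Arguments dproj : simpl never.

Fact dproj_is_additive i : zmod_morphism (dproj i).
Proof. by []. Qed.
HB.instance Definition _ i :=
  GRing.isZmodMorphism.Build (dsum A) (A i) (dproj i) (dproj_is_additive i).

Lemma dsum_eqP (x y : dsum A) : (forall i, dproj i x = dproj i y) -> x = y.
Proof.
by move=> xy; apply: val_inj; apply: functional_extensionality_dep.
Qed.

Lemma dsum_support (x : dsum A) :
  exists s : seq I, uniq s /\ forall i, dproj i x <> 0 -> i \in s.
Proof.
have /asboolP/finite_seqP[s sE] : dsum_val x \in @fin_supp I A by case: x.
exists (undup s); split=> [|i xi]; first exact: undup_uniq.
by rewrite mem_undup; have : [set` s]%classic i by rewrite -sE.
Qed.

Fact dsum_mk_subproof (f : forall i, A i) (s : seq I) :
  (forall i, f i <> 0 -> i \in s) -> f \in @fin_supp I A.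
Proof.
move=> fs; apply/asboolP.
apply: (sub_finite_set (B := [set` s]%classic)) => [i|]; first exact: fs.
exact/finite_seqP/(ex_intro _ s).
Qed.

Definition dsum_mk f s fs : dsum A := DSum (@dsum_mk_subproof f s fs).

Definition dinj_val i (a : A i) (i' : I) : A i' :=
  match pselect (i = i') with
  | left e => eq_rect i A a i' e
  | right _ => 0
  end.

Lemma dinj_val_same i (a : A i) : dinj_val a i = a.
Proof.
by rewrite /dinj_val; case: pselect => // e; rewrite (Prop_irrelevance e erefl).
Qed.

Lemma dinj_val_diff i (a : A i) i' : i <> i' -> dinj_val a i' = 0.
Proof. by rewrite /dinj_val; case: pselect. Qed.

Fact dinj_subproof i (a : A i) i' : dinj_val a i' <> 0 -> i' \in [:: i].
Proof.
rewrite inE => ai; apply/eqP; apply: contrapT => ii'; apply: ai.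
by apply: dinj_val_diff => e; apply: ii'.
Qed.

Definition dinj i (a : A i) : dsum A := dsum_mk (@dinj_subproof i a).

Lemma dinj_same i (a : A i) : dproj i (dinj a) = a.
Proof. exact: dinj_val_same. Qed.

Lemma dinj_diff i (a : A i) i' : i <> i' -> dproj i' (dinj a) = 0.
Proof. exact: dinj_val_diff. Qed.

Fact dinj_is_additive i : zmod_morphism (@dinj i).
Proof.
move=> a b; apply: dsum_eqP => i'; rewrite raddfB /=.
have [<-|ii'] := pselect (i = i'); first by rewrite !dinj_same.
by rewrite !dinj_diff // subrr.
Qed.
HB.instance Definition _ i :=
  GRing.isZmodMorphism.Build (A i) (dsum A) (@dinj i) (@dinj_is_additive i).

Lemma dsum_sumE (x : dsum A) (s : seq I) :
  uniq s -> (forall i, dproj i x <> 0 -> i \in s) ->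
  x = \sum_(i <- s) dinj (dproj i x).
Proof.
move=> s_uniq xs; apply: dsum_eqP => j; rewrite raddf_sum /=.
have [js|/negP js] := boolP (j \in s).
  rewrite (bigD1_seq j) //= dinj_same big1 ?addr0 // => i /eqP ij.
  exact: dinj_diff.
rewrite big1_seq => [|i /= si].
  by apply: contrapT => /xs.
by apply: dinj_diff => ij; apply: js; rewrite -ij.
Qed.

Lemma dsum_ind (P : dsum A -> Prop) :
  P 0 -> (forall x y, P x -> P y -> P (x - y)) ->
  (forall i (a : A i), P (dinj a)) -> forall x, P x.
Proof.
move=> P0 PB PU x; have [s [s_uniq xs]] := dsum_support x.
rewrite (dsum_sumE s_uniq xs); apply: big_ind => // y z Py Pz.
by rewrite -[z]opprK; apply: (PB) => //; rewrite -sub0r; apply: PB.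
Qed.

Section Lift.
Variables (C : zmodType) (F : forall i, {additive A i -> C}).

Definition dlift_fun (x : dsum A) : C :=
  \sum_(i <- projT1 (cid (dsum_support x))) F i (dproj i x).

Lemma dlift_sumE (x : dsum A) (s : seq I) :
  uniq s -> (forall i, dproj i x <> 0 -> i \in s) ->
  dlift_fun x = \sum_(i <- s) F i (dproj i x).
Proof.
move=> s_uniq xs; rewrite /dlift_fun; case: cid => t /= [t_uniq xt].
have trim (r : seq I) : \sum_(i <- r) F i (dproj i x) =
    \sum_(i <- [seq i <- r | dproj i x != 0]) F i (dproj i x).
  rewrite big_filter (bigID (fun i => dproj i x == 0)) /= big1 ?add0r //.
  by move=> i /eqP ->; rewrite raddf0.
rewrite trim [RHS]trim; apply: perm_big; apply: uniq_perm.
- exact: filter_uniq.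
- exact: filter_uniq.
move=> i; rewrite !mem_filter; case: eqP => //= xi.
by rewrite xs // xt.
Qed.

Fact dlift_is_additive : zmod_morphism dlift_fun.
Proof.
move=> x y; have [s [_ xs]] := dsum_support x.
have [t [_ yt]] := dsum_support y.
pose r := undup (s ++ t); have r_uniq : uniq r := undup_uniq _.
have sr i : i \in s -> i \in r by rewrite mem_undup mem_cat => ->.
have tr i : i \in t -> i \in r by rewrite mem_undup mem_cat orbC => ->.
rewrite !(@dlift_sumE _ r) //.
- by rewrite -sumrB; apply: eq_bigr => i _; rewrite !raddfB.
- by move=> i /yt/tr.
- by move=> i /xs/sr.
move=> i; rewrite raddfB /= => xyi.
have [x0|/xs/sr//] := pselect (dproj i x = 0).
have [y0|/yt/tr//] := pselect (dproj i y = 0).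
by case: xyi; rewrite x0 y0 subrr.
Qed.
HB.instance Definition _ :=
  GRing.isZmodMorphism.Build (dsum A) C dlift_fun dlift_is_additive.

Definition dlift : {additive dsum A -> C} := dlift_fun.

Lemma dlift_inj i (a : A i) : dlift (dinj a) = F i a.
Proof.
rewrite [LHS](@dlift_sumE _ [:: i]) ?big_seq1 ?dinj_same // => j.
rewrite inE => aj; apply/eqP; apply: contrapT => ji.
by apply: aj; apply: dinj_diff => e; apply: ji.
Qed.
End Lift.

Section Family.
Variables (C : zmodType) (h : forall i, {additive C -> A i}).
Hypothesis h_fin : forall c, exists s : seq I, forall i, h i c <> 0 -> i \in s.

Definition dsum_fun_val (c : C) : dsum A := dsum_mk (projT2 (cid (h_fin c))).

Fact dsum_fun_is_additive : zmod_morphism dsum_fun_val.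
Proof. by move=> c c'; apply: dsum_eqP => i; rewrite [LHS]raddfB. Qed.
HB.instance Definition _ :=
  GRing.isZmodMorphism.Build C (dsum A) dsum_fun_val dsum_fun_is_additive.

Definition dsum_fun : {additive C -> dsum A} := dsum_fun_val.

End Family.
End DirectSum.
Arguments dproj {I A} i _ : simpl never.
Arguments dinj {I A} i _ : simpl never.

Lemma dprojB (I : choiceType) (A : I -> zmodType) (x y : dsum A) i :
  dproj i (x - y) = dproj i x - dproj i y.
Proof. by []. Qed.

Section DirectSumMaps.
Variables (I : choiceType) (A B : I -> zmodType).
Variable f : forall i, {additive A i -> B i}.

Lemma dsum_map_inj i (a : A i) : dsum_map f (dinj i a) = dinj i (f i a).
Proof.
apply: dsum_eqP => j; change (f j (dproj j (dinj i a)) = dproj j (dinj i (f i a))).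
have [<-|ij] := pselect (i = j); first by rewrite !dinj_same.
by rewrite !dinj_diff // raddf0.
Qed.

Lemma dproj_map i x : dproj i (dsum_map f x) = f i (dproj i x).
Proof. by []. Qed.

(** The choice of a preimage must be zero where the component is zero, for the
    support to stay finite. *)
Lemma dsum_lift_along (y : dsum B) :
  (forall i, exists a, f i a = dproj i y) -> exists x, dsum_map f x = y.
Proof.
move=> fy; have [s [_ ys]] := dsum_support y.
have fy' i : exists a, f i a = dproj i y /\ (dproj i y = 0 -> a = 0).
  have [y0|yi] := pselect (dproj i y = 0).
    by exists 0; rewrite y0 raddf0.
  by have [a fa] := fy i; exists a.
pose g i := projT1 (cid (fy' i)).
have gP i : f i (g i) = dproj i y /\ (dproj i y = 0 -> g i = 0).
  by rewrite /g; case: cid.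
have gs i : g i <> 0 -> i \in s.
  by move=> gi; apply: ys => yi; apply: gi; have [_ ->] := gP i.
exists (dsum_mk gs); apply: dsum_eqP => i; rewrite dproj_map.
by have [] := gP i.
Qed.
End DirectSumMaps.

(** * Subgroups of free abelian groups *)

(** The generator is an element of smallest nonzero absolute value, by division
    with remainder. *)
Lemma int_subgroup_gen (P : int -> Prop) :
  P 0 -> (forall m n, P m -> P n -> P (m - n)) ->
  exists2 n, P n & forall m, P m -> exists z, m = n * z.
Proof.
move=> P0 PB.
have PM m (k : int) : P m -> P (m * k).
  move=> Pm; have PN x : P x -> P (- x) by move=> Px; rewrite -sub0r; apply: PB.
  have PMn k' : P (m * k'%:Z).
    elim: k' => [|k' IHk]; first by rewrite mulr0.
    rewrite intS mulrDr mulr1 -[m * k'%:Z]opprK; apply: PB => //; exact: PN.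
  by case: k => k; rewrite ?NegzE ?mulrN; [|apply: PN]; apply: PMn.
have [[m [Pm m0]]|no] := pselect (exists m, P m /\ m != 0); last first.
  exists 0 => // m Pm; exists 0; rewrite mulr0; apply: contrapT => /eqP m0.
  by apply: no; exists m.
pose Q k := `[< exists2 x, P x & (x != 0) && (absz x == k) >].
have exQ : exists k, Q k by exists (absz m); apply/asboolP; exists m; rewrite ?m0 /=.
case: (ex_minnP exQ) => _ /asboolP[n Pn /andP[n0 /eqP <-]] nmin.
exists n => // x Px; exists (x %/ n)%Z.
have rE : x - n * (x %/ n)%Z = (x %% n)%Z.
  by rewrite {1}(divz_eq x n) mulrC addrAC subrr add0r.
apply/eqP; rewrite -subr_eq0 rE; apply: contraT => r0.
have Pr : P (x %% n)%Z by rewrite -rE; apply: PB => //; apply: PM.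
have : Q (absz (x %% n)%Z) by apply/asboolP; exists (x %% n)%Z; rewrite ?r0 /=.
move=> /nmin; rewrite leqNgt => /negP[].
by rewrite -ltz_nat abszE ger0_norm ?modz_ge0 // ltz_mod.
Qed.

Section FreeSplit.
Variables (A : zmodType) (L : choiceType) (f : {additive A -> {freeg L}}).

Let R : rel L := projT1 (well_ordering_principle L).
Let Rwo : well_order R. Proof. by rewrite /R; case: well_ordering_principle. Qed.

Let Rchain : wo_chain R predT.
Proof. by move=> C _; apply: Rwo. Qed.
Let Rtotal : total R.
Proof. by move=> x y; apply: (wo_chainW Rchain). Qed.
Let Ranti : antisymmetric R.
Proof. by move=> x y; apply: (wo_chain_antisymmetric Rchain). Qed.
Let Rtrans : transitive R.
Proof.
move=> y x z Rxy Ryz.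
have [|m [[mA mmin] _]] := Rwo (A := [in [:: x; y; z]]).
  by exists x; rewrite !inE eqxx.
have := mmin; rewrite /lower_bound => mm.
move: mA; rewrite !inE => /or3P[] /eqP e; subst m.
- by apply: mm; rewrite !inE eqxx !orbT.
- have /(_ x) := mm; rewrite !inE eqxx /= => /(_ isT) Ryx.
  by rewrite (@Ranti x y) // Rxy.
- have /(_ y) := mm; rewrite !inE eqxx orbT /= => /(_ isT) Rzy.
  by rewrite -(@Ranti y z) // Ryz.
Qed.

Let below l (D : {freeg L}) := forall u, coeff u D <> 0 -> R u l.

Let belowB l D D' : below l D -> below l D' -> below l (D - D').
Proof.
move=> lD lD' u; rewrite raddfB /= => uDD'.
have [D0|/eqP Du] := eqVneq (coeff u D) 0; last exact: lD.
by apply: lD' => D'u; apply: uDD'; rewrite D0 D'u subrr.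
Qed.

(* The leading coefficients at [l] form a subgroup of the integers; [c] has a
   generator of it as leading coefficient. *)
Let leader l : exists c, [/\ below l (f c),
    forall x, below l (f x) -> exists z, coeff l (f x) = coeff l (f c) * z
  & coeff l (f c) = 0 -> c = 0].
Proof.
have [|m n|n [c cl <-] ndiv] :=
    @int_subgroup_gen (fun m => exists2 c, below l (f c) & coeff l (f c) = m).
- exists 0; last by rewrite !raddf0.
  by move=> u; rewrite !raddf0.
- move=> [c cl <-] [c' cl' <-]; exists (c - c'); last by rewrite !raddfB.
  by rewrite raddfB; apply: belowB.
have [c0|c0] := pselect (coeff l (f c) = 0); last first.
  by exists c; split=> // x xl; apply: ndiv; exists x.
exists 0; split=> //; first by move=> u; rewrite !raddf0.
move=> x xl; have [|z ->] := ndiv (coeff l (f x)); first by exists x.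
by exists 0; rewrite c0 mul0r mulr0.
Qed.

Let c l := projT1 (cid (leader l)).
Let cP l : [/\ below l (f (c l)),
    forall x, below l (f x) -> exists z, coeff l (f x) = coeff l (f (c l)) * z
  & coeff l (f (c l)) = 0 -> c l = 0].
Proof. by rewrite /c; case: cid. Qed.

Let seq_max (s : seq L) : s != [::] -> exists2 m, m \in s & {in s, forall u, R u m}.
Proof.
elim: s => // a s IHs _; have [->|/IHs[m ms mmax]] := eqVneq s [::].
  exists a; rewrite ?inE // => u; rewrite inE => /eqP ->.
  by have := Rtotal a a; rewrite orbb.
have /orP[Ram|Rma] := Rtotal a m.
  exists m => [|u]; first by rewrite inE ms orbT.
  by rewrite inE => /orP[/eqP -> //|]; apply: mmax.
exists a => [|u]; first by rewrite inE eqxx.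
rewrite inE => /orP[/eqP -> |us].
  by have := Rtotal a a; rewrite orbb.
exact: Rtrans (mmax u us) Rma.
Qed.

Let g : {additive {freeg L} -> A} := flift c.

(* The image of [f] is generated by the [f (c l)], by well-founded induction
   on the leading index. *)
Let image_gen x : exists D, f (g D) = f x.
Proof.
suff main l : forall x, below l (f x) -> exists D, f (g D) = f x.
  have [fx0|] := eqVneq (f x) 0; first by exists 0; rewrite !raddf0.
  rewrite -dom_eq0 => /seq_max[m _ mmax]; apply: (main m) => u /eqP ux.
  by apply: mmax; rewrite mem_dom.
apply: contrapT => bad.
pose B := [pred l | `[< ~ forall x, below l (f x) -> exists D, f (g D) = f x >]].
have [|m [[/asboolP mB mmin] _]] := Rwo (A := B).
  by exists l; apply/asboolP.
apply: mB => {}x xm; have [cm cdiv _] := cP m; have [z zE] := cdiv x xm.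
pose x' := x - c m *~ z.
have x'm : coeff m (f x') = 0.
  by rewrite !raddfB !raddfMz /= zE mulNrz -mulrzr intz subrr.
have x'b : below m (f x').
  move=> u ux'; have [xu|] := pselect (coeff u (f x) <> 0); first exact: xm.
  move=> /contrapT xu; apply: cm => cu; apply: ux'.
  by rewrite !raddfB !raddfMz /= xu cu mulNrz mul0rz subrr.
suff [D DE] : exists D, f (g D) = f x'.
  exists (D + << m >> *~ z); rewrite !raddfD /= DE raddfB !raddfMz /= fliftU.
  by rewrite mulNrz subrK.
have [fx0|] := eqVneq (f x') 0; first by exists 0; rewrite !raddf0.
rewrite -dom_eq0 => /seq_max[m' m's m'max].
have m'm : coeff m' (f x') <> 0 by apply/eqP; rewrite -mem_dom.
apply: contrapT => noD.
have : m' \in B.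
  apply/asboolP => all; apply: noD; apply: all => u /eqP ux.
  by apply: m'max; rewrite mem_dom.
move=> /mmin Rmm'; apply: (m'm); have <- : m = m' by apply: Ranti; rewrite Rmm' x'b.
exact: x'm.
Qed.

(* Nonzero [f (c l)] have distinct leading indices, so a relation between them
   only involves those [l] with [c l = 0]. *)
Let relation_trivial D : f (g D) = 0 -> g D = 0.
Proof.
move=> D0; suff cD l : l \in dom D -> c l = 0.
  rewrite -[D]freeg_sumE raddf_sum big_seq big1 // => l lD.
  by rewrite -[coeff l D]intz -freegU_mulz raddfMz /= fliftU cD // mul0rz.
move=> lD; apply: contrapT => cl.
have : [seq l <- dom D | c l != 0] != [::].
  by rewrite -has_filter; apply/hasP; exists l => //; apply/eqP.
move=> /seq_max[m]; rewrite mem_filter => /andP[cm mD] mmax.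
have [mb _ /contra_not m0] := cP m.
have {m0} mm : coeff m (f (c m)) != 0 by apply/eqP/m0/eqP.
have : coeff m (f (g D)) = coeff m (f (c m)) * coeff m D.
  rewrite -[D in LHS]freeg_sumE !raddf_sum /= (bigD1_seq m) ?uniq_dom //=.
  rewrite big1_seq => [|u /andP[um uD]].
    by rewrite -[coeff m D]intz -freegU_mulz !raddfMz /= fliftU addr0 -mulrzr intz.
  rewrite -[coeff u D]intz -freegU_mulz !raddfMz /= fliftU.
  have [->|cu] := eqVneq (c u) 0; first by rewrite !raddf0 mul0rz.
  have Rum : R u m by apply: mmax; rewrite mem_filter cu.
  have [ub _ _] := cP u.
  have [->|/eqP/ub Rmu] := eqVneq (coeff m (f (c u))) 0; first exact: mul0rz.
  by rewrite (@Ranti u m) ?Rum // eqxx in um.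
rewrite D0 raddf0 => /esym/eqP; rewrite mulf_eq0 (negPf mm) /=.
by move: mD; rewrite mem_dom => /negPf ->.
Qed.

(** The image of [f] is free, hence [f] splits over it; [e] is [f] followed by
    a section. With a well-ordering of the basis, a basis of the image is given
    by elements whose leading coefficients generate the possible leading
    coefficients. *)
Theorem free_split : exists e : {additive A -> A},
  (forall x, f (e x) = f x) /\ (forall x, f x = 0 -> e x = 0).
Proof.
have [||x x' y y'|e eP] :=
    @additive_choice A A (fun x y => exists2 D, f (g D) = f x & y = g D).
- by move=> x; have [D DE] := image_gen x; exists (g D), D.
- move=> x y y' [D DE ->] [D' D'E ->].
  apply/eqP; rewrite -subr_eq0 -raddfB; apply/eqP/relation_trivial.
  by rewrite !raddfB DE D'E subrr.
- by move=> [D DE ->] [D' D'E ->]; exists (D - D'); rewrite !raddfB ?DE ?D'E.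
exists e; split=> x; have [D DE ->] := eP x => //.
by rewrite -DE => /relation_trivial.
Qed.
End FreeSplit.

Lemma addBrACA (V : zmodType) (a b c d : V) : (a - b) + (c - d) = (a + c) - (b + d).
Proof. by rewrite opprD addrACA. Qed.

(** * Chains of nonempty lists *)

(** A tuple [x_0, ..., x_n] is encoded as the pair of [x_0] and the list
    [x_1, ..., x_n]: all tuples of all lengths then live in one type, and faces
    and cones are defined by recursion. *)
Definition ne (T : choiceType) : choiceType := (T * seq T)%type.

Section Lists.
Variable T : choiceType.
Implicit Types (a : T) (x : ne T) (w : {freeg (ne T)}).

Definition necons a x : ne T := (a, x.1 :: x.2).
Definition nept a : ne T := (a, [::]).
Definition nedim x : nat := size x.2.

Definition cone a (w : {freeg (ne T)}) : {freeg (ne T)} := flift (fun x => << necons a x >>) w.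
HB.instance Definition _ a := GRing.isZmodMorphism.Build {freeg (ne T)}
  {freeg (ne T)} (cone a) (raddfB (flift (fun x => << necons a x >>))).

Definition aug (w : {freeg (ne T)}) : int := flift (fun x : ne T => (nedim x == 0%N)%:Z) w.
HB.instance Definition _ := GRing.isZmodMorphism.Build {freeg (ne T)}
  int (aug) (raddfB (flift (fun x : ne T => (nedim x == 0%N)%:Z))).

(** The recursion makes [cone] a contraction, see [bd_cone]; the last term is
    the face of the pair of [x0] and [x1] that deletes [x1]. *)
Fixpoint bd_rec (x0 : T) (s : seq T) : {freeg (ne T)} :=
  if s is x1 :: s' then
    << (x1, s') : ne T >> - cone x0 (bd_rec x1 s') -
    << nept x0 >> *~ (size s' == 0%N)%:Z
  else 0.

Definition bd (w : {freeg (ne T)}) : {freeg (ne T)} := flift (fun x : ne T => bd_rec x.1 x.2) w.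
HB.instance Definition _ := GRing.isZmodMorphism.Build {freeg (ne T)}
  {freeg (ne T)} (bd) (raddfB (flift (fun x : ne T => bd_rec x.1 x.2))).

Definition sgn (w : {freeg (ne T)}) : {freeg (ne T)} := flift (fun x : ne T => << x >> *~ (-1) ^+ nedim x) w.
HB.instance Definition _ := GRing.isZmodMorphism.Build {freeg (ne T)}
  {freeg (ne T)} (sgn) (raddfB (flift (fun x : ne T => << x >> *~ (-1) ^+ nedim x))).

Arguments cone : simpl never.
Arguments aug : simpl never.
Arguments bd : simpl never.
Arguments sgn : simpl never.

Lemma coneU a x : cone a << x >> = << necons a x >>.
Proof. exact: fliftU. Qed.

Lemma augU x : aug << x >> = (nedim x == 0%N)%:Z.
Proof. exact: fliftU. Qed.

Lemma sgnU x : sgn << x >> = << x >> *~ (-1) ^+ nedim x.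
Proof. exact: fliftU. Qed.

Lemma bdU x : bd << x >> = bd_rec x.1 x.2.
Proof. exact: fliftU. Qed.

Lemma bd_pt a : bd << nept a >> = 0.
Proof. exact: bdU. Qed.

Lemma bd_dim0 x : nedim x = 0%N -> bd << x >> = 0.
Proof. by case: x => x0 s /size0nil /= ->; rewrite bd_pt. Qed.

Lemma aug_pt a : aug << nept a >> = 1.
Proof. exact: augU. Qed.

Lemma sgn_pt a : sgn << nept a >> = << nept a >>.
Proof. exact: sgnU. Qed.

Lemma bd_cone_add a w : bd (cone a w) + cone a (bd w) + << nept a >> *~ aug w = w.
Proof.
move: w; apply: freeg_ind => [|v w vE wE|[x0 s]]; first by rewrite !raddf0 !addr0.
  by rewrite !raddfB /= !addBrACA vE wE.
by rewrite coneU !bdU augU /= addrAC !subrK.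
Qed.

Lemma bd_cone a w : bd (cone a w) = w - cone a (bd w) - << nept a >> *~ aug w.
Proof. by rewrite -[X in X - _ - _](bd_cone_add a) addrAC addrK addrK. Qed.

Lemma aug_cone a w : aug (cone a w) = 0.
Proof.
move: w; apply: freeg_ind => [|v w vE wE|x]; first by rewrite !raddf0.
  by rewrite !raddfB /= vE wE subrr.
by rewrite coneU augU.
Qed.

Lemma aug_bd w : aug (bd w) = 0.
Proof.
move: w; apply: freeg_ind => [|v w vE wE|[x0 s]]; first by rewrite !raddf0.
  by rewrite !raddfB /= vE wE subrr.
rewrite bdU /=; case: s => [|x1 s]; first exact: raddf0.
by rewrite /= !raddfB /= raddfMz /= aug_cone aug_pt augU subr0 intz subrr.
Qed.

Lemma bd_bd w : bd (bd w) = 0.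
Proof.
move: w; apply: freeg_ind => [|v w vE wE|[x0 s]]; first by rewrite !raddf0.
  by rewrite !raddfB /= vE wE subrr.
rewrite bdU /=; elim: s x0 => [|x1 s IHs] x0; first exact: raddf0.
rewrite /= !raddfB /= raddfMz /= bd_pt mul0rz subr0 bd_cone bdU IHs /=.
by rewrite -(bdU (x1, s)) aug_bd raddf0 mulr0z !subr0 subrr.
Qed.

Lemma sgn_cone a w : sgn (cone a w) = - cone a (sgn w).
Proof.
move: w; apply: freeg_ind => [|v w vE wE|x]; first by rewrite !raddf0.
  by rewrite !raddfB /= vE wE.
by rewrite coneU !sgnU raddfMz /= coneU exprS mulN1r mulrNz.
Qed.

Lemma aug_sgn w : aug (sgn w) = aug w.
Proof.
move: w; apply: freeg_ind => [|v w vE wE|x]; first by rewrite !raddf0.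
  by rewrite !raddfB /= vE wE.
rewrite sgnU raddfMz /= augU; case: (nedim x) => [|d]; last exact: mul0rz.
by rewrite expr0 mulr1z.
Qed.

Lemma sgn_bd w : sgn (bd w) = - bd (sgn w).
Proof.
move: w; apply: freeg_ind => [|v w vE wE|[x0 s]].
- by rewrite !raddf0.
- by rewrite !raddfB /= vE wE.
elim: s x0 => [|x1 s IHs] x0.
  by rewrite sgnU raddfMz /= bd_pt mul0rz raddf0 oppr0.
have bdE : bd << (x1, s) : ne T >> = bd_rec x1 s by rewrite bdU.
rewrite sgnU raddfMz /= bdU /= -bdE !raddfB /= raddfMz /= sgn_cone IHs.
rewrite sgn_pt !sgnU raddfMz /= raddfN /= raddfMz /= opprK.
rewrite /nedim /= exprS mulN1r mulrNz opprK !mulrzBl.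
rewrite [cone _ (_ *~ _)]raddfMz /= raddfN /= mulNrz.
by case: s {IHs bdE} => [|x2 s] /=; rewrite ?mulr1z // mulr0z mul0rz.
Qed.
End Lists.
Arguments cone {T} a w : simpl never.
Arguments aug {T} w : simpl never.
Arguments bd {T} w : simpl never.
Arguments sgn {T} w : simpl never.

Section ListMap.
Variables (T T' : choiceType) (f : T -> T').

Definition nemap (x : ne T) : ne T' := (f x.1, map f x.2).

Lemma nedim_map x : nedim (nemap x) = nedim x.
Proof. exact: size_map. Qed.

Definition lmap (w : {freeg (ne T)}) : {freeg (ne T')} := flift (fun x => << nemap x >>) w.
HB.instance Definition _ := GRing.isZmodMorphism.Build {freeg (ne T)}
  {freeg (ne T')} (lmap) (raddfB (flift (fun x => << nemap x >>))).

Arguments lmap : simpl never.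

Lemma lmapU x : lmap << x >> = << nemap x >>.
Proof. exact: fliftU. Qed.

Lemma lmap_cone a w : lmap (cone a w) = cone (f a) (lmap w).
Proof.
move: w; apply: freeg_ind => [|v w vE wE|x]; first by rewrite !raddf0.
  by rewrite !raddfB /= vE wE.
by rewrite coneU !lmapU coneU.
Qed.

Lemma lmap_sgn w : lmap (sgn w) = sgn (lmap w).
Proof.
move: w; apply: freeg_ind => [|v w vE wE|x]; first by rewrite !raddf0.
  by rewrite !raddfB /= vE wE.
by rewrite sgnU raddfMz /= !lmapU sgnU nedim_map.
Qed.

Lemma lmap_aug w : aug (lmap w) = aug w.
Proof.
move: w; apply: freeg_ind => [|v w vE wE|x]; first by rewrite !raddf0.
  by rewrite !raddfB /= vE wE.
by rewrite lmapU !augU nedim_map.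
Qed.

Lemma lmap_bd w : lmap (bd w) = bd (lmap w).
Proof.
move: w; apply: freeg_ind => [|v w vE wE|[x0 s]]; first by rewrite !raddf0.
  by rewrite !raddfB /= vE wE.
rewrite lmapU !bdU /=; elim: s x0 => [|x1 s IHs] x0; first exact: raddf0.
by rewrite /= !raddfB /= raddfMz /= lmap_cone IHs !lmapU size_map.
Qed.
End ListMap.
Arguments lmap {T T'} f w : simpl never.

(** * Chains of pairs of lists *)

(** [{freeg (K * K')}] is the tensor product of [{freeg K}] and [{freeg K'}];
    this form of it has a basis along which maps can be defined. *)
Section FreePairs.
Variables K K' : choiceType.

Definition prod_fun (D : {freeg K}) (E : {freeg K'}) : {freeg (K * K')} :=
  flift (fun x => flift (fun y => << (x, y) >>) E) D.

Lemma prodBl E : zmod_morphism (prod_fun ^~ E).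
Proof. by move=> D D'; rewrite /prod_fun raddfB. Qed.

Lemma prodBr D : zmod_morphism (prod_fun D).
Proof.
move=> E E'; rewrite /prod_fun; move: D.
apply: freeg_ind => [|v w vE wE|x]; first by rewrite !raddf0 addr0.
  by rewrite !raddfB /= vE wE addBrACA.
by rewrite !fliftU raddfB.
Qed.

Definition lprod (D : {freeg K}) := prod_fun D.
Definition lprodl (E : {freeg K'}) D := prod_fun D E.
HB.instance Definition _ D := GRing.isZmodMorphism.Build
  {freeg K'} {freeg (K * K')} (lprod D) (prodBr D).
HB.instance Definition _ E := GRing.isZmodMorphism.Build
  {freeg K} {freeg (K * K')} (lprodl E) (prodBl E).

Lemma lprodU x y : lprod << x >> << y >> = << (x, y) >>.
Proof. by rewrite /lprod /prod_fun !fliftU. Qed.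

Lemma lprodBl D D' E : lprod (D - D') E = lprod D E - lprod D' E.
Proof. exact: prodBl. Qed.
Lemma lprodBr D E E' : lprod D (E - E') = lprod D E - lprod D E'.
Proof. exact: prodBr. Qed.
Lemma lprodNl D E : lprod (- D) E = - lprod D E.
Proof. exact: (raddfN (lprodl E)). Qed.
Lemma lprod0l E : lprod 0 E = 0.
Proof. exact: (raddf0 (lprodl E)). Qed.
Lemma lprodMzl D E z : lprod (D *~ z) E = lprod D E *~ z.
Proof. exact: (raddfMz (lprodl E)). Qed.
Lemma lprodMzr D E z : lprod D (E *~ z) = lprod D E *~ z.
Proof. exact: (raddfMz (lprod D)). Qed.
End FreePairs.

Lemma lprod_additive_eq (K K' : choiceType) (C : zmodType)
    (F G : {additive {freeg (K * K')} -> C}) :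
  (forall x y, F (lprod << x >> << y >>) = G (lprod << x >> << y >>)) -> F =1 G.
Proof. by move=> FG; apply: freeg_additive_eq => -[x y]; rewrite -lprodU. Qed.

Section ProdMap.
Variables K1 K2 L1 L2 : choiceType.
Variables (f : {additive {freeg K1} -> {freeg L1}}).
Variables (g : {additive {freeg K2} -> {freeg L2}}).

Definition prod_map : {additive {freeg (K1 * K2)} -> {freeg (L1 * L2)}} :=
  flift (fun p => lprod (f << p.1 >>) (g << p.2 >>)).

Lemma prod_mapE D E : prod_map (lprod D E) = lprod (f D) (g E).
Proof.
move: D; apply: freeg_ind => [|v w vE wE|x]; first by rewrite !(lprod0l, raddf0).
  by rewrite lprodBl !raddfB /= vE wE lprodBl.
move: E; apply: freeg_ind => [|v w vE wE|y]; first by rewrite !raddf0.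
  by rewrite !raddfB /= vE wE.
by rewrite lprodU [LHS]fliftU.
Qed.
End ProdMap.

Section PairChains.
Variables S T : choiceType.
Local Notation chains2 := {freeg (ne S * ne T)}.
Implicit Types (w : chains2) (D : {freeg (ne S)}) (E : {freeg (ne T)}).

Definition pdim (p : ne S * ne T) : nat := nedim p.1 + nedim p.2.

Definition aug2 w : int := flift (fun p => (pdim p == 0%N)%:Z) w.
HB.instance Definition _ := GRing.isZmodMorphism.Build chains2 int aug2
  (raddfB (flift (fun p => (pdim p == 0%N)%:Z))).

Definition base (a : S) D : {freeg (ne S)} := << nept a >> *~ aug D.
Fact base_is_additive a : zmod_morphism (base a).
Proof. by move=> D D'; rewrite /base raddfB mulrzBr. Qed.
HB.instance Definition _ a := GRing.isZmodMorphism.Build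
  {freeg (ne S)} {freeg (ne S)} (base a) (base_is_additive a).

Definition bd2 w : chains2 := prod_map bd idfun w + prod_map sgn bd w.
Fact bd2_is_additive : zmod_morphism bd2.
Proof. by move=> v w; rewrite /bd2 !raddfB addBrACA. Qed.
HB.instance Definition _ :=
  GRing.isZmodMorphism.Build chains2 chains2 bd2 bd2_is_additive.

(** The contraction of a tensor product of two augmented contractible
    complexes: contract the first factor, and where it is contracted to its
    base point contract the second one. *)
Definition cone2 (c : S * T) w : chains2 :=
  prod_map (cone c.1) idfun w + prod_map (base c.1) (cone c.2) w.
Fact cone2_is_additive c : zmod_morphism (cone2 c).
Proof. by move=> v w; rewrite /cone2 !raddfB addBrACA. Qed.
HB.instance Definition _ c :=
  GRing.isZmodMorphism.Build chains2 chains2 (cone2 c) (cone2_is_additive c).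

Definition pt2 (c : S * T) : ne S * ne T := (nept c.1, nept c.2).

Arguments aug2 : simpl never.
Arguments base : simpl never.
Arguments bd2 : simpl never.
Arguments cone2 : simpl never.

Lemma bd2_prod D E : bd2 (lprod D E) = lprod (bd D) E + lprod (sgn D) (bd E).
Proof. by rewrite /bd2 !prod_mapE. Qed.

Lemma cone2_prod c D E : cone2 c (lprod D E) =
  lprod (cone c.1 D) E + lprod (base c.1 D) (cone c.2 E).
Proof. by rewrite /cone2 !prod_mapE. Qed.

Lemma aug2U p : aug2 << p >> = (pdim p == 0%N)%:Z.
Proof. exact: fliftU. Qed.

Lemma aug2_prod D E : aug2 (lprod D E) = aug D * aug E.
Proof.
move: D; apply: freeg_ind => [|v w vE wE|x].
- by rewrite lprod0l !raddf0 mul0r.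
- by rewrite lprodBl !raddfB /= vE wE mulrBl.
move: E; apply: freeg_ind => [|v w vE wE|y]; first by rewrite !raddf0 mulr0.
  by rewrite !raddfB /= vE wE mulrBr.
by rewrite lprodU aug2U !augU addn_eq0 /pdim /=; do 2!case: (_ == _).
Qed.

Lemma bd2_bd2 w : bd2 (bd2 w) = 0.
Proof.
apply: (lprod_additive_eq (F := bd2 \o bd2) (G := \0)) => x y /=.
rewrite bd2_prod raddfD /= !bd2_prod !bd_bd lprod0l add0r raddf0 addr0.
by rewrite sgn_bd lprodNl addNr.
Qed.

Lemma aug2_bd2 w : aug2 (bd2 w) = 0.
Proof.
apply: (lprod_additive_eq (F := aug2 \o bd2) (G := \0)) => x y /=.
by rewrite bd2_prod raddfD /= !aug2_prod !aug_bd mul0r mulr0.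
Qed.

Lemma aug2_cone2 c w : aug2 (cone2 c w) = 0.
Proof.
apply: (lprod_additive_eq (F := aug2 \o cone2 c) (G := \0)) => x y /=.
by rewrite cone2_prod raddfD /= !aug2_prod !aug_cone mul0r mulr0.
Qed.

Lemma bd2_cone2 c w :
  bd2 (cone2 c w) = w - cone2 c (bd2 w) - << pt2 c >> *~ aug2 w.
Proof.
case: c => a b; suff : bd2 (cone2 (a, b) w) + cone2 (a, b) (bd2 w) +
    << pt2 (a, b) >> *~ aug2 w = w.
  by move=> {2}<-; rewrite addrAC addrK addrK.
move: w; apply: freeg_ind => [|v w vE wE|[x y]].
- by rewrite !raddf0 !addr0.
- by rewrite !raddfB /= !addBrACA vE wE.
rewrite -lprodU; move: << x >> << y >> => D E.
have bdA : bd2 (lprod (cone a D) E) = lprod D E - lprod (cone a (bd D)) E -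
    lprod (base a D) E - lprod (cone a (sgn D)) (bd E).
  by rewrite bd2_prod bd_cone sgn_cone !lprodBl lprodNl.
have bdB : bd2 (lprod (base a D) (cone b E)) = lprod (base a D) E -
    lprod (base a D) (cone b (bd E)) - << pt2 (a, b) >> *~ aug2 (lprod D E).
  rewrite bd2_prod bd_cone /base !raddfMz /= bd_pt sgn_pt mul0rz lprod0l add0r.
  rewrite !mulNrz !lprodBr; congr (_ - _ - _).
  by rewrite lprodMzl lprodMzr lprodU aug2_prod -mulrzA mulrC.
have coneA : cone2 (a, b) (lprod (bd D) E) = lprod (cone a (bd D)) E.
  by rewrite cone2_prod /base /= aug_bd mulr0z lprod0l addr0.
have coneB : cone2 (a, b) (lprod (sgn D) (bd E)) =
    lprod (cone a (sgn D)) (bd E) + lprod (base a D) (cone b (bd E)).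
  by rewrite cone2_prod /base /= aug_sgn.
rewrite cone2_prod [bd2 (lprod D E)]bd2_prod !raddfD /= bdA bdB coneA coneB.
rewrite !addrA [LHS](ACl (1*(2*8)*(3*5)*(4*9)*(6*10)*(7*11))) /=.
by rewrite !addNr !addr0.
Qed.
End PairChains.
Arguments aug2 {S T} w : simpl never.
Arguments base {S} a D : simpl never.
Arguments bd2 {S T} w : simpl never.
Arguments cone2 {S T} c w : simpl never.

(** * Lengths of lists *)

Section Lengths.
Variables (R : realType) (X : gmetric R).
Implicit Types (a : X) (x : ne X).

Fixpoint plen_rec (x0 : X) (s : seq X) : \bar R :=
  if s is x1 :: s' then (gdist x0 x1 + plen_rec x1 s')%E else 0%E.

Definition plen x : \bar R := plen_rec x.1 x.2.

Lemma plen_cons a x : plen (necons a x) = (gdist a x.1 + plen x)%E.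
Proof. by []. Qed.

Lemma plen_ge0 x : (0 <= plen x)%E.
Proof.
case: x => x0 s; rewrite /plen /=; elim: s x0 => //= x1 s IHs x0.
by rewrite adde_ge0 ?gdist_ge0.
Qed.

(** Every list that is made from [x] by deleting and repeating entries shrinks
    [x]. In this form the relation is stable under the prefixing of a point,
    whether a new one or the head of [x], as well as under deletion. *)
Definition shrinks x' x : Prop :=
  (plen x' <= plen x)%E /\
  forall a, (plen (necons a x') <= plen (necons a x))%E.

Lemma shrinks_refl x : shrinks x x. Proof. by split. Qed.

Lemma shrinks_trans x y z : shrinks x y -> shrinks y z -> shrinks x z.
Proof.
move=> [xy axy] [yz ayz]; split=> [|a]; first exact: le_trans yz.
exact: le_trans (ayz a).
Qed.

Lemma shrinks_tail a x : shrinks x (necons a x).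
Proof.
split=> [|b]; first by rewrite plen_cons leeDr ?gdist_ge0.
by rewrite !plen_cons addeA leeD // gdist_triangle.
Qed.

Lemma shrinks_cons a x' x : shrinks x' x -> shrinks (necons a x') (necons a x).
Proof. by move=> [_ xx']; split=> [//|b]; rewrite plen_cons leeD. Qed.

Lemma shrinks_head x' x : shrinks x' x -> shrinks (necons x.1 x') x.
Proof.
move=> [_ xx']; have le_x : (plen (necons x.1 x') <= plen x)%E.
  by apply: le_trans (xx' _) _; rewrite plen_cons gdistxx add0e.
by split=> // a; rewrite plen_cons leeD.
Qed.

Lemma shrinks_pt x : shrinks (nept x.1) x.
Proof.
by split=> [|a]; rewrite ?plen_cons ?leeD // plen_ge0.
Qed.

End Lengths.

Lemma plen_map (R : realType) (X X' : gmetric R) (f : short_map X X') x :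
  (plen (nemap f x) <= plen x)%E.
Proof.
case: x => x0 s; rewrite /plen /=; elim: s x0 => //= x1 s IHs x0.
by rewrite leeD ?short_funP.
Qed.

(** * Acyclic carriers *)

Section Carrier.
Variables (R : realType) (X Y : gmetric R).
Local Notation shape := (ne X * ne Y)%type.

Definition shadow_le (q p : shape) : Prop := shrinks q.1 p.1 /\ shrinks q.2 p.2.

Lemma shadow_le_refl p : shadow_le p p.
Proof. by split; apply: shrinks_refl. Qed.

Lemma shadow_le_trans p q r : shadow_le p q -> shadow_le q r -> shadow_le p r.
Proof.
by move=> [pq1 pq2] [qr1 qr2]; split; [apply: shrinks_trans qr1|apply: shrinks_trans qr2].
Qed.

Definition heads (p : shape) : X * Y := (p.1.1, p.2.1).

Definition carrier (B : choiceType) (dim : B -> nat) (sh : B -> shape)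
    (n : nat) (p : shape) : zmodClosed {freeg B} :=
  span (fun v => exists b, [/\ dim b = n, shadow_le (sh b) p & v = << b >>]).

Lemma carrierU (B : choiceType) (dim : B -> nat) (sh : B -> shape) n p b :
  dim b = n -> shadow_le (sh b) p -> << b >> \in carrier dim sh n p.
Proof. by move=> bn bp; apply: mem_span; exists b. Qed.

Lemma carrier_le (B : choiceType) (dim : B -> nat) (sh : B -> shape) n p q w :
  shadow_le q p -> w \in carrier dim sh n q -> w \in carrier dim sh n p.
Proof.
move=> qp; apply: span_incl => _ [b [bn bq ->]]; exists b; split=> //.
exact: shadow_le_trans bq qp.
Qed.

(** Augmented chain complexes with a basis, in which every point of the product
    is the apex of a contraction. The shadow of a basis element consists of its
    two coordinate lists; the conditions on carriers say that the differential
    and the contraction towards the head do not increase lengths. *)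
Record cone_complex := ConeComplex {
  cbasis :> choiceType;
  cdim : cbasis -> nat;
  cshadow : cbasis -> shape;
  cbd : {additive {freeg cbasis} -> {freeg cbasis}};
  caug : {additive {freeg cbasis} -> int};
  ccone : X * Y -> {additive {freeg cbasis} -> {freeg cbasis}};
  cpt : X * Y -> cbasis;
  cbd_cbd : forall w, cbd (cbd w) = 0;
  caugU : forall b, caug << b >> = (cdim b == 0%N)%:Z;
  caug_bd : forall w, caug (cbd w) = 0;
  caug_cone : forall c w, caug (ccone c w) = 0;
  cbd_cone : forall c w,
    cbd (ccone c w) = w - ccone c (cbd w) - << cpt c >> *~ caug w;
  cbd_dim0 : forall b, cdim b = 0%N -> cbd << b >> = 0;
  cbd_carrier : forall b n, cdim b = n.+1 ->
    cbd << b >> \in carrier cdim cshadow n (cshadow b);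
  ccone_carrier : forall n p w, w \in carrier cdim cshadow n p ->
    ccone (heads p) w \in carrier cdim cshadow n.+1 p;
  cpt_dim : forall c, cdim (cpt c) = 0%N;
  cpt_shadow : forall p, shadow_le (cshadow (cpt (heads p))) p
}.

Local Notation ccarrier C := (carrier (@cdim C) (@cshadow C)).

Definition raises (C D : cone_complex) (e : nat)
    (F : {additive {freeg C} -> {freeg D}}) : Prop :=
  forall b, F << b >> \in ccarrier D (cdim b + e) (cshadow b).

Lemma raises_carrier (C D : cone_complex) e F n p w :
  @raises C D e F -> w \in ccarrier C n p -> F w \in ccarrier D (n + e) p.
Proof.
move=> Fe; move: w; apply: span_ind.
- by rewrite raddf0 rpred0.
- by move=> v w vV wV; rewrite raddfB rpredB.
- by move=> _ [b [<- bp ->]]; apply: carrier_le bp (Fe b).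
Qed.

Lemma raises_id (C : cone_complex) : @raises C C 0 idfun.
Proof. by move=> b; rewrite addn0; apply: carrierU => //; apply: shadow_le_refl. Qed.

Lemma raises_comp (C D E : cone_complex) (F : {additive {freeg C} -> {freeg D}})
    (G : {additive {freeg D} -> {freeg E}}) :
  raises 0 F -> raises 0 G -> raises 0 (G \o F).
Proof.
move=> F0 G0 b; rewrite -[(cdim b + 0)%N]addn0.
exact: raises_carrier G0 (F0 b).
Qed.

Lemma agree_carrier (C : cone_complex) (G : zmodType)
    (F F' : {additive {freeg C} -> G}) n p :
  (forall b, cdim b = n -> F << b >> = F' << b >>) ->
  forall w, w \in ccarrier C n p -> F w = F' w.
Proof.
move=> FF'; apply: span_ind; first by rewrite !raddf0.
  by move=> v w vE wE; rewrite !raddfB vE wE.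
by move=> _ [b [bn _ ->]]; apply: FF'.
Qed.

Section Recursion.
Variables (C D : cone_complex) (step : C -> {freeg D} -> {freeg D}).

(* [n] is fuel. *)
Fixpoint acyc_rec (n : nat) : {additive {freeg C} -> {freeg D}} :=
  flift (fun b => step b (if n is n'.+1 then acyc_rec n' (cbd C << b >>) else 0)).

Definition acyc (w : {freeg C}) : {freeg D} :=
  flift (fun b => acyc_rec (cdim b) << b >>) w.
HB.instance Definition _ := GRing.isZmodMorphism.Build
  {freeg C} {freeg D} acyc (raddfB (flift (fun b => acyc_rec (cdim b) << b >>))).
Arguments acyc : simpl never.

Lemma acycE b : acyc << b >> = step b (acyc (cbd C << b >>)).
Proof.
have rec0 m b' : cdim b' = 0%N -> acyc_rec m << b' >> = step b' 0.
  by move=> b'0; case: m => [|m] /=; rewrite fliftU ?cbd_dim0 ?raddf0.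
have stable n : forall m m' b', cdim b' = n -> (n <= m)%N -> (n <= m')%N ->
    acyc_rec m << b' >> = acyc_rec m' << b' >>.
  elim: n => [|n IHn] m m' b' b'n; first by rewrite !rec0.
  case: m m' => [|m] [|m'] // nm nm'; rewrite /= !fliftU; congr (step _ _).
  by apply: agree_carrier (cbd_carrier b'n) => b'' b''n; apply: (IHn).
rewrite [LHS]fliftU; case E: (cdim b) => [|n].
  by rewrite rec0 // cbd_dim0 // raddf0.
rewrite /= fliftU; congr (step _ _).
apply: agree_carrier (cbd_carrier E) => b' b'n.
by rewrite [RHS]fliftU; apply: (stable n); rewrite ?b'n.
Qed.

Lemma acyc_raises e :
  (forall b, cdim b = 0%N -> step b 0 \in ccarrier D e (cshadow b)) ->
  (forall b n w, cdim b = n.+1 -> w \in ccarrier D (n + e) (cshadow b) ->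
     step b w \in ccarrier D (n.+1 + e) (cshadow b)) ->
  raises e acyc.
Proof.
move=> step0 stepS b; have [n] := ubnP (cdim b); elim: n b => // n IHn b.
rewrite ltnS /= acycE; case E: (cdim b) => [|m] mn.
  by rewrite cbd_dim0 // raddf0; apply: step0.
apply: stepS => //.
have /= : forall w, w \in ccarrier C m (cshadow b) ->
    acyc w \in ccarrier D (m + e) (cshadow b).
  apply: span_ind; first by rewrite raddf0 rpred0.
    by move=> v w vV wV; rewrite raddfB rpredB.
  move=> _ [b' [b'm b'b ->]]; rewrite -b'm.
  by apply: carrier_le b'b (IHn b' _); rewrite b'm.
by apply; apply: cbd_carrier.
Qed.
End Recursion.

(** By induction on the degree this is a chain map: the image of the boundary of
    [b] is a cycle, and hence it is the boundary of the cone over it. The head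
    of [b] is the apex because cones over other points can be too long. *)
Definition cmp_step (C D : cone_complex) (b : C) (w : {freeg D}) : {freeg D} :=
  if cdim b == 0%N then << cpt D (heads (cshadow b)) >>
  else ccone D (heads (cshadow b)) w.

Definition cmp (C D : cone_complex) (w : {freeg C}) : {freeg D} :=
  acyc (@cmp_step C D) w.
HB.instance Definition _ (C D : cone_complex) := GRing.isZmodMorphism.Build
  {freeg C} {freeg D} (@cmp C D) (raddfB (acyc (@cmp_step C D))).
Arguments cmp : simpl never.

Lemma cmpE (C D : cone_complex) (b : C) :
  cmp D << b >> = cmp_step b (cmp D (cbd C << b >>)).
Proof. exact: acycE. Qed.

Section Comparison.
Variables C D : cone_complex.

Lemma cmp_raises : raises 0 (@cmp C D).
Proof.
apply: acyc_raises => [b b0|b n w bn wV]; rewrite /cmp_step ?b0 ?bn ?addn0 /=.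
  by apply: carrierU; [apply: cpt_dim | apply: cpt_shadow].
by apply: ccone_carrier; rewrite addn0 in wV.
Qed.

Lemma cmp_aug w : caug D (cmp D w) = caug C w.
Proof.
apply: (freeg_additive_eq (g := caug D \o @cmp C D) (h := caug C)) => b /=.
rewrite cmpE /cmp_step caugU; case: (cdim b == 0%N).
  by rewrite caugU cpt_dim.
by rewrite caug_cone.
Qed.

Lemma cmp_bd w : cbd D (cmp D w) = cmp D (cbd C w).
Proof.
apply: (freeg_additive_eq (g := cbd D \o @cmp C D) (h := @cmp C D \o cbd C)) => b /=.
have [n] := ubnP (cdim b); elim: n b => // n IHn b; rewrite ltnS => bn.
case E: (cdim b) => [|m].
  rewrite cbd_dim0 // raddf0.
  by rewrite cmpE /cmp_step E /= cbd_dim0 ?cpt_dim.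
rewrite cmpE /cmp_step E /= cbd_cone cmp_aug caug_bd mulr0z subr0.
suff -> : cbd D (cmp D (cbd C << b >>)) = cmp D (cbd C (cbd C << b >>)).
  by rewrite cbd_cbd !raddf0 addr0.
apply: (agree_carrier (F := cbd D \o @cmp C D) (F' := @cmp C D \o cbd C) _
  (cbd_carrier E)) => b' b'm.
by apply: IHn; rewrite b'm -E.
Qed.

Section Homotopy.
Variables F G : {additive {freeg C} -> {freeg D}}.

Definition htpy_step (b : C) (w : {freeg D}) : {freeg D} :=
  ccone D (heads (cshadow b)) (F << b >> - G << b >> - w).

Definition htpy (w : {freeg C}) : {freeg D} := acyc htpy_step w.
HB.instance Definition _ := GRing.isZmodMorphism.Build
  {freeg C} {freeg D} htpy (raddfB (acyc htpy_step)).
Arguments htpy : simpl never.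

Lemma htpyE b : htpy << b >> = htpy_step b (htpy (cbd C << b >>)).
Proof. exact: acycE. Qed.

Hypotheses (F_bd : forall w, cbd D (F w) = F (cbd C w))
           (G_bd : forall w, cbd D (G w) = G (cbd C w)).
Hypotheses (F_aug : forall w, caug D (F w) = caug C w)
           (G_aug : forall w, caug D (G w) = caug C w).

Lemma htpy_aug w : caug D (htpy w) = 0.
Proof.
apply: (freeg_additive_eq (g := caug D \o htpy) (h := \0)) => b /=.
by rewrite htpyE caug_cone.
Qed.

(** The cone over [F b - G b - htpy (cbd b)] has the boundary required of
    [htpy b] because that chain is a cycle. *)
Lemma htpy_bd w : cbd D (htpy w) + htpy (cbd C w) = F w - G w.
Proof.
apply/eqP; rewrite eq_sym -subr_eq eq_sym; apply/eqP; move: w.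
have main b : cbd D (htpy << b >>) =
    F << b >> - G << b >> - htpy (cbd C << b >>).
  have [n] := ubnP (cdim b); elim: n b => // n IHn b; rewrite ltnS => bn.
  rewrite htpyE /htpy_step cbd_cone; set Z := F _ - _ - _.
  have -> : caug D Z = 0.
    by rewrite /Z !raddfB /= F_aug G_aug htpy_aug !subrr.
  suff -> : cbd D Z = 0 by rewrite !raddf0 !addr0.
  rewrite /Z; case E: (cdim b) => [|m].
    by rewrite cbd_dim0 // !raddf0 addr0 raddfB /= F_bd G_bd cbd_dim0 // !raddf0 addr0.
  have -> : cbd D (F << b >> - G << b >> - htpy (cbd C << b >>)) =
      F (cbd C << b >>) - G (cbd C << b >>) - cbd D (htpy (cbd C << b >>)).
    by rewrite raddfB /= [cbd D (F _ - _)]raddfB /= F_bd G_bd.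
  apply/eqP; rewrite subr_eq0; apply/eqP/esym.
  have bdE v : v \in ccarrier C m (cshadow b) ->
      cbd D (htpy v) + htpy (cbd C v) = F v - G v.
    move: v; apply: span_ind; first by rewrite !raddf0 addr0.
      by move=> u v uE vE; rewrite !raddfB addBrACA uE vE /= addBrACA.
    move=> _ [b' [b'm _ ->]]; rewrite IHn ?subrK //.
    by rewrite b'm -E.
  by rewrite -bdE ?cbd_carrier // cbd_cbd !raddf0 addr0.
move=> w; apply: (freeg_additive_eq (g := cbd D \o htpy)
  (h := (F \- G) \- (htpy \o cbd C))) => b /=.
exact: main.
Qed.

Lemma htpy_raises : raises 0 F -> raises 0 G -> raises 1 htpy.
Proof.
move=> F0 G0; apply: acyc_raises => [b b0|b n w bn wV].
  rewrite /htpy_step subr0; apply: ccone_carrier; rewrite -b0 -[cdim b]addn0.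
  by rewrite rpredB ?F0 ?G0.
rewrite addn1; apply: ccone_carrier; rewrite addn1 -bn -[cdim b]addn0 in wV *.
by rewrite !rpredB ?F0 ?G0.
Qed.
End Homotopy.
End Comparison.
End Carrier.

Section Naturality.
Variables (R : realType) (X Y X' Y' : gmetric R).
Variables (f : short_map X X') (g : short_map Y Y').

Definition bmap (B B' : choiceType) (m : B -> B') (w : {freeg B}) : {freeg B'} :=
  flift (fun b => << m b >>) w.
HB.instance Definition _ (B B' : choiceType) (m : B -> B') := GRing.isZmodMorphism.Build
  {freeg B} {freeg B'} (@bmap B B' m) (raddfB (flift (fun b => << m b >>))).
Arguments bmap {B B'} m w : simpl never.

Lemma bmapU (B B' : choiceType) (m : B -> B') b : bmap m << b >> = << m b >>.
Proof. exact: fliftU. Qed.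

Definition shape_map (p : ne X * ne Y) : ne X' * ne Y' :=
  (nemap f p.1, nemap g p.2).

Record is_cmap (C : cone_complex X Y) (C' : cone_complex X' Y') (m : C -> C') :
    Prop := IsCmap {
  cmap_dim : forall b, cdim (m b) = cdim b;
  cmap_shadow : forall b, cshadow (m b) = shape_map (cshadow b);
  cmap_bd : forall w, bmap m (cbd C w) = cbd C' (bmap m w);
  cmap_cone : forall c w,
    bmap m (ccone C c w) = ccone C' (f c.1, g c.2) (bmap m w);
  cmap_pt : forall c, m (cpt C c) = cpt C' (f c.1, g c.2)
}.

Lemma cmp_natural (C D : cone_complex X Y) (C' D' : cone_complex X' Y')
    (mC : C -> C') (mD : D -> D') : is_cmap mC -> is_cmap mD ->
  forall w, bmap mD (cmp D w) = cmp D' (bmap mC w).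
Proof.
move=> hC hD w.
apply: (freeg_additive_eq (g := bmap mD \o @cmp _ _ _ C D)
                          (h := @cmp _ _ _ C' D' \o bmap mC)) => b /=.
have [n] := ubnP (cdim b); elim: n b => // n IHn b; rewrite ltnS => bn.
rewrite (bmapU mC) !cmpE /cmp_step (cmap_dim hC) (cmap_shadow hC).
case E: (cdim b) => [|m] /=; first by rewrite (bmapU mD) (cmap_pt hD).
rewrite (cmap_cone hD) -(bmapU mC) -(cmap_bd hC); congr (ccone _ _ _).
apply: (agree_carrier (F := bmap mD \o @cmp _ _ _ C D)
  (F' := @cmp _ _ _ C' D' \o bmap mC) _ (cbd_carrier E)) => b' b'm.
by apply: IHn; rewrite b'm -E.
Qed.
End Naturality.
Arguments bmap {B B'} m w : simpl never.

(** * The two chain complexes of a product *)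

Section ListComplex.
Variables (R : realType) (X Y : gmetric R).
Local Notation XY := (X * Y)%type.

Definition lshadow (z : ne XY) : ne X * ne Y := (nemap fst z, nemap snd z).

Local Notation lcarrier := (carrier (@nedim XY) lshadow).

Lemma cone_carrier n c p w : w \in lcarrier n p ->
  cone c w \in lcarrier n.+1 (necons c.1 p.1, necons c.2 p.2).
Proof.
move: w; apply: span_ind; first by rewrite raddf0 rpred0.
  by move=> v w vV wV; rewrite raddfB rpredB.
move=> _ [z [<- [z1 z2] ->]]; rewrite coneU; apply: carrierU => //.
by split; [exact: (shrinks_cons c.1 z1) | exact: (shrinks_cons c.2 z2)].
Qed.

Lemma cone_heads_carrier n p w : w \in lcarrier n p ->
  cone (heads p) w \in lcarrier n.+1 p.
Proof.
move: w; apply: span_ind; first by rewrite raddf0 rpred0.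
  by move=> v w vV wV; rewrite raddfB rpredB.
move=> _ [z [<- [z1 z2] ->]]; rewrite coneU; apply: carrierU => //.
by split; [exact: (shrinks_head z1) | exact: (shrinks_head z2)].
Qed.

Lemma nept_carrier p : shadow_le (lshadow (nept (heads p))) p.
Proof. by split; [exact: (shrinks_pt p.1) | exact: (shrinks_pt p.2)]. Qed.

Lemma bd_carrier z n : nedim z = n.+1 -> bd << z >> \in lcarrier n (lshadow z).
Proof.
case: z => z0 s; elim: s z0 n => [|z1 s IHs] z0 n //= [sn].
rewrite bdU /=; apply: rpredB.
  apply: rpredB.
    apply: carrierU => //; split; first exact: (shrinks_tail z0.1 (nemap fst (z1, s))).
    exact: (shrinks_tail z0.2 (nemap snd (z1, s))).
  case: n sn => [|n] sn.
    by rewrite (size0nil sn) raddf0 rpred0.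
  rewrite -[bd_rec _ _](bdU (z1, s)).
  exact: (cone_carrier (p := lshadow (z1, s)) z0 (IHs _ _ _)).
case: eqP => [s0|_]; last by rewrite mulr0z rpred0.
rewrite mulr1z; apply: carrierU; first by rewrite /= -sn s0.
exact: (nept_carrier (lshadow (z0, z1 :: s))).
Qed.

Definition list_complex : cone_complex X Y :=
  @ConeComplex R X Y (ne XY) (@nedim XY) lshadow bd aug cone (@nept XY)
    (@bd_bd XY) (@augU XY) (@aug_bd XY) (@aug_cone XY) (@bd_cone XY)
    (@bd_dim0 XY) bd_carrier cone_heads_carrier (fun=> erefl) nept_carrier.
End ListComplex.

Section PairComplex.
Variables (R : realType) (X Y : gmetric R).

Local Notation pcarrier := (carrier (@pdim X Y) (id : ne X * ne Y -> _)).

Lemma bd_shrinks (Z : gmetric R) (x : ne Z) n : nedim x = n.+1 ->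
  bd << x >> \in
    span (fun v => exists x', [/\ nedim x' = n, shrinks x' x & v = << x' >>]).
Proof.
case: x => x0 s; elim: s x0 n => [|x1 s IHs] x0 n //= [sn].
rewrite bdU /=; apply: rpredB.
  apply: rpredB.
    apply: mem_span; exists (x1, s); split=> //.
    exact: (shrinks_tail x0 (x1, s)).
  case: n sn => [|n] sn.
    by rewrite (size0nil sn) raddf0 rpred0.
  rewrite -[bd_rec _ _](bdU (x1, s)); move: (IHs x1 n sn).
  move: (bd _); apply: span_ind; first by rewrite raddf0 rpred0.
    by move=> v w vV wV; rewrite raddfB rpredB.
  move=> _ [x' [x'n xx' ->]]; rewrite coneU; apply: mem_span.
  exists (necons x0 x'); split=> //; first by rewrite -x'n.
  exact: (shrinks_cons x0 xx').
case: eqP => [s0|_]; last by rewrite mulr0z rpred0.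
rewrite mulr1z; apply: mem_span; exists (nept x0); split=> //.
  by rewrite /= -sn s0.
exact: (shrinks_pt (x0, x1 :: s)).
Qed.

Lemma bd2_carrier p n : pdim p = n.+1 -> bd2 << p >> \in pcarrier n p.
Proof.
case: p => x y pn; rewrite -lprodU bd2_prod; apply: rpredD.
  case E: (nedim x) => [|m]; first by rewrite bd_dim0 // lprod0l rpred0.
  move: (bd_shrinks E); move: (bd _); apply: span_ind.
  - by rewrite lprod0l rpred0.
  - by move=> v w vV wV; rewrite lprodBl rpredB.
  move=> _ [x' [x'm xx' ->]]; rewrite lprodU; apply: carrierU.
    by apply: succn_inj; rewrite -pn /pdim /= x'm E.
  by split=> //; apply: shrinks_refl.
case E: (nedim y) => [|m]; first by rewrite [bd _]bd_dim0 // raddf0 rpred0.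
move: (bd_shrinks E); move: (bd _); apply: span_ind.
- by rewrite raddf0 rpred0.
- by move=> v w vV wV; rewrite raddfB rpredB.
move=> _ [y' [y'm yy' ->]]; rewrite sgnU lprodMzl lprodU rpredMz //.
apply: carrierU; first by apply: succn_inj; rewrite -pn /pdim /= y'm E addnS.
by split=> //; apply: shrinks_refl.
Qed.

Lemma cone2_carrier n p w : w \in pcarrier n p ->
  cone2 (heads p) w \in pcarrier n.+1 p.
Proof.
move: w; apply: span_ind; first by rewrite raddf0 rpred0.
  by move=> v w vV wV; rewrite raddfB rpredB.
move=> _ [[x y] [<- [xp yp] ->]]; rewrite -lprodU cone2_prod !coneU lprodU.
apply: rpredD.
  by apply: carrierU => //; split=> //; apply: shrinks_head.
rewrite /base augU lprodMzl lprodU; case: eqP => [x0|_]; last by rewrite mulr0z rpred0.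
rewrite mulr1z; apply: carrierU; first by rewrite /pdim /= x0.
by split; [apply: shrinks_pt | apply: shrinks_head].
Qed.

Lemma bd2_dim0 (p : ne X * ne Y) : pdim p = 0%N -> bd2 << p >> = 0.
Proof.
case: p => x y /eqP; rewrite addn_eq0 => /andP[/eqP x0 /eqP y0].
by rewrite -lprodU bd2_prod !bd_dim0 // lprod0l raddf0 addr0.
Qed.

Lemma pt2_shadow (p : ne X * ne Y) : shadow_le (pt2 (heads p)) p.
Proof. by split; apply: shrinks_pt. Qed.

Definition pair_complex : cone_complex X Y :=
  @ConeComplex R X Y (ne X * ne Y)%type (@pdim X Y) id bd2 aug2 cone2
    (@pt2 X Y) (@bd2_bd2 X Y) (@aug2U X Y) (@aug2_bd2 X Y) (@aug2_cone2 X Y)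
    (@bd2_cone2 X Y) bd2_dim0 bd2_carrier cone2_carrier (fun=> erefl) pt2_shadow.

(** The maps of Eilenberg-Zilber and Alexander-Whitney, up to homotopy. *)
Definition EZ : {additive {freeg pair_complex} -> {freeg (list_complex X Y)}} :=
  @cmp R X Y pair_complex (list_complex X Y).
Definition AW : {additive {freeg (list_complex X Y)} -> {freeg pair_complex}} :=
  @cmp R X Y (list_complex X Y) pair_complex.
End PairComplex.

Section PairNaturality.
Variables (R : realType) (X Y X' Y' : gmetric R).
Variables (f : short_map X X') (g : short_map Y Y').

Definition fg (p : X * Y) : X' * Y' := (f p.1, g p.2).

Lemma list_cmap : is_cmap f g (C := list_complex X Y) (C' := list_complex X' Y')
  (nemap fg).
Proof.
split=> //; first exact: nedim_map.
- by case=> z s; rewrite /shape_map /= /lshadow /nemap /= -!map_comp.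
- exact: (lmap_bd fg).
- by move=> c w; apply: (lmap_cone fg).
Qed.

Lemma lmap2E (w : {freeg (ne X * ne Y)}) :
  bmap (shape_map f g) w = prod_map (lmap f) (lmap g) w.
Proof.
apply: (lprod_additive_eq (F := bmap (shape_map f g))
  (G := prod_map (lmap f) (lmap g))) => x y /=.
by rewrite prod_mapE /= !lmapU !lprodU bmapU.
Qed.

Lemma pair_cmap : is_cmap f g (C := pair_complex X Y) (C' := pair_complex X' Y')
  (shape_map f g).
Proof.
split=> //.
- by case=> x y; rewrite /= /pdim /= !nedim_map.
- move=> w; rewrite !lmap2E; move: w.
  apply: (lprod_additive_eq (F := prod_map (lmap f) (lmap g) \o bd2)
    (G := bd2 \o prod_map (lmap f) (lmap g))) => x y /=.
  by rewrite bd2_prod raddfD /= !prod_mapE /= bd2_prod !lmap_bd lmap_sgn.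
- move=> [a b] w; rewrite !lmap2E; move: w.
  apply: (lprod_additive_eq (F := prod_map (lmap f) (lmap g) \o cone2 (a, b))
    (G := cone2 (f a, g b) \o prod_map (lmap f) (lmap g))) => x y /=.
  rewrite cone2_prod raddfD /= !prod_mapE /= cone2_prod !lmap_cone /=.
  by congr (_ + lprod _ _); rewrite /base raddfMz /= lmapU lmap_aug.
Qed.
End PairNaturality.

(** * Graded pieces *)

Section Pieces.
Variable R : realType.

Record wbasis := WBasis {
  wcar :> choiceType;
  wdim : wcar -> nat;
  wlen : wcar -> \bar R
}.

(** The part of [{freeg B}] in degree [n] and length [l]. The module is left
    open: it is free on a type of tuples for magnitude chains, and a direct sum
    of tensor products for the chains of pairs. *)
Record piece (B : wbasis) (n : nat) (l : R) := Piece {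
  pmod : zmodType;
  pproj : {additive {freeg B} -> pmod};
  pinj : {additive pmod -> {freeg B}};
  pinjK : forall e, pproj (pinj e) = e;
  pproj_out : forall b, ~ (wdim b = n /\ wlen b = l%:E) -> pproj << b >> = 0;
  pprojK : forall b, wdim b = n -> wlen b = l%:E -> pinj (pproj << b >>) = << b >>
}.

Definition low (B : wbasis) (l : R) : zmodClosed {freeg B} :=
  span (fun v => exists2 b : B, (wlen b <= l%:E)%E & v = << b >>).

Lemma pinj_hom B n l (P : piece B n l) e : pinj P e \in
  span (fun v => exists b : B, [/\ wdim b = n, wlen b = l%:E & v = << b >>]).
Proof.
rewrite -(pinjK e); move: (pinj P e).
apply: freeg_ind => [|v w vV wV|b]; first by rewrite !raddf0 rpred0.
  by rewrite !raddfB rpredB.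
have [[bn bl]|bout] := pselect (wdim b = n /\ wlen b = l%:E).
  by rewrite pprojK //; apply: mem_span; exists b.
by rewrite pproj_out // raddf0 rpred0.
Qed.

Lemma pinj_low B n l (P : piece B n l) e : pinj P e \in low B l.
Proof.
move: (pinj P e) (pinj_hom e); apply: span_incl => _ [b [_ bl ->]].
by exists b; rewrite ?bl.
Qed.

(** Two numbers [d] and [e], because the boundary lowers degrees. *)
Definition shifts (B B' : wbasis) (d e : nat)
    (F : {additive {freeg B} -> {freeg B'}}) : Prop :=
  forall b, F << b >> \in span (fun v => exists b',
    [/\ (wdim b' + d)%N = (wdim b + e)%N, (wlen b' <= wlen b)%E & v = << b' >>]).

Lemma shifts_low (B B' : wbasis) d e F l w :
  @shifts B B' d e F -> w \in low B l -> F w \in low B' l.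
Proof.
move=> Fde; move: w; apply: span_ind; first by rewrite raddf0 rpred0.
  by move=> v w vV wV; rewrite raddfB rpredB.
move=> _ [b bl ->]; move: (F _) (Fde b); apply: span_incl => _ [b' [_ b'b ->]].
by exists b' => //; apply: le_trans bl.
Qed.

Section Gr.
Variables (B B' : wbasis) (d e n n' : nat) (l : R).
Variables (P : piece B n l) (P' : piece B' n' l).

Definition gr (F : {additive {freeg B} -> {freeg B'}}) :
  {additive pmod P -> pmod P'} := pproj P' \o F \o pinj P.

(** Basis elements of smaller length, or of another degree, do not contribute
    to the piece, neither before nor after [F]. *)
Lemma gr_proj F w : shifts d e F -> (n' + d)%N = (n + e)%N ->
  w \in low B l -> pproj P' (F w) = gr F (pproj P w).
Proof.
move=> Fde nn'; move: w; apply: span_ind; first by rewrite !raddf0.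
  by move=> v w vE wE; rewrite !raddfB vE wE.
move=> _ [b bl ->].
have [[bn bl']|bout] := pselect (wdim b = n /\ wlen b = l%:E).
  by rewrite /gr /= pprojK.
rewrite (pproj_out P bout) [RHS]raddf0.
move: (F << b >>) (Fde b); apply: span_kills => _ [b' [b'd b'b ->]].
apply: pproj_out => -[b'n b'l]; apply: bout; split.
  by apply: (@addIn e); rewrite -b'd b'n.
by apply/eqP; rewrite eq_le bl -b'l.
Qed.
End Gr.

Lemma gr_comp (B B' B'' : wbasis) d e d' e' n n' n'' l (P : piece B n l)
    (P' : piece B' n' l) (P'' : piece B'' n'' l)
    (F : {additive {freeg B} -> {freeg B'}})
    (G : {additive {freeg B'} -> {freeg B''}}) c :
  shifts d e F -> shifts d' e' G -> (n'' + d')%N = (n' + e')%N ->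
  gr P' P'' G (gr P P' F c) = pproj P'' (G (F (pinj P c))).
Proof.
move=> Fs Gs nn; rewrite [RHS](gr_proj P' P'' Gs nn) //.
exact/(shifts_low Fs)/pinj_low.
Qed.
End Pieces.
Arguments gr_comp {R B B' B'' d e d' e' n n' n'' l} P P' P'' {F G} c.
Arguments pproj {R B n l} p.
Arguments pinj {R B n l} p.

Section ConePieces.
Variables (R : realType) (X Y : gmetric R).

Definition shadow_len (p : ne X * ne Y) : \bar R := (plen p.1 + plen p.2)%E.

Definition cone_wbasis (C : cone_complex X Y) : wbasis R :=
  WBasis (@cdim _ _ _ C) (fun b => shadow_len (cshadow b)).

Lemma shadow_len_le (p q : ne X * ne Y) :
  shadow_le p q -> (shadow_len p <= shadow_len q)%E.
Proof. by move=> [[p1 _] [p2 _]]; apply: leeD. Qed.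

Lemma raises_shifts (C D : cone_complex X Y) e
    (F : {additive {freeg C} -> {freeg D}}) :
  raises e F -> shifts (B := cone_wbasis C) (B' := cone_wbasis D) 0 e F.
Proof.
move=> Fe b; move: (F << b >>) (Fe b); apply: span_incl => _ [b' [b'n b'b ->]].
by exists b'; rewrite addn0; split=> //; apply: shadow_len_le.
Qed.

Lemma cbd_shifts (C : cone_complex X Y) :
  shifts (B := cone_wbasis C) (B' := cone_wbasis C) 1 0 (cbd C).
Proof.
move=> b; case E: (cdim b) => [|n]; first by rewrite cbd_dim0 // rpred0.
move: (cbd C << b >>) (cbd_carrier E).
apply: span_incl => _ [b' [b'n b'b ->]]; exists b'; split=> //.
  by rewrite addn0 addn1 /= E b'n.
exact: shadow_len_le.
Qed.
End ConePieces.

(** * Magnitude chains as a graded piece *)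

Section MagnitudePiece.
Variables (R : realType) (X : gmetric R).

Definition ne_of n (x : {ffun 'I_n.+1 -> X}) : ne X :=
  (x ord0, [seq x (lift ord0 i) | i <- enum 'I_n]).

Definition ffun_of n (z : ne X) : {ffun 'I_n.+1 -> X} :=
  [ffun i => nth z.1 (z.1 :: z.2) (val i)].

Lemma nedim_of n (x : {ffun 'I_n.+1 -> X}) : nedim (ne_of x) = n.
Proof. by rewrite /nedim size_map size_enum_ord. Qed.

Lemma ne_ofK n : cancel (@ne_of n) (@ffun_of n).
Proof.
move=> x; apply/ffunP => i; rewrite ffunE.
case: (unliftP ord0 i) => [j|] -> //.
rewrite [val _]lift0 /= (nth_map j) ?size_enum_ord //.
by rewrite (nth_ord_enum j j).
Qed.

Lemma ffun_ofK n (z : ne X) : nedim z = n -> ne_of (ffun_of n z) = z.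
Proof.
case: z => x s /= sn; rewrite /ne_of ffunE /=; congr pair.
apply: (@eq_from_nth _ x); rewrite size_map size_enum_ord // => i ni.
by rewrite (nth_map (Ordinal ni)) ?size_enum_ord // ffunE /= nth_enum_ord.
Qed.

Lemma ne_ofS n (x : {ffun 'I_n.+2 -> X}) :
  ne_of x = necons (x ord0) (ne_of (tuple_delete ord0 x)).
Proof.
rewrite /ne_of /necons enum_ordSl /= ffunE; congr (_, _ :: _).
rewrite -map_comp; apply: eq_map => i /=; rewrite ffunE; congr (x _).
Qed.

Lemma plen_of n (x : {ffun 'I_n.+1 -> X}) : plen (ne_of x) = tuple_length x.
Proof.
elim: n x => [|n IHn] x.
  by rewrite /tuple_length big_ord0 /ne_of enum_ord0.
rewrite ne_ofS plen_cons IHn tuple_lengthS; congr (gdist _ _ + _)%E.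
by rewrite /= ffunE.
Qed.

(** The cones of the recursion are the deletions of entries other than the
    first one. *)
Lemma bd_of n (x : {ffun 'I_n.+2 -> X}) :
  bd << ne_of x >> = \sum_(i < n.+2) << ne_of (tuple_delete i x) >> *~ (-1) ^+ i.
Proof.
elim: n x => [|n IHn] x.
  rewrite ne_ofS -coneU bd_cone bd_dim0 ?nedim_of // raddf0 subr0 augU nedim_of.
  rewrite big_ord_recl big_ord1 expr0 expr1 mulr1z mulrN1z; congr (_ - _).
  congr << _ >>; rewrite /ne_of enum_ord0 /= ffunE.
  by congr (x _, _); apply: ord_inj.
rewrite ne_ofS -coneU bd_cone augU nedim_of mulr0z subr0 IHn raddf_sum.
rewrite [RHS]big_ord_recl expr0 mulr1z -sumrN; congr (_ + _).
apply: eq_bigr => i _; rewrite raddfMz /= coneU -mulrNz /bump /= add1n exprS.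
rewrite mulN1r; congr (<< _ >> *~ _); rewrite [RHS]ne_ofS.
have -> : tuple_delete ord0 (tuple_delete (lift ord0 i) x) =
          tuple_delete i (tuple_delete ord0 x).
  apply/ffunP => k; rewrite !ffunE; congr (x _); apply: ord_inj => /=.
  by rewrite /bump /= !add1n ltnS addnS.
by rewrite ffunE; congr (necons (x _) _); apply: ord_inj.
Qed.

Definition ne_wbasis : wbasis R := WBasis (@nedim X) (@plen R X).

Variables (n : nat) (l : R).

Definition mproj (w : {freeg (ne X)}) : MB X n l :=
  flift (fun z => if nedim z == n then mbasis l (ffun_of n z) else 0) w.
HB.instance Definition _ := GRing.isZmodMorphism.Build {freeg (ne X)} (MB X n l)
  mproj (raddfB (flift (fun z => if nedim z == n then mbasis l (ffun_of n z) else 0))).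

Definition minj (c : MB X n l) : {freeg (ne X)} :=
  flift (fun u => << ne_of (val u) >>) c.
HB.instance Definition _ := GRing.isZmodMorphism.Build (MB X n l) {freeg (ne X)}
  minj (raddfB (flift (fun u => << ne_of (val u) >>))).

Arguments mproj : simpl never.
Arguments minj : simpl never.

Lemma minjU u : minj << u >> = << ne_of (val u) >>.
Proof. exact: fliftU. Qed.

Lemma mproj_of (x : {ffun 'I_n.+1 -> X}) : mproj << ne_of x >> = mbasis l x.
Proof. by rewrite [LHS]fliftU nedim_of eqxx ne_ofK. Qed.

Lemma mbasis_val (u : msimplex X n l) : mbasis l (val u) = << u >>.
Proof. by rewrite /mbasis valK. Qed.

Lemma minjK c : mproj (minj c) = c.
Proof.
apply: (freeg_additive_eq (g := mproj \o minj) (h := idfun)) => u /=.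
by rewrite minjU mproj_of mbasis_val.
Qed.

Lemma mproj_out z : ~ (nedim z = n /\ plen z = l%:E) -> mproj << z >> = 0.
Proof.
move=> zout; rewrite [LHS]fliftU; case: eqP => // zn.
rewrite /mbasis; case: insubP => // u /eqP ul _; case: zout; split=> //.
by rewrite -ul -plen_of ffun_ofK.
Qed.

Lemma mprojK z : nedim z = n -> plen z = l%:E -> minj (mproj << z >>) = << z >>.
Proof.
move=> zn zl; rewrite [mproj _]fliftU zn eqxx /mbasis.
have zl' : tuple_length (ffun_of n z) == l%:E by rewrite -plen_of ffun_ofK ?zl.
by rewrite insubT minjU /= ffun_ofK.
Qed.

Definition MB_piece : piece ne_wbasis n l :=
  @Piece R ne_wbasis n l (MB X n l) mproj minj minjK mproj_out mprojK.
End MagnitudePiece.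
Arguments mproj {R X} n l w : simpl never.
Arguments minj {R X n l} c : simpl never.

Lemma nebd_shifts (R : realType) (X : gmetric R) :
  shifts (B := ne_wbasis X) (B' := ne_wbasis X) 1 0 bd.
Proof.
move=> z /=; case E: (nedim z) => [|n]; first by rewrite bd_dim0 // rpred0.
move: (bd << z >>) (bd_shrinks E); apply: span_incl => _ [z' [z'n [zz' _] ->]].
by exists z'; split=> //; rewrite addn0 addn1 /= z'n ?E.
Qed.

Lemma mproj_bd (R : realType) (X : gmetric R) n l (w : {freeg (ne X)}) :
  w \in low (ne_wbasis X) l -> mproj n l (bd w) = mbnd (mproj n.+1 l w).
Proof.
move=> wl; have grE : gr (MB_piece X n.+1 l) (MB_piece X n l) bd =1 @mbnd R X n l.
  apply: freeg_additive_eq => u.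
  rewrite /gr /= minjU bd_of raddf_sum /mbnd; apply: eq_bigr => i _.
  by rewrite raddfMz /= mproj_of [mface _ _ _ _]fliftU.
rewrite -[RHS]grE.
apply: (gr_proj (MB_piece X n.+1 l) (MB_piece X n l) (@nebd_shifts R X) _ wl).
by rewrite addn1 addn0.
Qed.

Lemma lmap_shifts (R : realType) (X X' : gmetric R) (f : short_map X X') :
  shifts (B := ne_wbasis X) (B' := ne_wbasis X') 0 0 (lmap f).
Proof.
move=> z; rewrite /= lmapU; apply: mem_span; exists (nemap f z); split=> //.
  by rewrite /= nedim_map.
exact: plen_map.
Qed.

Lemma mproj_map (R : realType) (X X' : gmetric R) (f : short_map X X') n l w :
  w \in low (ne_wbasis X) l -> mproj n l (lmap f w) = MB_map f n l (mproj n l w).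
Proof.
move=> wl; have grE : gr (MB_piece X n l) (MB_piece X' n l) (lmap f) =1 MB_map f n l.
  apply: freeg_additive_eq => u.
  rewrite /gr /= minjU lmapU [RHS]fliftU -mproj_of; congr (mproj _ _ << _ >>).
  rewrite /ne_of /nemap /= ffunE; congr pair.
  by rewrite -map_comp; apply: eq_map => i; rewrite /= ffunE.
rewrite -[RHS]grE.
exact: (gr_proj (MB_piece X n l) (MB_piece X' n l) (lmap_shifts f) _ wl).
Qed.

Section ProductPiece.
Variables (R : realType) (X Y : gmetric R).

Lemma plen_gprod (z : ne (gprod X Y)) :
  plen z = shadow_len (lshadow (X := X) (Y := Y) z).
Proof.
case: z => z0 s; rewrite /shadow_len /plen /=.
elim: s z0 => [|z1 s IHs] z0 /=; first by rewrite adde0.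
by rewrite IHs /= /gprod_dist addeACA.
Qed.

Variables (n : nat) (l : R).
Local Notation L := (cone_wbasis (list_complex X Y)).

Fact list_piece_out (z : L) :
  ~ (wdim z = n /\ wlen z = l%:E) -> mproj (X := gprod X Y) n l << z >> = 0.
Proof.
move=> zout; apply: (@mproj_out R (gprod X Y)) => -[zn zl]; apply: zout.
by split=> //; rewrite -zl plen_gprod.
Qed.

Fact list_pieceK (z : L) : wdim z = n -> wlen z = l%:E ->
  minj (mproj (X := gprod X Y) n l << z >>) = << z >>.
Proof.
move=> zn zl; apply: (@mprojK R (gprod X Y)) => //.
by rewrite plen_gprod.
Qed.

Definition list_piece : piece L n l :=
  @Piece R L n l (MB (gprod X Y) n l)
    (mproj n l : {additive {freeg (ne (gprod X Y))} -> MB (gprod X Y) n l})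
    (minj : {additive MB (gprod X Y) n l -> {freeg (ne (gprod X Y))}})
    (@minjK R (gprod X Y) n l) list_piece_out list_pieceK.
End ProductPiece.

(** * The tensor product of two magnitude complexes *)

HB.instance Definition _ (R : realType) n (l : R) :=
  gen_eqMixin (kunneth_index n l).
HB.instance Definition _ (R : realType) n (l : R) :=
  gen_choiceMixin (kunneth_index n l).

Lemma kunneth_index_eq (R : realType) n (l : R) (i i' : kunneth_index n l) :
  kr i = kr i' -> ks i = ks i' -> kj i = kj i' -> kk i = kk i' -> i = i'.
Proof.
case: i i' => [r s j k r0 s0 rs jk] [r' s' j' k' r0' s0' rs' jk'] /=.
move=> rr ss jj kk; subst r' s' j' k'.
by congr KunnethIndex; apply: Prop_irrelevance.
Qed.

(** With [iright], the indices from which the differential reaches [i]. *)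
Definition ileft (R : realType) n (l : R) (i : kunneth_index n l) :
  kunneth_index n.+1 l :=
  @KunnethIndex R n.+1 l (kr i) (ks i) (kj i).+1 (kk i) (kr_ge0 i) (ks_ge0 i)
    (krsE i) (congr1 S (kjkE i)).

Definition iright (R : realType) n (l : R) (i : kunneth_index n l) :
  kunneth_index n.+1 l :=
  @KunnethIndex R n.+1 l (kr i) (ks i) (kj i) (kk i).+1 (kr_ge0 i) (ks_ge0 i)
    (krsE i) (etrans (addnS (kj i) (kk i)) (congr1 S (kjkE i))).

Lemma eadd_fin (R : realType) (x y : \bar R) (l : R) :
  (0 <= x)%E -> (0 <= y)%E -> (x + y)%E = l%:E ->
  exists r s : R, [/\ 0 <= r, 0 <= s, r + s = l, x = r%:E & y = s%:E].
Proof.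
case: x y => [r| |] [s| |] // r0 s0 [rs]; exists r, s.
by rewrite -2!lee_fin.
Qed.

Section TensorComplex.
Variables (R : realType) (X Y : gmetric R).

Definition tsummand n (l : R) (i : kunneth_index n l) : zmodType :=
  tensor (MB X (kj i) (kr i)) (MB Y (kk i) (ks i)).

Definition TC n (l : R) : zmodType := dsum (@tsummand n l).

Section Piece.
Variables (n : nat) (l : R).
Local Notation I := (kunneth_index n l).

Definition tcomp (i : I) (w : {freeg (ne X * ne Y)}) : tsummand i :=
  flift (fun p => tens (mproj (kj i) (kr i) << p.1 >>)
                       (mproj (kk i) (ks i) << p.2 >>)) w.
HB.instance Definition _ i := GRing.isZmodMorphism.Build
  {freeg (ne X * ne Y)} (tsummand i) (tcomp i) (raddfB (flift (fun p =>
    tens (mproj (kj i) (kr i) << p.1 >>) (mproj (kk i) (ks i) << p.2 >>)))).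
Arguments tcomp : simpl never.

Lemma tcompU i x y : tcomp i << (x, y) >> =
  tens (mproj (kj i) (kr i) << x >>) (mproj (kk i) (ks i) << y >>).
Proof. exact: fliftU. Qed.

Lemma tcomp_prod i D E : tcomp i (lprod D E) =
  tens (mproj (kj i) (kr i) D) (mproj (kk i) (ks i) E).
Proof.
move: D; apply: freeg_ind => [|v w vE wE|x].
- by rewrite lprod0l !raddf0 tens0l.
- by rewrite lprodBl !raddfB /= vE wE tensBl.
move: E; apply: freeg_ind => [|v w vE wE|y]; first by rewrite !raddf0.
  by rewrite !raddfB /= vE wE.
by rewrite lprodU tcompU.
Qed.

Lemma mproj_neq0 (Z : gmetric R) m (r : R) (z : ne Z) :
  mproj m r << z >> <> 0 -> nedim z = m /\ plen z = r%:E.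
Proof. by move=> z0; apply: contrapT => zout; apply/z0/mproj_out. Qed.

Lemma tcomp_neq0 i x y : tcomp i << (x, y) >> <> 0 ->
  [/\ nedim x = kj i, plen x = (kr i)%:E, nedim y = kk i & plen y = (ks i)%:E].
Proof.
rewrite tcompU => xy0.
have [xj xr] : nedim x = kj i /\ plen x = (kr i)%:E.
  by apply: mproj_neq0 => x0; apply: xy0; rewrite x0 tens0l.
have [yk ys] : nedim y = kk i /\ plen y = (ks i)%:E.
  by apply: mproj_neq0 => y0; apply: xy0; rewrite y0 raddf0.
by split.
Qed.

Fact tcomp_support (p : ne X * ne Y) :
  exists s : seq I, forall i, tcomp i << p >> <> 0 -> i \in s.
Proof.
case: p => x y; have [[i i0]|none] := pselect (exists i, tcomp i << (x, y) >> <> 0).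
  exists [:: i] => i' i'0; rewrite inE; apply/eqP.
  have [xj xr yk ys] := tcomp_neq0 i0; have [xj' xr' yk' ys'] := tcomp_neq0 i'0.
  apply: kunneth_index_eq; [| |by rewrite -xj|by rewrite -yk].
    by apply: EFin_inj; rewrite -xr.
  by apply: EFin_inj; rewrite -ys.
by exists [::] => i i0; case: none; exists i.
Qed.

Definition tproj (w : {freeg (ne X * ne Y)}) : TC n l :=
  flift (fun p => dsum_mk (projT2 (cid (tcomp_support p)))) w.
HB.instance Definition _ := GRing.isZmodMorphism.Build
  {freeg (ne X * ne Y)} (TC n l) tproj
  (raddfB (flift (fun p => dsum_mk (projT2 (cid (tcomp_support p)))))).
Arguments tproj : simpl never.

Lemma dproj_tproj i w : dproj i (tproj w) = tcomp i w.
Proof.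
apply: (freeg_additive_eq (g := dproj i \o tproj) (h := tcomp i)) => p /=.
by rewrite [tproj _]fliftU.
Qed.

Definition tinj_summand (i : I) : {additive tsummand i -> {freeg (ne X * ne Y)}} :=
  tensor_lift (phi := fun a b => lprod (minj a) (minj b))
    (fun b => raddfB (lprodl (minj b) \o minj)) (fun a => raddfB (lprod (minj a) \o minj)).

Definition tinj (t : TC n l) : {freeg (ne X * ne Y)} := dlift tinj_summand t.
HB.instance Definition _ := GRing.isZmodMorphism.Build
  (TC n l) {freeg (ne X * ne Y)} tinj (raddfB (dlift tinj_summand)).
Arguments tinj : simpl never.

Lemma tinjE i a b : tinj (dinj i (tens a b)) = lprod (minj a) (minj b).
Proof. by rewrite /tinj dlift_inj /tinj_summand tensor_liftE. Qed.

Lemma TC_ind (P : TC n l -> Prop) :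
  P 0 -> (forall x y, P x -> P y -> P (x - y)) ->
  (forall i u v, P (dinj i (tens << u >> << v >> : tsummand i))) -> forall t, P t.
Proof.
move=> P0 PB PU; apply: dsum_ind => // i; apply: tensor_ind.
- by rewrite raddf0.
- by move=> x y Px Py; rewrite raddfB; apply: PB.
move=> a b; move: a; apply: freeg_ind.
- by rewrite tens0l raddf0.
- by move=> v w Pv Pw; rewrite tensBl raddfB; apply: PB.
move=> u; move: b; apply: freeg_ind; last exact: PU.
- by rewrite !raddf0.
- by move=> v w Pv Pw; rewrite !raddfB; apply: PB.
Qed.

Lemma tinjK t : tproj (tinj t) = t.
Proof.
move: t; apply: TC_ind; first by rewrite !raddf0.
  by move=> v w vE wE; rewrite !raddfB /= vE wE.
move=> i u v; apply: dsum_eqP => i'; rewrite dproj_tproj tinjE tcomp_prod.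
have [<-|ii'] := pselect (i = i'); first by rewrite dinj_same !minjK.
rewrite dinj_diff //; apply: contrapT; rewrite -tcomp_prod !minjU lprodU.
move=> /tcomp_neq0[uj ur vk vs]; apply: ii'.
rewrite nedim_of in uj; rewrite nedim_of in vk; rewrite plen_of in ur; rewrite plen_of in vs.
apply: kunneth_index_eq => //; apply: EFin_inj; rewrite -?ur -?vs.
  by rewrite (eqP (valP u)).
by rewrite (eqP (valP v)).
Qed.

Local Notation Pb := (cone_wbasis (pair_complex X Y)).

Fact tproj_out (p : Pb) : ~ (wdim p = n /\ wlen p = l%:E) -> tproj << p >> = 0.
Proof.
case: p => x y pout; apply: dsum_eqP => i; rewrite dproj_tproj raddf0.
apply: contrapT => /tcomp_neq0[xj xr yk ys]; apply: pout; split.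
  by rewrite /= /pdim /= xj yk kjkE.
by rewrite /= /shadow_len /= xr ys -EFinD krsE.
Qed.

Fact tprojK (p : Pb) : wdim p = n -> wlen p = l%:E -> tinj (tproj << p >>) = << p >>.
Proof.
case: p => x y pn pl.
have [r [s [r0 s0 rs xr ys]]] := eadd_fin (plen_ge0 x) (plen_ge0 y) pl.
pose i := @KunnethIndex R n l r s (nedim x) (nedim y) r0 s0 rs pn.
suff -> : tproj << (x, y) >> = dinj i (tens (mproj (nedim x) r << x >>)
    (mproj (nedim y) s << y >>) : tsummand i).
  by rewrite tinjE !mprojK // lprodU.
apply: dsum_eqP => i'; rewrite dproj_tproj.
have [<-|ii'] := pselect (i = i'); first by rewrite dinj_same tcompU.
rewrite dinj_diff //; apply: contrapT => /tcomp_neq0[xj xr' yk ys']; apply: ii'.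
apply: kunneth_index_eq => //; apply: EFin_inj => /=; first by rewrite -xr'.
by rewrite -ys'.
Qed.

Definition pair_piece : piece Pb n l :=
  @Piece R Pb n l (TC n l) tproj tinj tinjK tproj_out tprojK.
End Piece.
End TensorComplex.
Arguments tcomp {R X Y n l} i w : simpl never.
Arguments tproj {R X Y} n l w : simpl never.
Arguments tinj {R X Y n l} t : simpl never.

(* Keeps [/=] from unfolding maps that are defined with their structure. *)
Local Opaque tensor_map.

Section ProductChains.
Variables (R : realType) (X Y : gmetric R).
Local Notation LC := (list_complex X Y).
Local Notation PC := (pair_complex X Y).
Local Notation TC := (TC X Y).
Local Notation XY := (gprod X Y).

Definition Td n (l : R) : {additive TC n.+1 l -> TC n l} :=
  gr (pair_piece X Y n.+1 l) (pair_piece X Y n l) bd2.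

Definition EZm n (l : R) : {additive TC n l -> MB XY n l} :=
  gr (pair_piece X Y n l) (list_piece X Y n l) (EZ X Y).

Definition AWm n (l : R) : {additive MB XY n l -> TC n l} :=
  gr (list_piece X Y n l) (pair_piece X Y n l) (AW X Y).

Definition pair_htpy : {additive {freeg PC} -> {freeg PC}} :=
  htpy (AW X Y \o EZ X Y) idfun.
Definition list_htpy : {additive {freeg LC} -> {freeg LC}} :=
  htpy (EZ X Y \o AW X Y) idfun.

Definition Thtpy n (l : R) : {additive TC n l -> TC n.+1 l} :=
  gr (pair_piece X Y n l) (pair_piece X Y n.+1 l) pair_htpy.

Definition Mhtpy n (l : R) : {additive MB XY n l -> MB XY n.+1 l} :=
  gr (list_piece X Y n l) (list_piece X Y n.+1 l) list_htpy.

Let EZr : raises 0 (EZ X Y). Proof. exact: cmp_raises. Qed.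
Let AWr : raises 0 (AW X Y). Proof. exact: cmp_raises. Qed.
Let EZs := raises_shifts EZr.
Let AWs := raises_shifts AWr.
Let bd2s := @cbd_shifts _ _ _ PC.
Let bds := @cbd_shifts _ _ _ LC.

Let pair_htpy_s := raises_shifts
  (htpy_raises (raises_comp EZr AWr) (@raises_id _ _ _ PC)).
Let list_htpy_s := raises_shifts
  (htpy_raises (raises_comp AWr EZr) (@raises_id _ _ _ LC)).

Lemma mbnd_gr n l (e : MB XY n.+1 l) :
  mbnd e = gr (list_piece X Y n.+1 l) (list_piece X Y n l) (cbd LC) e.
Proof.
rewrite -{1}(minjK e) -mproj_bd //.
exact: (@pinj_low _ _ _ _ (MB_piece XY n.+1 l)).
Qed.

Lemma EZm_bd n l t : mbnd (EZm n.+1 l t) = EZm n l (Td n l t).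
Proof.
rewrite mbnd_gr (gr_comp _ _ _ _ EZs bds) ?addn1 ?addn0 //.
rewrite [RHS](gr_comp _ _ _ _ bd2s EZs) //.
exact: (congr1 _ (@cmp_bd _ _ _ PC LC _)).
Qed.

Lemma AWm_bd n l e : Td n l (AWm n.+1 l e) = AWm n l (mbnd e).
Proof.
rewrite mbnd_gr (gr_comp _ _ _ _ AWs bd2s) ?addn1 ?addn0 //.
rewrite [RHS](gr_comp _ _ _ _ bds AWs) //.
exact: (congr1 _ (@cmp_bd _ _ _ LC PC _)).
Qed.

Lemma pair_htpyE w : bd2 (pair_htpy w) + pair_htpy (bd2 w) =
  AW X Y (EZ X Y w) - w.
Proof.
apply: (@htpy_bd _ _ _ PC PC (AW X Y \o EZ X Y) idfun) => // v /=.
  by rewrite (@cmp_bd _ _ _ LC PC) (@cmp_bd _ _ _ PC LC).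
by rewrite (@cmp_aug _ _ _ LC PC) (@cmp_aug _ _ _ PC LC).
Qed.

Lemma list_htpyE w : bd (list_htpy w) + list_htpy (bd w) =
  EZ X Y (AW X Y w) - w.
Proof.
apply: (@htpy_bd _ _ _ LC LC (EZ X Y \o AW X Y) idfun) => // v /=.
  by rewrite (@cmp_bd _ _ _ PC LC) (@cmp_bd _ _ _ LC PC).
by rewrite (@cmp_aug _ _ _ PC LC) (@cmp_aug _ _ _ LC PC).
Qed.

Definition Tdiff n l : {additive TC n l -> TC n.-1 l} :=
  match n return {additive TC n l -> TC n.-1 l} with
  | 0 => \0
  | m.+1 => Td m l
  end.

Lemma cbd_pinj0 (C : cone_complex X Y) l (P : piece (cone_wbasis C) 0 l) e :
  cbd C (pinj P e) = 0.
Proof.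
move: (pinj P e) (pinj_hom e); apply: span_kills => _ [b [b0 _ ->]].
exact: cbd_dim0.
Qed.

(** For a cycle, the homotopy leaves only a boundary; in degree [0] every chain
    is a cycle. *)
Lemma AWm_EZm n l t : Tdiff n l t = 0 ->
  AWm n l (EZm n l t) = t + Td n l (Thtpy n l t).
Proof.
move=> t0; rewrite (gr_comp _ _ _ _ EZs AWs) //.
rewrite [Td _ _ _](gr_comp _ _ _ _ pair_htpy_s bd2s) ?addn1 ?addn0 //.
have := pair_htpyE (pinj (pair_piece X Y n l) t).
move/(congr1 (pproj (pair_piece X Y n l))); rewrite raddfD raddfB pinjK.
move/eqP; rewrite eq_sym subr_eq => /eqP ->.
suff -> : pproj (pair_piece X Y n l)
    (pair_htpy (bd2 (pinj (pair_piece X Y n l) t))) = 0 by rewrite addr0 addrC.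
case: n t t0 => [|n] t t0.
  by rewrite [bd2 _](@cbd_pinj0 PC) !raddf0.
rewrite -(gr_comp _ (pair_piece X Y n l) _ _ bd2s pair_htpy_s) ?addn1 ?addn0 //.
by rewrite [X in gr _ _ _ X](t0 : Td n l t = 0) raddf0.
Qed.

Lemma EZm_AWm n l e : mdiff XY n l e = 0 ->
  EZm n l (AWm n l e) = e + mbnd (Mhtpy n l e).
Proof.
move=> e0; rewrite (gr_comp _ _ _ _ AWs EZs) //.
rewrite mbnd_gr (gr_comp _ _ _ _ list_htpy_s bds) ?addn1 ?addn0 //.
have := list_htpyE (pinj (list_piece X Y n l) e).
move/(congr1 (pproj (list_piece X Y n l))); rewrite raddfD raddfB pinjK.
move/eqP; rewrite eq_sym subr_eq => /eqP ->.
suff -> : pproj (list_piece X Y n l)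
    (list_htpy (bd (pinj (list_piece X Y n l) e))) = 0 by rewrite addr0 addrC.
case: n e e0 => [|n] e e0.
  by rewrite [bd _](@cbd_pinj0 LC) !raddf0.
rewrite -(gr_comp _ (list_piece X Y n l) _ _ bds list_htpy_s) ?addn1 ?addn0 //.
by rewrite -mbnd_gr [mbnd e]e0 raddf0.
Qed.

Lemma mproj_sgn (Z : gmetric R) n l (w : {freeg (ne Z)}) :
  mproj n l (sgn w) = mproj n l w *~ (-1) ^+ n.
Proof.
move: w; apply: freeg_ind => [|v w vE wE|z]; first by rewrite !raddf0 mul0rz.
  by rewrite !raddfB /= vE wE mulrzBl.
rewrite sgnU raddfMz /=; have [->|/eqP z0] := eqVneq (mproj n l << z >>) 0.
  by rewrite !mul0rz.
by have [-> _] := mproj_neq0 z0.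
Qed.

Lemma lowN (Z : gmetric R) (x : ne Z) (r : R) :
  (plen x <= r%:E)%E -> << x >> \in low (ne_wbasis Z) r.
Proof. by move=> xr; apply: mem_span; exists x. Qed.

Lemma eadd_le (x y : \bar R) (r s : R) : (0 <= x)%E -> (0 <= y)%E ->
  (x + y <= (r + s)%:E)%E -> y = s%:E -> (x <= r%:E)%E.
Proof.
move=> x0 _ xy ys; move: x0 xy; rewrite ys.
by case: x => [x| |] //; rewrite -EFinD !lee_fin lerD2r.
Qed.

Lemma eadd_lt (x y : \bar R) (r s : R) : (0 <= x)%E -> (0 <= y)%E ->
  (x + y <= (r + s)%:E)%E -> (r%:E < x)%E -> (y < s%:E)%E.
Proof.
case: x y => [x| |] [y| |] // _ _; rewrite -EFinD lee_fin !lte_fin => xy rx.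
by rewrite -(ltrD2l r); apply: lt_le_trans xy; rewrite ltrD2r.
Qed.

(** The differential of a tensor product. A component of [bd2 << (x, y) >>] can
    only be nonzero when one of the two lists already has the right length, and
    then the other one is not too long. *)
Lemma TdE n l (t : TC n.+1 l) (i : kunneth_index n l) :
  dproj i (Td n l t) =
    tensor_map (@mbnd R X (kj i) (kr i)) idfun (dproj (ileft i) t) +
    tensor_map idfun (@mbnd R Y (kk i) (ks i)) (dproj (iright i) t)
      *~ (-1) ^+ kj i.
Proof.
have main w : w \in low (cone_wbasis PC) l -> tcomp i (bd2 w) =
    tensor_map (@mbnd R X (kj i) (kr i)) idfun (tcomp (ileft i) w) +
    tensor_map idfun (@mbnd R Y (kk i) (ks i)) (tcomp (iright i) w)
      *~ (-1) ^+ kj i.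
  move: w; apply: span_ind; first by rewrite !raddf0 mul0rz addr0.
    by move=> v w vE wE; rewrite !raddfB /= vE wE mulrzBl addBrACA.
  move=> _ [[x y] xyl ->]; rewrite !tcompU -lprodU bd2_prod raddfD /= !tcomp_prod.
  rewrite !tensor_mapE /= mproj_sgn tensMzl; congr (_ + _ *~ _).
    have [->|/eqP/mproj_neq0[_ ys]] := eqVneq (mproj (kk i) (ks i) << y >>) 0.
      by rewrite !raddf0.
    rewrite mproj_bd //; apply/lowN.
    apply: (eadd_le (plen_ge0 x) (plen_ge0 y) _ ys).
    by rewrite krsE.
  have [->|/eqP/mproj_neq0[_ xr]] := eqVneq (mproj (kj i) (kr i) << x >>) 0.
    by rewrite !tens0l.
  rewrite mproj_bd //; apply/lowN.
  apply: (eadd_le (plen_ge0 y) (plen_ge0 x) _ xr).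
  by rewrite addeC [ks i + _]addrC krsE.
rewrite -[t in RHS](tinjK t) [LHS]dproj_tproj !dproj_tproj.
exact/main/(@pinj_low _ _ _ _ (pair_piece X Y n.+1 l)).
Qed.
End ProductChains.

Section ProductNaturality.
Variables (R : realType) (X Y X' Y' : gmetric R).
Variables (f : short_map X X') (g : short_map Y Y').

Definition TC_map n (l : R) : {additive TC X Y n l -> TC X' Y' n l} :=
  dsum_map (fun i : kunneth_index n l =>
    tensor_map (MB_map f (kj i) (kr i)) (MB_map g (kk i) (ks i))).

Lemma pair_map_shifts : shifts (B := cone_wbasis (pair_complex X Y))
  (B' := cone_wbasis (pair_complex X' Y')) 0 0 (bmap (shape_map f g)).
Proof.
move=> [x y]; rewrite /= bmapU; apply: mem_span.
exists (shape_map f g (x, y)); split=> //; first by rewrite /= /pdim /= !nedim_map.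
by rewrite leeD ?plen_map.
Qed.

Lemma list_map_shifts : shifts (B := cone_wbasis (list_complex X Y))
  (B' := cone_wbasis (list_complex X' Y')) 0 0 (bmap (nemap (fg f g))).
Proof.
move=> z; rewrite /= bmapU; apply: mem_span.
exists (nemap (fg f g) z); split=> //; first by rewrite /= nedim_map.
rewrite /= -!plen_gprod.
exact: (plen_map (gprod_map f g)).
Qed.

(** When the lengths of the two lists are not those of the index, one list is
    too short and both sides vanish. *)
Lemma TC_map_gr n l t : TC_map n l t =
  gr (pair_piece X Y n l) (pair_piece X' Y' n l) (bmap (shape_map f g)) t.
Proof.
rewrite /gr /=; apply: dsum_eqP => i.
rewrite dproj_tproj dproj_map -{1}(tinjK t) dproj_tproj.
have := @pinj_low _ _ _ _ (pair_piece X Y n l) t; rewrite /=.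
move: (tinj t); apply: span_ind; first by rewrite !raddf0.
  by move=> v w vE wE; rewrite !raddfB /= vE wE.
move=> _ [[x y] xyl ->]; rewrite bmapU !tcompU tensor_mapE -!lmapU.
have small (Z Z' : gmetric R) (h : short_map Z Z') (z : ne Z) m (q : R) :
    (plen z < q%:E)%E -> mproj m q << z >> = 0 /\ mproj m q (lmap h << z >>) = 0.
  move=> zq; rewrite lmapU; split; apply: mproj_out => -[_ zq'].
    by rewrite zq' ltxx in zq.
  by have := le_lt_trans (plen_map h z) zq; rewrite zq' ltxx.
have xyl' : (plen x + plen y <= (kr i + ks i)%:E)%E by rewrite krsE.
have [xr|xr] := leP (plen x) (kr i)%:E; last first.
  have ys := eadd_lt (plen_ge0 x) (plen_ge0 y) xyl' xr.
  by have [-> ->] := small _ _ g y (kk i) _ ys; rewrite !raddf0.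
have [ys|ys] := leP (plen y) (ks i)%:E; first by rewrite !mproj_map // lowN.
have xr' : (plen x < (kr i)%:E)%E.
  by apply: (eadd_lt (plen_ge0 y) (plen_ge0 x) _ ys); rewrite addeC [ks i + _]addrC.
by have [-> ->] := small _ _ f x (kj i) _ xr'; rewrite raddf0 !tens0l.
Qed.

Lemma MB_map_gr n l e : MB_map (gprod_map f g) n l e =
  gr (list_piece X Y n l) (list_piece X' Y' n l) (bmap (nemap (fg f g))) e.
Proof.
rewrite -{1}(minjK e) -mproj_map //.
exact: (@pinj_low _ _ _ _ (MB_piece (gprod X Y) n l)).
Qed.

Lemma EZm_natural n l t :
  MB_map (gprod_map f g) n l (EZm X Y n l t) = EZm X' Y' n l (TC_map n l t).
Proof.
rewrite MB_map_gr TC_map_gr.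
rewrite (gr_comp _ _ _ _ (raises_shifts (@cmp_raises _ _ _ _ _)) list_map_shifts) //.
rewrite [RHS](gr_comp _ _ _ _ pair_map_shifts (raises_shifts (@cmp_raises _ _ _ _ _))) //.
exact: (congr1 _ (cmp_natural (pair_cmap f g) (list_cmap f g) _)).
Qed.

Lemma AWm_natural n l e :
  TC_map n l (AWm X Y n l e) = AWm X' Y' n l (MB_map (gprod_map f g) n l e).
Proof.
rewrite MB_map_gr TC_map_gr.
rewrite (gr_comp _ _ _ _ (raises_shifts (@cmp_raises _ _ _ _ _)) pair_map_shifts) //.
rewrite [RHS](gr_comp _ _ _ _ list_map_shifts (raises_shifts (@cmp_raises _ _ _ _ _))) //.
exact: (congr1 _ (cmp_natural (list_cmap f g) (pair_cmap f g) _)).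
Qed.
End ProductNaturality.

(** * Universal coefficients *)

Local Opaque qproj free_aug free_map.

Section Homology.
Variables (R : realType) (X : gmetric R).

Lemma mbnd_mbnd n l (c : MB X n.+2 l) : mbnd (mbnd c) = 0.
Proof.
rewrite -(minjK c) -mproj_bd; last exact: (@pinj_low _ _ _ _ (MB_piece X n.+2 l)).
rewrite -mproj_bd ?bd_bd ?raddf0 //.
apply: (shifts_low (@nebd_shifts R X)).
exact: (@pinj_low _ _ _ _ (MB_piece X n.+2 l)).
Qed.

Lemma mdiff_mbnd n l (c : MB X n.+1 l) : mdiff X n l (mbnd c) = 0.
Proof. by case: n c => [|n] c //; apply: mbnd_mbnd. Qed.

Lemma ret_exists n l : exists r : {additive MB X n l -> mcycle X n l},
  forall z, r (val z) = z.
Proof.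
have [e [de e0]] := free_split (mdiff X n l).
have cyc c : mdiff X n l ((idfun \- e) c) = 0 by rewrite raddfB /= de subrr.
exists (ker_lift cyc) => z; apply: val_inj; rewrite ker_liftE /=.
by rewrite e0 ?kernelP // subr0.
Qed.

Variables (n : nat) (l : R).
Local Notation C := (MB X n l).
Local Notation C1 := (MB X n.+1 l).
Local Notation Z := (mcycle X n l).
Local Notation H := (MH X n l).

(** Cycles are a direct summand: the boundaries of degree [n - 1] form a free
    group. *)
Definition ret : {additive C -> Z} := projT1 (cid (ret_exists n l)).

Lemma retK z : ret (val z) = z.
Proof. by rewrite /ret; case: cid. Qed.

Lemma ret_cycle c : mdiff X n l c = 0 -> val (ret c) = c.
Proof.
move=> c0; have cP : c \in kernel_pred (mdiff X n l) by apply/eqP.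
by rewrite (retK (Kernel cP)).
Qed.

Definition hclass : {additive Z -> H} := qproj (@mboundary R X n l).

Lemma hclass_surj (h : H) : exists z, hclass z = h.
Proof. by exists (repr h); apply: reprK. Qed.

Lemma hclass_eq0 z : hclass z = 0 <-> exists c : C1, mbnd c = val z.
Proof.
split=> [/eqP|[c cz]]; first by rewrite qproj_eq0 => /asboolP[c cz]; exists c.
by apply/eqP; rewrite qproj_eq0; apply/asboolP; exists c.
Qed.

Definition hproj : {additive C -> H} := hclass \o ret.

Lemma hproj_val z : hproj (val z) = hclass z.
Proof. by rewrite /hproj /= retK. Qed.

Lemma hproj_bnd c : hproj (mbnd c) = 0.
Proof.
have bz : val (ret (mbnd c)) = mbnd c by rewrite ret_cycle // mdiff_mbnd.
by apply/hclass_eq0; exists c.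
Qed.

(** The differential, followed by the section of it whose values have no
    component in the cycles. *)
Definition resid : {additive C -> C} := idfun \- (val \o ret).

Lemma residE c : resid c = c - val (ret c). Proof. by []. Qed.

Lemma ret_resid c : ret (resid c) = 0.
Proof. by rewrite residE raddfB /= retK subrr. Qed.

Lemma mdiff_resid c : mdiff X n l (resid c) = mdiff X n l c.
Proof. by rewrite residE raddfB /= kernelP subr0. Qed.

Lemma ret_detect c : ret c = 0 -> mdiff X n l c = 0 -> c = 0.
Proof. by move=> rc /ret_cycle <-; rewrite rc. Qed.

(** A lift of [hproj] to the standard resolution: on cycles and boundaries it is
    a comparison of two free resolutions of [H]. *)
Definition lam : {additive C -> {freeg H}} := flift (fun u => << hproj << u >> >>).

Lemma aug_lam c : free_aug H (lam c) = hproj c.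
Proof.
apply: (freeg_additive_eq (g := free_aug H \o lam) (h := hproj)) => u.
by rewrite /= /lam fliftU [LHS]fliftU.
Qed.

Fact lamd_subproof c : free_aug H ((lam \o @mbnd R X n l) c) = 0.
Proof. by rewrite /= aug_lam hproj_bnd. Qed.

Definition lamd : {additive C1 -> syzygy H} := ker_lift lamd_subproof.

Lemma lamdE c : val (lamd c) = lam (mbnd c). Proof. by []. Qed.

Lemma lamd_cycle c : mbnd c = 0 -> lamd c = 0.
Proof. by move=> c0; apply: val_inj; rewrite lamdE c0 raddf0. Qed.

(** The comparison of resolutions in the other direction. *)
Definition mu : {additive {freeg H} -> Z} := flift repr.

Lemma hclass_mu D : hclass (mu D) = free_aug H D.
Proof.
apply: (freeg_additive_eq (g := hclass \o mu) (h := free_aug H)) => h.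
by rewrite /= /mu fliftU [RHS]fliftU; apply: reprK.
Qed.

Arguments ret : simpl never.
Arguments hclass : simpl never.
Arguments lam : simpl never.
Arguments mu : simpl never.
End Homology.
Arguments ret {R X n l}.
Arguments hclass {R X n l}.
Arguments hproj {R X n l}.
Arguments resid {R X n l}.
Arguments lam {R X n l}.
Arguments lamd {R X n l}.
Arguments mu {R X n l}.

Lemma mbnd_val (R : realType) (X : gmetric R) n l (z : mcycle X n.+1 l) :
  mbnd (val z) = 0.
Proof. exact: (kernelP z). Qed.

Local Opaque ret hclass lam mu resid.

Section UniversalCoefficients.
Variables (R : realType) (X : gmetric R) (n : nat) (l : R).
Local Notation C := (MB X n l).
Local Notation C1 := (MB X n.+1 l).
Local Notation Z := (mcycle X n l).
Local Notation H := (MH X n l).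

(** A chain is determined by its boundary and its component in the cycles, so the
    chain with a given boundary and no such component depends additively on it:
    see [boundary_lift]. *)
Lemma boundary_unique (c c' : C1) :
  mbnd c = mbnd c' -> ret c = ret c' -> c = c'.
Proof.
move=> dc rc; apply/eqP; rewrite -subr_eq0; apply/eqP/ret_detect.
  by rewrite raddfB /= rc subrr.
by rewrite raddfB /= dc subrr.
Qed.

Lemma boundary_lift (A : zmodType) (g : {additive A -> Z}) :
  (forall a, hclass (g a) = 0) ->
  exists h : {additive A -> C1},
    forall a, mbnd (h a) = val (g a) /\ ret (h a) = 0.
Proof.
move=> g0; apply: (@additive_choice A C1 (fun a c =>
  mbnd c = val (g a) /\ ret c = 0)).
- move=> a; have [c cg] := (hclass_eq0 _).1 (g0 a).
  by exists (resid c); rewrite ret_resid (mdiff_resid (n := n.+1)).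
- by move=> a c c' [ca rc] [c'a rc']; apply: boundary_unique; rewrite ?ca ?c'a ?rc.
- by move=> a a' c c' [ca rc] [c'a rc']; rewrite !raddfB /= ca c'a rc rc' subrr.
Qed.

Variable B : zmodType.
Local Notation tl f := (tensor_map f (idfun : {additive B -> B})).

Lemma syz_lift : exists m : {additive syzygy H -> C1},
  forall y, mbnd (m y) = val (mu (val y)) /\ ret (m y) = 0.
Proof.
apply: (@boundary_lift _ (mu \o ker_incl (free_aug H))) => y.
by rewrite hclass_mu; apply: kernelP.
Qed.

(** [lamd] maps the resolution of [H] by boundaries and cycles to the standard
    one, and [mu] goes back. The composites are homotopic to the identity, and
    the homotopies vanish on the elements in question. *)
Lemma uct_injective (x : tensor C1 B) :
  tl (@mbnd R X n l) x = 0 -> tl lamd x = 0 -> tl (val \o ret) x = x.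
Proof.
move=> dx lx; have [m mP] := syz_lift.
have [|k kP] := @boundary_lift C ((mu \o lam \o val \o ret) \- ret).
  move=> c; rewrite raddfB /= hclass_mu aug_lam hproj_val; exact: subrr.
have mE c : m (lamd c) = (c - val (ret c)) + k (mbnd c).
  have [dm rm] := mP (lamd c); have [dk rk] := kP (mbnd c).
  apply: boundary_unique.
    rewrite dm raddfD raddfB /= mbnd_val subr0 dk raddfB /=.
    by rewrite ret_cycle ?mdiff_mbnd // addrC subrK.
  by rewrite rm raddfD raddfB /= retK subrr add0r rk.
have : tl m (tl lamd x) = x - tl (val \o ret) x + tl k (tl (@mbnd R X n l) x).
  move: x {dx lx}; apply: tensor_ind => [|x y xE yE|c b].
  - by rewrite !raddf0 !addr0.
  - by rewrite !raddfB /= xE yE addBrACA addBrACA.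
  - by rewrite !tensor_mapE /= mE tensDl tensBl.
rewrite lx dx !raddf0 addr0 => /eqP.
by rewrite eq_sym subr_eq0 => /eqP.
Qed.

(** The element is carried over to the resolution by cycles and boundaries, where
    it is a boundary on the left because it dies in the free group. *)
Lemma uct_surjective (y : Tor H B) :
  exists x : tensor C1 B, tl (@mbnd R X n l) x = 0 /\ tl lamd x = val y.
Proof.
have [m mP] := syz_lift; exists (tl m (val y)); split.
  have -> : tl (@mbnd R X n l) (tl m (val y)) =
      tl (val \o mu) (tor_diff H B (val y)).
    move: (val y); apply: tensor_ind => [|v w vE wE|s b]; first by rewrite !raddf0.
      by rewrite !raddfB /= vE wE.
    by rewrite /tor_diff !tensor_mapE /=; have [-> _] := mP s.
  by rewrite kernelP raddf0.
have kcyc D : free_aug H (((lam \o val \o mu) \- idfun) D) = 0.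
  by rewrite raddfB /= aug_lam hproj_val hclass_mu subrr.
pose k := ker_lift kcyc.
have -> : tl lamd (tl m (val y)) = val y + tl k (tor_diff H B (val y)).
  move: (val y); apply: tensor_ind => [|v w vE wE|s b].
  - by rewrite !raddf0 addr0.
  - by rewrite !raddfB /= vE wE addBrACA.
  rewrite /tor_diff !tensor_mapE /= -tensDl; congr (tens _ _).
  apply: val_inj; rewrite lamdE raddfD /=; have [-> _] := mP s.
  by rewrite addrC subrK.
by rewrite kernelP raddf0 addr0.
Qed.
End UniversalCoefficients.

(** * The Kunneth sequence of the tensor product *)

Section Indices.
Variables (R : realType) (l : R).

Lemma ileft_inj n : injective (@ileft R n l).
Proof.
move=> i i' e; have er := congr1 (@kr _ _ _) e; have es := congr1 (@ks _ _ _) e.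
have ej := congr1 (@kj _ _ _) e; have ek := congr1 (@kk _ _ _) e.
by apply: kunneth_index_eq => //; apply: succn_inj.
Qed.

Lemma iright_inj n : injective (@iright R n l).
Proof.
move=> i i' e; have er := congr1 (@kr _ _ _) e; have es := congr1 (@ks _ _ _) e.
have ej := congr1 (@kj _ _ _) e; have ek := congr1 (@kk _ _ _) e.
by apply: kunneth_index_eq => //; apply: succn_inj.
Qed.

Lemma index_left n (i : kunneth_index n.+1 l) :
  kj i = 0%N \/ exists i0, i = ileft i0.
Proof.
case: i => r s [|j] k r0 s0 rs jk; [by left|right].
exists (@KunnethIndex R n l r s j k r0 s0 rs (succn_inj jk)).
exact: kunneth_index_eq.
Qed.

Lemma index_right n (i : kunneth_index n.+1 l) :
  kk i = 0%N \/ exists i0, i = iright i0.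
Proof.
case: i => r s j [|k] r0 s0 rs jk; [by left|right].
have jk' : (j + k)%N = n by apply: succn_inj; rewrite -jk addnS.
exists (@KunnethIndex R n l r s j k r0 s0 rs jk').
exact: kunneth_index_eq.
Qed.

Lemma index0 (i : kunneth_index 0 l) : kj i = 0%N /\ kk i = 0%N.
Proof.
by case: i => r s j k r0 s0 rs /= /eqP; rewrite addn_eq0 => /andP[/eqP -> /eqP ->].
Qed.
End Indices.

Section TensorKunneth.
Variables (R : realType) (X Y : gmetric R) (l : R).
Local Notation TC := (TC X Y).
Local Notation Td n := (Td X Y n l).
Local Notation summand i := (tsummand X Y i).
Local Notation dX i := (@mbnd R X (kj i) (kr i)).
Local Notation dY i := (@mbnd R Y (kk i) (ks i)).

Lemma Td_Td n (t : TC n.+2 l) : Td n (Td n.+1 t) = 0.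
Proof.
rewrite (gr_comp _ _ _ _ (@cbd_shifts _ _ _ (pair_complex X Y))
  (@cbd_shifts _ _ _ (pair_complex X Y))) ?addn1 ?addn0 //.
by rewrite [cbd _ (cbd _ _)](@cbd_cbd _ _ _ (pair_complex X Y)) raddf0.
Qed.

Lemma left_cycle0 n (i : kunneth_index n.+1 l) (x : summand i) :
  tensor_map (mdiff X (kj i) (kr i)) idfun x = 0 ->
  forall i', tensor_map (dX i') idfun (dproj (ileft i') (dinj i x)) = 0.
Proof.
move=> x0 i'; have [e|ne] := pselect (i = ileft i').
  by subst i; rewrite dinj_same.
by rewrite dinj_diff // raddf0.
Qed.

Lemma right_cycle0 n (i : kunneth_index n.+1 l) (x : summand i) :
  tensor_map idfun (mdiff Y (kk i) (ks i)) x = 0 ->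
  forall i', tensor_map idfun (dY i') (dproj (iright i') (dinj i x)) = 0.
Proof.
move=> x0 i'; have [e|ne] := pselect (i = iright i').
  by subst i; rewrite dinj_same.
by rewrite dinj_diff // raddf0.
Qed.

Lemma Td_left n (i : kunneth_index n l) (x : summand (ileft i)) :
  tensor_map idfun (mdiff Y (kk i) (ks i)) x = 0 ->
  Td n (dinj (ileft i) x) = dinj i (tensor_map (dX i) idfun x : summand i).
Proof.
move=> x0; apply: dsum_eqP => i'; rewrite TdE right_cycle0 // mul0rz addr0.
have [<-|ne] := pselect (i = i'); first by rewrite !dinj_same.
by rewrite !dinj_diff ?raddf0 // => /ileft_inj.
Qed.

Lemma Td_right n (i : kunneth_index n l) (x : summand (iright i)) :
  tensor_map (mdiff X (kj i) (kr i)) idfun x = 0 ->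
  Td n (dinj (iright i) x) =
    dinj i (tensor_map idfun (dY i) x : summand i) *~ (-1) ^+ kj i.
Proof.
move=> x0; apply: dsum_eqP => i'; rewrite TdE left_cycle0 // add0r raddfMz /=.
have [<-|ne] := pselect (i = i'); first by rewrite !dinj_same.
by rewrite !dinj_diff ?raddf0 ?mul0rz // => /iright_inj.
Qed.

Section Cycle.
Variables (n : nat) (t : TC n.+1 l).
Hypothesis t_cycle : Td n t = 0.

Lemma cycle_at (i : kunneth_index n l) :
  tensor_map (dX i) idfun (dproj (ileft i) t) =
  - (tensor_map idfun (dY i) (dproj (iright i) t) *~ (-1) ^+ kj i).
Proof. by apply/eqP; rewrite -addr_eq0 -TdE t_cycle. Qed.

Lemma cycle_hproj (i : kunneth_index n l) :
  tensor_map (dX i) hproj (dproj (ileft i) t) = 0.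
Proof.
rewrite -[LHS](tensor_map_comp (dX i) idfun idfun hproj) cycle_at.
rewrite raddfN raddfMz /= tensor_map_comp tensor_map0r ?mul0rz ?oppr0 // => b.
exact: hproj_bnd.
Qed.

Lemma cycle_mdiff (i : kunneth_index n l) :
  tensor_map (dX i) (mdiff Y (kk i) (ks i)) (dproj (ileft i) t) = 0.
Proof.
rewrite -[LHS](tensor_map_comp (dX i) idfun idfun (mdiff _ _ _)) cycle_at.
rewrite raddfN raddfMz /= tensor_map_comp tensor_map0r ?mul0rz ?oppr0 // => b.
exact: mdiff_mbnd.
Qed.
End Cycle.

(** The component of the connecting map at [(j, k + 1)] only involves the
    component of a chain at [(j + 1, k)]: on the left the differential, lifted
    to the standard resolution, on the right the class. *)
Definition bcomp n (i : kunneth_index n l) (t : TC n l) :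
    tensor (syzygy (MH X (kj i) (kr i))) (MHpred Y (kk i) (ks i)) :=
  match i return
    tensor (syzygy (MH X (kj i) (kr i))) (MHpred Y (kk i) (ks i)) with
  | KunnethIndex r s j k r0 s0 rs jk =>
    match k return (j + k)%N = n ->
      tensor (syzygy (MH X j r)) (MHpred Y k s) with
    | 0 => fun _ => 0
    | k'.+1 => fun jk => tensor_map (@lamd R X j r) (@hproj R Y k' s)
        (dproj (@KunnethIndex R n l r s j.+1 k' r0 s0 rs
                  (etrans (addSnnS j k') jk)) t)
    end jk
  end.

Fact bcomp_is_additive n (i : kunneth_index n l) : zmod_morphism (bcomp i).
Proof.
case: i => r s j [|k] r0 s0 rs jk t t' /=; first by rewrite subrr.
by rewrite !raddfB.
Qed.
HB.instance Definition _ n (i : kunneth_index n l) :=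
  GRing.isZmodMorphism.Build (TC n l) _ (bcomp i) (bcomp_is_additive i).

Arguments bcomp : simpl never.

Lemma bcomp0 n (i : kunneth_index n l) t : kk i = 0%N -> bcomp i t = 0.
Proof. by case: i => r s j [|k]. Qed.

Lemma bcomp_right n (i : kunneth_index n l) (t : TC n.+1 l) :
  bcomp (iright i) t = tensor_map lamd hproj (dproj (ileft i) t).
Proof.
case: i => r s j k r0 s0 rs jk; rewrite /bcomp /iright /ileft /=.
by rewrite (Prop_irrelevance (etrans _ _) (congr1 S jk)).
Qed.

(** A chain that is a cycle on the left, or has no component in the cycles on
    the right, does not contribute at any index. *)
Lemma bcomp_dinj n (i : kunneth_index n l) (x : summand i) :
  tensor_map (mdiff X (kj i) (kr i)) idfun x = 0 \/
    tensor_map idfun (@ret _ _ (kk i) (ks i)) x = 0 ->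
  forall i', bcomp i' (dinj i x) = 0.
Proof.
case: n i x => [|n] i x x0 i'; first by apply: bcomp0; have [] := index0 i'.
have [/bcomp0 //|[i0 ->]] := index_right i'; rewrite bcomp_right.
have [e|ne] := pselect (i = ileft i0); last by rewrite dinj_diff ?raddf0.
subst i; rewrite dinj_same; case: x0 => x0.
  have -> : tensor_map lamd hproj x = tensor_map idfun hproj (tensor_map lamd idfun x).
    by rewrite tensor_map_comp; apply: tensor_map_ext.
  rewrite (@free_tensor_kills _ _ _ _ (dX i0) lamd) ?raddf0 //.
  by move=> c; apply: lamd_cycle.
have -> : tensor_map lamd hproj x = tensor_map lamd hclass (tensor_map idfun ret x).
  by rewrite tensor_map_comp; apply: tensor_map_ext.
by rewrite x0 raddf0.
Qed.

Lemma bcomp_boundary n (i : kunneth_index n l) (w : TC n.+1 l) :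
  bcomp i (Td n w) = 0.
Proof.
case: n i w => [|n] i w; first by apply: bcomp0; have [] := index0 i.
have [/bcomp0 //|[i0 ->]] := index_right i; rewrite bcomp_right TdE.
rewrite raddfD raddfMz /= !tensor_map_comp tensor_map0l ?tensor_map0r ?mul0rz ?addr0 //.
  by move=> c; apply: hproj_bnd.
by move=> c; apply: lamd_cycle; apply: mbnd_mbnd.
Qed.

Lemma bcomp_tor n (i : kunneth_index n l) (t : TC n l) : Tdiff X Y n l t = 0 ->
  tor_diff _ _ (bcomp i t) = 0.
Proof.
case: n i t => [|n] i t t0.
  by rewrite bcomp0 ?raddf0 //; have [] := index0 i.
have [i0|[i0 ->]] := index_right i; first by rewrite bcomp0 ?raddf0.
rewrite bcomp_right /tor_diff tensor_map_comp.
have -> : tensor_map (ker_incl (free_aug (MH X (kj i0) (kr i0))) \o lamd)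
    (idfun \o hproj) (dproj (ileft i0) t) =
    tensor_map lam idfun (tensor_map (dX i0) hproj (dproj (ileft i0) t)).
  by rewrite tensor_map_comp; apply: tensor_map_ext.
by rewrite cycle_hproj ?raddf0.
Qed.

Lemma bcomp_support n (t : TC n l) :
  exists s : seq (kunneth_index n l), forall i, bcomp i t <> 0 -> i \in s.
Proof.
case: n t => [|n] t.
  by exists [::] => i []; apply: bcomp0; have [] := index0 i.
have [s [_ ts]] := dsum_support t.
pose psi i' := if pselect (exists i0 : kunneth_index n l, i' = ileft i0) is left e
  then Some (iright (projT1 (cid e))) else None.
exists (pmap psi s) => i it; have [i0|[i0 ei]] := index_right i.
  by case: it; apply: bcomp0.
rewrite mem_pmap; apply/mapP; exists (ileft i0).
  by apply: ts => t0; apply: it; rewrite ei bcomp_right t0 raddf0.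
rewrite /psi; case: pselect => [e|[]]; last by exists i0.
by case: cid => i1 /= /ileft_inj <-; rewrite ei.
Qed.
End TensorKunneth.
Arguments bcomp {R X Y l n} i t : simpl never.

Local Opaque Td.

Definition zscale (A : zmodType) (z : int) (a : A) : A := a *~ z.
Fact zscale_is_additive (A : zmodType) z : zmod_morphism (@zscale A z).
Proof. by move=> a b; rewrite /zscale mulrzBl. Qed.
HB.instance Definition _ (A : zmodType) z :=
  GRing.isZmodMorphism.Build A A (@zscale A z) (zscale_is_additive z).

(** Right exactness, followed by [resid] on the right. *)
Lemma hclass0_boundary (R : realType) (Y : gmetric R) k (s : R) (A : zmodType)
    (x : tensor A (mcycle Y k s)) : tensor_map idfun hclass x = 0 ->
  exists w : tensor A (MB Y k.+1 s), tensor_map idfun (@mbnd R Y k s) w =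
    tensor_map idfun \val x /\ tensor_map idfun ret w = 0.
Proof.
move/tensor_map_ker => /(_ (fun a => ex_intro _ a erefl) (@hclass_surj _ _ _ _)) mem.
have [w wE] : exists w : tensor A (MB Y k.+1 s),
    tensor_map idfun (@mbnd R Y k s) w = tensor_map idfun \val x.
  move: x mem; apply: span_ind.
  - by exists 0; rewrite !raddf0.
  - by move=> v w [v' v'E] [w' w'E]; exists (v' - w'); rewrite !raddfB v'E w'E.
  - move=> _ [a [z [[/= -> | /hclass_eq0[c cz]] ->]]].
      by exists 0; rewrite tens0l !raddf0.
    by exists (tens a c); rewrite !tensor_mapE /= cz.
exists (tensor_map idfun resid w); rewrite -wE !tensor_map_comp; split.
  apply: tensor_map_ext => // c /=; exact: (mdiff_resid (n := k.+1)).
by apply: tensor_map0r => c; apply: ret_resid.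
Qed.

(** The left differential of [w] vanishes because it is a cycle on the right
    without component in the cycles. *)
Lemma ret0_boundary_cycle (R : realType) (X Y : gmetric R) j k (r s : R)
    (a : tensor (MB X j.+1 r) (MB Y k s)) (w : tensor (MB X j r) (MB Y k.+1 s)) :
  tensor_map idfun (@mbnd R Y k s) w = tensor_map (@mbnd R X j r) idfun a ->
  tensor_map idfun ret w = 0 -> tensor_map (mdiff X j r) idfun w = 0.
Proof.
case: j a w => [|j] a w wE rw; first exact: tensor_map0l.
apply: (@free_tensor_detect _ _ _ _ ret (mdiff Y k.+1 s)).
- exact: ret_detect.
- have -> : tensor_map idfun ret (tensor_map (mdiff X j.+1 r) idfun w) =
      tensor_map (mdiff X j.+1 r) idfun (tensor_map idfun ret w).
    by rewrite !tensor_map_comp; apply: tensor_map_ext.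
  by rewrite rw raddf0.
- have -> : tensor_map idfun (mdiff Y k.+1 s)
      (tensor_map (mdiff X j.+1 r) idfun w) =
      tensor_map (mdiff X j.+1 r) idfun (tensor_map idfun (@mbnd R Y k s) w).
    by rewrite !tensor_map_comp; apply: tensor_map_ext.
  by rewrite wE tensor_map_comp tensor_map0l // => c; apply: mdiff_mbnd.
Qed.

Section TensorExactness.
Variables (R : realType) (X Y : gmetric R) (l : R).
Local Notation TC := (TC X Y).
Local Notation Td n := (Td X Y n l).
Local Notation summand i := (tsummand X Y i).
Local Notation dX i := (@mbnd R X (kj i) (kr i)).
Local Notation dY i := (@mbnd R Y (kk i) (ks i)).

Lemma Tdiff_Td n (w : TC n.+1 l) : Tdiff X Y n l (Td n w) = 0.
Proof. by case: n w => [|n] w //; apply: Td_Td. Qed.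

Definition zsummand n (i : kunneth_index n l) : zmodType :=
  tensor (mcycle X (kj i) (kr i)) (mcycle Y (kk i) (ks i)).

Definition zincl n (i : kunneth_index n l) : {additive zsummand i -> summand i} :=
  tensor_map \val \val.

Lemma zincl_left n (i : kunneth_index n l) x :
  tensor_map (mdiff X (kj i) (kr i)) idfun (zincl i x) = 0.
Proof. by rewrite /zincl tensor_map_comp tensor_map0l // => a; apply: kernelP. Qed.

Lemma zincl_right n (i : kunneth_index n l) x :
  tensor_map idfun (mdiff Y (kk i) (ks i)) (zincl i x) = 0.
Proof. by rewrite /zincl tensor_map_comp tensor_map0r // => a; apply: kernelP. Qed.

Lemma zincl_cycle n (z : dsum (@zsummand n)) :
  Tdiff X Y n l (dsum_map (@zincl n) z) = 0.
Proof.
case: n z => [//|n]; apply: dsum_ind; first by rewrite !raddf0.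
  by move=> v w vE wE; rewrite !raddfB vE wE subrr.
move=> i x; rewrite dsum_map_inj; apply: dsum_eqP => i'.
rewrite [Tdiff _ _ _ _ _]/(Td n _) TdE raddf0 left_cycle0 ?zincl_left // add0r.
by rewrite right_cycle0 ?zincl_right // mul0rz.
Qed.

Lemma summand_detect n (i : kunneth_index n l) (x : summand i) :
  tensor_map idfun (@ret _ _ (kk i) (ks i)) x = 0 ->
  tensor_map idfun (mdiff Y (kk i) (ks i)) x = 0 -> x = 0.
Proof. by move=> rx dx; apply: free_tensor_detect rx dx => c; apply: ret_detect. Qed.

(** A cycle without components in the complements of the cycles of [Y]
    vanishes: its second differential is zero because it lies in those
    complements as well. *)
Lemma ret0_cycle n (t : TC n l) : Tdiff X Y n l t = 0 ->
  (forall i : kunneth_index n l,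
     tensor_map idfun (@ret _ _ (kk i) (ks i)) (dproj i t) = 0) -> t = 0.
Proof.
move=> t0 rt; apply: dsum_eqP => i; rewrite raddf0.
apply: summand_detect; first exact: rt.
case: n t t0 rt i => [|n] t t0 rt i.
  by apply: tensor_map0r => b; have [_ k0] := index0 i; move: b; rewrite k0.
have [k0|[i0 ei]] := index_right i.
  by apply: tensor_map0r => b; move: b; rewrite k0.
subst i; have := cycle_at t0 i0.
move/(congr1 (tensor_map idfun (@ret _ _ (kk i0) (ks i0)))).
rewrite tensor_map_comp raddfN raddfMz /= tensor_map_comp.
have -> : tensor_map (idfun \o dX i0) (ret \o idfun) (dproj (ileft i0) t) =
    tensor_map (dX i0) idfun (tensor_map idfun ret (dproj (ileft i0) t)).
  by rewrite tensor_map_comp; apply: tensor_map_ext.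
rewrite rt raddf0 => /esym/eqP; rewrite oppr_eq0 => /eqP.
move/(congr1 (fun x => x *~ (-1) ^+ kj i0)).
rewrite -mulrzA -exprMn mulrNN mulr1 expr1n mulr1z mul0rz.
move/(congr1 (tensor_map idfun (\val : mcycle Y (kk i0) (ks i0) -> _))).
rewrite raddf0 tensor_map_comp => <-; apply: tensor_map_ext => // b /=.
by rewrite ret_cycle // mdiff_mbnd.
Qed.

(** By right exactness, the part of [t] in the cycles of [Y] is the second
    differential of a chain [w]. When [w] is moved to the complements of those
    cycles, the difference of [t] and the differential of [w] falls under
    [ret0_cycle]. *)
Lemma hproj0_boundary n (t : TC n l) : Tdiff X Y n l t = 0 ->
  (forall i : kunneth_index n l,
     tensor_map idfun (@hproj _ _ (kk i) (ks i)) (dproj i t) = 0) ->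
  exists w, t = Td n w.
Proof.
move=> t0 pt.
(* The sign cancels the one in [TdE]. *)
pose vr (i : kunneth_index n l) : {additive summand i -> summand i} :=
  tensor_map (zscale ((-1) ^+ kj i)) (\val \o @ret _ _ (kk i) (ks i)).
pose P (i : kunneth_index n l) := summand (iright i).
have [|b bE] := @dsum_lift_along _ P (fun i => summand i)
    (fun i => tensor_map idfun (dY i)) (dsum_map vr t).
  move=> i; have : tensor_map idfun (@hclass _ _ (kk i) (ks i))
      (tensor_map idfun (@ret _ _ (kk i) (ks i)) (dproj i t)) = 0.
    by rewrite tensor_map_comp -[RHS](pt i); apply: tensor_map_ext.
  move=> h0; pose sc := zscale (A := MB X (kj i) (kr i)) ((-1) ^+ kj i).
  have [|w [wE _]] := @hclass0_boundary R Y (kk i) (ks i) _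
      (tensor_map sc ret (dproj i t)).
    have -> : tensor_map idfun hclass (tensor_map sc ret (dproj i t)) =
        tensor_map sc idfun (tensor_map idfun hclass
          (tensor_map idfun ret (dproj i t))).
      by rewrite !tensor_map_comp; apply: tensor_map_ext.
    by rewrite h0 raddf0.
  exists w; rewrite wE dproj_map tensor_map_comp.
  exact: tensor_map_ext.
pose rs (i : kunneth_index n l) : {additive P i -> P i} :=
  tensor_map idfun (@resid _ _ (kk i).+1 (ks i)).
pose G (i : kunneth_index n l) : {additive P i -> TC n.+1 l} :=
  (dinj (A := @tsummand R X Y n.+1 l) (iright i)
    : {additive summand (iright i) -> TC n.+1 l}).
pose w := dlift G (dsum_map rs b); exists w.
have wi i : dproj (iright i) w = rs i (dproj i b).
  rewrite /w; move: b {bE w}; apply: dsum_ind; first by rewrite !raddf0.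
    by move=> x y xE yE; rewrite !raddfB /= xE yE.
  move=> i' x; rewrite dsum_map_inj dlift_inj /G /=.
  have [e|ne] := pselect (i' = i); first by subst i; rewrite !dinj_same.
  by rewrite !dinj_diff ?raddf0 // => /iright_inj.
have rw i : tensor_map idfun (@ret _ _ (kk i) (ks i)) (dproj i w) = 0.
  rewrite /w; move: b {bE w wi}; apply: dsum_ind; first by rewrite !raddf0.
    by move=> x y xE yE; rewrite !raddfB /= xE yE subrr.
  move=> i' x; rewrite dsum_map_inj dlift_inj /G /=.
  have [e|ne] := pselect (iright i' = i); last by rewrite dinj_diff ?raddf0.
  subst i; rewrite dinj_same /rs tensor_map_comp tensor_map0r // => c.
  exact: ret_resid.
apply/eqP; rewrite -subr_eq0; apply/eqP; apply: ret0_cycle.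
  by rewrite raddfB t0 Tdiff_Td subrr.
move=> i; rewrite dprojB raddfB TdE raddfD raddfMz /= wi.
have -> : tensor_map idfun ret (tensor_map (dX i) idfun (dproj (ileft i) w)) = 0.
  have -> : tensor_map idfun ret (tensor_map (dX i) idfun (dproj (ileft i) w)) =
      tensor_map (dX i) idfun (tensor_map idfun ret (dproj (ileft i) w)).
    by rewrite !tensor_map_comp; apply: tensor_map_ext.
  by rewrite rw raddf0.
rewrite add0r; have -> : tensor_map idfun (dY i) (rs i (dproj i b)) =
    tensor_map idfun (dY i) (dproj i b).
  rewrite /rs tensor_map_comp; apply: tensor_map_ext => // c /=.
  exact: (mdiff_resid (n := (kk i).+1)).
have := congr1 (dproj i) bE; rewrite !dproj_map => ->.
rewrite /vr tensor_map_comp; apply/eqP; rewrite subr_eq0; apply/eqP.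
move: (dproj i t); apply: tensor_ind => [|x y xE yE|x y].
- by rewrite !raddf0 mul0rz.
- by rewrite !raddfB /= xE yE mulrzBl.
rewrite !tensor_mapE /= retK /zscale tensMzl -mulrzA -exprMn mulrNN mulr1 expr1n.
by rewrite mulr1z.
Qed.

(** When classes are taken on the right, [t] becomes a family of cycles with
    coefficients in the homology of [Y]; by [uct_injective] they come from
    cycles of [X]. So [t] has the same classes on the right as a sum of products
    of cycles, and [hproj0_boundary] applies to the difference. *)
Theorem tensor_middle n (t : TC n l) : Tdiff X Y n l t = 0 ->
  (forall i : kunneth_index n l, bcomp i t = 0) ->
  exists z w, t = dsum_map (@zincl n) z + Td n w.
Proof.
move=> t0 bt.
pose rr (i : kunneth_index n l) : {additive summand i -> zsummand i} :=
  tensor_map ret ret.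
pose z := dsum_map rr t; exists z.
have [||w wE] := @hproj0_boundary n (t - dsum_map (@zincl n) z).
- by rewrite raddfB t0 zincl_cycle subrr.
- move=> i; rewrite dprojB raddfB /z !dproj_map.
  have left_part : tensor_map (\val \o @ret _ _ (kj i) (kr i)) idfun
      (tensor_map idfun (@hproj _ _ (kk i) (ks i)) (dproj i t)) =
      tensor_map idfun hproj (dproj i t).
    case: n t t0 bt rr z i => [|n] t t0 bt rr z i.
      rewrite tensor_map_comp; apply: tensor_map_ext => // c /=.
      by apply: ret_cycle; have [j0 _] := index0 i; move: c; rewrite j0.
    have [j0|[i0 ei]] := index_left i.
      rewrite tensor_map_comp; apply: tensor_map_ext => // c /=.
      by apply: ret_cycle; move: c; rewrite j0.
    subst i; apply: uct_injective.
      by rewrite tensor_map_comp; apply: (cycle_hproj t0).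
    have := bt (iright i0); rewrite bcomp_right => <-.
    by rewrite tensor_map_comp; apply: tensor_map_ext.
  apply/eqP; rewrite subr_eq0 -{1}left_part; apply/eqP.
  rewrite /zincl /rr !tensor_map_comp; apply: tensor_map_ext => // c /=.
  by rewrite /hproj /= retK.
- by exists w; rewrite -wE addrC subrK.
Qed.

Lemma tensor_unit0 (A : zmodType) (x : tensor A unit) : x = 0.
Proof.
move: x; apply: tensor_ind => // [x y -> ->|a []]; first by rewrite subrr.
exact: tens0r.
Qed.

(** [uct_surjective] gives a cycle with coefficients in the homology of [Y]. It
    is lifted to a chain with cycles of [Y] on the right, at [(j + 1, k)]; the
    differential of that chain is cancelled by a chain at [(j, k + 1)], which
    does not contribute to [bcomp]. *)
Theorem tensor_onto n (i : kunneth_index n l)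
    (y : Tor (MH X (kj i) (kr i)) (MHpred Y (kk i) (ks i))) :
  exists t : TC n l, [/\ Tdiff X Y n l t = 0, bcomp i t = val y
    & forall i', i <> i' -> bcomp i' t = 0].
Proof.
case: n i y => [|n] i.
  have [_ k0] := index0 i; case: i k0 => r s j [|//] r0 s0 rs jk _ y.
  exists 0; split; rewrite ?raddf0 //; last by move=> i' _; rewrite raddf0.
  by rewrite [val y]tensor_unit0.
have [k0|[i0 ->]] := index_right i.
  case: i k0 => r s j [|//] r0 s0 rs jk _ y.
  exists 0; split; rewrite ?raddf0 //; last by move=> i' _; rewrite raddf0.
  by rewrite [val y]tensor_unit0.
move=> y; have [x [dx lx]] := uct_surjective y.
have [z zE] := tensor_map_surj
  (f := (idfun : {additive MB X (kj i0).+1 (kr i0) -> _}))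
  (g := @hclass R Y (kk i0) (ks i0))
  (fun a => ex_intro _ a erefl) (@hclass_surj _ _ _ _) x.
pose a : summand (ileft i0) := tensor_map idfun \val z.
have [|w [wE rw]] := @hclass0_boundary R Y (kk i0) (ks i0) _
    (tensor_map (dX i0) idfun z).
  by rewrite tensor_map_comp -dx -zE tensor_map_comp; apply: tensor_map_ext.
have {}wE : tensor_map idfun (dY i0) w = tensor_map (dX i0) idfun a.
  by rewrite wE !tensor_map_comp; apply: tensor_map_ext.
have dw := ret0_boundary_cycle wE rw.
have da : tensor_map idfun (mdiff Y (kk i0) (ks i0)) a = 0.
  by rewrite /a tensor_map_comp tensor_map0r // => c; apply: kernelP.
exists (dinj (ileft i0) a - dinj (iright i0) (w : summand (iright i0)) *~ (-1) ^+ kj i0).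
have bw i' : bcomp i' (dinj (iright i0) (w : summand (iright i0))) = 0.
  by apply: bcomp_dinj; right.
split.
- rewrite [Tdiff _ _ _ _ _]raddfB raddfMz /= Td_left // Td_right // wE.
  by rewrite -mulrzA -exprMn mulrNN mulr1 expr1n mulr1z subrr.
- rewrite raddfB raddfMz /= bw mul0rz subr0 bcomp_right dinj_same -lx -zE.
  by rewrite /a !tensor_map_comp; apply: tensor_map_ext => // c; rewrite /= retK.
- move=> i' ne; rewrite raddfB raddfMz /= bw mul0rz subr0.
  have [k0|[i1 e]] := index_right i'; first exact: bcomp0.
  rewrite e bcomp_right.
  by rewrite dinj_diff ?raddf0 // => /ileft_inj ei; apply: ne; rewrite e ei.
Qed.
End TensorExactness.

Local Opaque hproj lamd.
Local Opaque EZm AWm MB_map MH_map mcycle_map.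

(** * Naturality on tensor products *)

Section HomologyMap.
Variables (R : realType) (X X' : gmetric R) (f : short_map X X').
Variables (n : nat) (l : R).

Lemma val_mcycle_map z : val (mcycle_map f n l z) = MB_map f n l (val z).
Proof. by []. Qed.

Lemma MH_map_hclass z : MH_map f n l (hclass z) = hclass (mcycle_map f n l z).
Proof. exact: qlift_proj. Qed.

Lemma hproj_map z : hproj (MB_map f n l (val z)) = MH_map f n l (hclass z).
Proof. by rewrite -val_mcycle_map hproj_val MH_map_hclass. Qed.
End HomologyMap.

Section TensorNaturality.
Variables (R : realType) (X Y X' Y' : gmetric R) (l : R).
Variables (f : short_map X X') (g : short_map Y Y').

(** The choices of retractions for the two spaces are unrelated. On the right,
    the resulting difference vanishes on cycles of [Y], so only the part of
    [t] in the complements of those matters; its first differential is zero. On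
    the left, the difference extends to all chains that the differential
    reaches, and the class of the differential of [t] is zero. *)
Lemma bcomp_natural n (t : TC X Y n l) (i : kunneth_index n l) :
  Tdiff X Y n l t = 0 ->
  tensor_map (syzygy_map (MH_map f (kj i) (kr i)))
    (MHpred_map g (kk i) (ks i)) (bcomp i t) = bcomp i (TC_map f g n l t).
Proof.
case: n t i => [|n] t i t0.
  by have [_ k0] := index0 i; rewrite !bcomp0 ?raddf0.
have [k0|[i0 ->]] := index_right i; first by rewrite !bcomp0 ?raddf0.
rewrite !bcomp_right dproj_map.
set j := kj i0; set r := kr i0; set k := kk i0; set s := ks i0.
set x := dproj (ileft i0) t.
pose fC := MB_map f j.+1 r; pose gC := MB_map g k s.
pose fH := MH_map f j r; pose gH := MH_map g k s.
pose dX := @mbnd R X j r.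
have dx_hproj : tensor_map dX hproj x = 0 by apply: cycle_hproj.
pose x1 := tensor_map idfun (@resid _ _ k s) x.
have dx1 : tensor_map dX idfun x1 = 0.
  apply: (@free_tensor_detect _ _ _ _ (@ret _ _ k s) (mdiff Y k s)).
  - exact: ret_detect.
  - by rewrite /x1 !tensor_map_comp tensor_map0r // => c; apply: ret_resid.
  - rewrite /x1 !tensor_map_comp -[RHS](cycle_mdiff t0 i0).
    by apply: tensor_map_ext => // c; apply: mdiff_resid.
have lx1 : tensor_map (lamd \o fC) idfun x1 = 0.
  apply: (free_tensor_kills _ dx1) => c c0 /=.
  by apply: lamd_cycle; rewrite /fC MB_map_bnd [mbnd c]c0 raddf0.
have gE c : (hproj \o gC) c = (gH \o hproj) c + ((hproj \o gC) \o resid) c.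
  rewrite /= residE !raddfB /= hproj_map /gH; exact/esym/subrKC.
pose v : {additive MB X j r -> MB X j r} := \val \o ret.
pose N1 : {additive MB X j r -> {freeg MH X' j r}} := lam \o MB_map f j r \o v.
pose N2 : {additive MB X j r -> {freeg MH X' j r}} := free_map fH \o lam \o v.
have Ncyc c : free_aug _ ((N1 \- N2) c) = 0.
  rewrite raddfB /= aug_lam free_aug_map aug_lam hproj_val hproj_map.
  by rewrite subrr.
pose N := ker_lift Ncyc.
have fE c : (lamd \o fC) c = (syzygy_map fH \o lamd) c + N (dX c).
  apply: val_inj; rewrite raddfD /= !lamdE /fC MB_map_bnd.
  by rewrite ret_cycle ?mdiff_mbnd // addrC subrK.
have -> : tensor_map lamd hproj (tensor_map (MB_map f (kj (ileft i0)) (kr (ileft i0)))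
    (MB_map g (kk (ileft i0)) (ks (ileft i0))) x) =
    tensor_map (lamd \o fC) (hproj \o gC) x by rewrite tensor_map_comp.
have -> : tensor_map (lamd \o fC) (hproj \o gC) x =
    tensor_map (lamd \o fC) (gH \o hproj) x +
    tensor_map idfun (hproj \o gC) (tensor_map (lamd \o fC) idfun x1).
  rewrite /x1; move: x {x1 dx_hproj dx1 lx1}.
  apply: tensor_ind => [|y z yE zE|a b]; first by rewrite !raddf0 addr0.
    by rewrite !raddfB yE zE /= addBrACA.
  by rewrite !tensor_mapE -tensDr; congr (tens _ _); apply: gE.
rewrite lx1 raddf0 addr0.
have -> : tensor_map (lamd \o fC) (gH \o hproj) x =
    tensor_map (syzygy_map fH \o lamd) (gH \o hproj) x +
    tensor_map N gH (tensor_map dX hproj x).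
  move: x {x1 dx_hproj dx1 lx1}.
  apply: tensor_ind => [|y z yE zE|a b]; first by rewrite !raddf0 addr0.
    by rewrite !raddfB yE zE /= addBrACA.
  by rewrite !tensor_mapE -tensDl; congr (tens _ _); apply: fE.
by rewrite dx_hproj raddf0 addr0 tensor_map_comp.
Qed.
End TensorNaturality.

Section Assembly.
Variables (R : realType) (X Y : gmetric R) (n : nat) (l : R).
Local Notation XY := (gprod X Y).
Local Notation KT := (kunneth_tensor n l X Y).
Local Notation KTor := (kunneth_Tor n l X Y).

Lemma AWm_cycle (z : mcycle XY n l) : Tdiff X Y n l (AWm X Y n l (val z)) = 0.
Proof.
case: n z => [//|m] z; have := AWm_bd (val z); rewrite mbnd_val raddf0; exact.
Qed.

Lemma EZm_cycle t : Tdiff X Y n l t = 0 -> mdiff XY n l (EZm X Y n l t) = 0.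
Proof.
case: n t => [//|m] t t0; have := EZm_bd t.
by rewrite [Td _ _ _ _ t]t0 raddf0.
Qed.

(** * The map to the torsion products *)

Definition beta_raw (i : kunneth_index n l) : {additive mcycle XY n l ->
    tensor (syzygy (MH X (kj i) (kr i))) (MHpred Y (kk i) (ks i))} :=
  bcomp i \o AWm X Y n l \o \val.

Lemma beta_raw_tor (i : kunneth_index n l) z : tor_diff _ _ (beta_raw i z) = 0.
Proof. exact/bcomp_tor/AWm_cycle. Qed.

Definition beta_comp (i : kunneth_index n l) :
    {additive mcycle XY n l -> Tor (MH X (kj i) (kr i)) (MHpred Y (kk i) (ks i))} :=
  ker_lift (@beta_raw_tor i).

Lemma beta_support z : exists s : seq (kunneth_index n l),
  forall i, beta_comp i z <> 0 -> i \in s.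
Proof.
have [s sP] := bcomp_support (AWm X Y n l (val z)); exists s => i zi.
by apply: sP => bi; apply: zi; apply: val_inj.
Qed.

Definition beta_cycle : {additive mcycle XY n l -> KTor} := dsum_fun beta_support.

Lemma beta_cycleE z (i : kunneth_index n l) :
  val (dproj i (beta_cycle z)) = bcomp i (AWm X Y n l (val z)).
Proof. by []. Qed.

Fact beta_subproof z : z \in @mboundary R XY n l -> beta_cycle z = 0.
Proof.
move=> /asboolP[c cz]; apply: dsum_eqP => i; apply: val_inj.
by rewrite beta_cycleE -cz [mdiff _ _ _ c]/(mbnd c) -AWm_bd bcomp_boundary.
Qed.

Definition beta : {additive MH XY n l -> KTor} := qlift beta_subproof.

Lemma betaE z : beta (hclass z) = beta_cycle z.
Proof. exact: qlift_proj. Qed.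

(** * The map from the tensor products *)

Definition hh (i : kunneth_index n l) : {additive zsummand X Y i ->
    tensor (MH X (kj i) (kr i)) (MH Y (kk i) (ks i))} :=
  tensor_map hclass hclass.

Lemma hh_surj (x : KT) : exists z, dsum_map hh z = x.
Proof.
apply: dsum_lift_along => i.
exact: tensor_map_surj (@hclass_surj _ _ _ _) (@hclass_surj _ _ _ _) _.
Qed.

Fact cross_subproof z :
  mdiff XY n l ((EZm X Y n l \o dsum_map (@zincl R X Y l n)) z) = 0.
Proof. exact/EZm_cycle/zincl_cycle. Qed.

Definition cross : {additive dsum (@zsummand R X Y l n) -> mcycle XY n l} :=
  ker_lift cross_subproof.

Lemma crossE z : val (cross z) = EZm X Y n l (dsum_map (@zincl R X Y l n) z).
Proof. by []. Qed.

(** The product of a boundary and a cycle is the boundary of a product; the sign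
    is that of the differential of the right factor. *)
Lemma cross_boundary (i : kunneth_index n l) (x : zsummand X Y i) :
  hh i x = 0 -> hclass (cross (dinj i x)) = 0.
Proof.
move/(tensor_map_ker (@hclass_surj _ _ _ _) (@hclass_surj _ _ _ _)).
have zE a b : val (cross (dinj i (tens a b : zsummand X Y i))) =
    EZm X Y n l (dinj i (tens (val a) (val b) : tsummand X Y i)).
  by rewrite crossE dsum_map_inj /zincl tensor_mapE.
move: x; apply: span_kills (hclass \o cross \o dinj i) _ => _ [a [b [ab ->]]] /=.
apply/hclass_eq0; rewrite zE; case: ab => /hclass_eq0[c cE].
  exists (EZm X Y n.+1 l (dinj (ileft i) (tens c (val b) : tsummand X Y (ileft i)))).
  rewrite EZm_bd Td_left ?tensor_mapE /= ?cE //.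
  by rewrite [X in tens _ X](kernelP b) raddf0.
exists (EZm X Y n.+1 l
  (dinj (iright i) (tens (val a) c : tsummand X Y (iright i))) *~ (-1) ^+ kj i).
rewrite raddfMz /= EZm_bd Td_right ?tensor_mapE /= ?cE.
  by rewrite raddfMz /= -mulrzA -exprMn mulrNN mulr1 expr1n mulr1z.
by rewrite [X in tens X _](kernelP a) tens0l.
Qed.

Lemma alpha_comp_exists (i : kunneth_index n l) :
  exists h : {additive tensor (MH X (kj i) (kr i)) (MH Y (kk i) (ks i)) -> MH XY n l},
  forall x, h (hh i x) = hclass (cross (dinj i x)).
Proof.
apply: (additive_factor (q := hh i) (g := hclass \o cross \o dinj i)).
  exact: tensor_map_surj (@hclass_surj _ _ _ _) (@hclass_surj _ _ _ _).
exact: cross_boundary.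
Qed.

Definition alpha : {additive KT -> MH XY n l} :=
  dlift (fun i => projT1 (cid (alpha_comp_exists i))).

Lemma alphaE z : alpha (dsum_map hh z) = hclass (cross z).
Proof.
move: z; apply: dsum_ind => [|v w vE wE|i x]; first by rewrite !raddf0.
  by rewrite !raddfB vE wE.
by rewrite dsum_map_inj /alpha dlift_inj; case: cid.
Qed.

(** * Exactness and splitting *)

Definition pp (i : kunneth_index n l) : {additive tsummand X Y i ->
    tensor (MH X (kj i) (kr i)) (MH Y (kk i) (ks i))} :=
  tensor_map hproj hproj.

Lemma pp_Td w : dsum_map pp (Td X Y n l w) = 0.
Proof.
apply: dsum_eqP => i; rewrite dproj_map TdE raddf0 raddfD raddfMz /=.
rewrite !tensor_map_comp tensor_map0l ?tensor_map0r ?mul0rz ?addr0 // => c;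
  exact: hproj_bnd.
Qed.

Fact retraction_subproof z : z \in @mboundary R XY n l ->
  (dsum_map pp \o AWm X Y n l \o \val) z = 0.
Proof.
by move=> /asboolP[c cz]; rewrite /= -cz [mdiff _ _ _ c]/(mbnd c) -AWm_bd pp_Td.
Qed.

(** The projections of chains to homology give a retraction of [alpha]; it is
    not natural because the retractions to cycles are not. *)
Definition retraction : {additive MH XY n l -> KT} := qlift retraction_subproof.

Lemma alphaK x : retraction (alpha x) = x.
Proof.
have [z <-] := hh_surj x; rewrite alphaE.
have -> : retraction (hclass (cross z)) = dsum_map pp (AWm X Y n l (val (cross z))).
  exact: qlift_proj.
rewrite crossE AWm_EZm ?zincl_cycle // raddfD /= pp_Td addr0.
apply: dsum_eqP => i; rewrite !dproj_map /pp /zincl tensor_map_comp.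
by apply: tensor_map_ext => c; rewrite /= hproj_val.
Qed.

Lemma beta_alpha x : beta (alpha x) = 0.
Proof.
have [z <-] := hh_surj x; rewrite alphaE betaE.
apply: dsum_eqP => i; apply: val_inj; rewrite beta_cycleE crossE.
rewrite AWm_EZm ?zincl_cycle // raddfD /= bcomp_boundary addr0.
suff -> : bcomp i (dsum_map (@zincl R X Y l n) z) = 0 by [].
move: z {x}; apply: dsum_ind => [|v w vE wE|i' x]; first by rewrite !raddf0.
  by rewrite !raddfB /= vE wE subrr.
by rewrite dsum_map_inj bcomp_dinj //; left; apply: zincl_left.
Qed.

(** Up to boundaries, [z] is the image of its own component in the tensor
    complex. *)
Lemma beta_ker z : beta z = 0 -> exists x, alpha x = z.
Proof.
have [{}z <-] := hclass_surj z; rewrite betaE => bz.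
have [|x [w wE]] := tensor_middle (AWm_cycle z).
  by move=> i; rewrite -beta_cycleE bz.
exists (dsum_map hh x); rewrite alphaE; apply/eqP; rewrite -subr_eq0 -raddfB.
apply/eqP/hclass_eq0; exists (- EZm X Y n.+1 l w + Mhtpy X Y n l (val z)).
rewrite [RHS]raddfB [X in _ = X - _](crossE x) raddfD raddfN /= EZm_bd.
have := EZm_AWm (kernelP z); rewrite wE raddfD /=.
set A := EZm _ _ _ _ (dsum_map _ _); set B := EZm _ _ _ _ _ => AB.
by rewrite -[A](addrK B) AB [val z + _]addrC addrAC addrK addrC.
Qed.

Lemma beta_surj y : exists z, beta z = y.
Proof.
move: y; apply: dsum_ind.
- by exists 0; rewrite raddf0.
- by move=> _ _ [z <-] [z' <-]; exists (z - z'); rewrite raddfB.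
move=> i y; have [t [t0 ti ti']] := tensor_onto y.
have tP : EZm X Y n l t \in kernel_pred (mdiff XY n l) by apply/eqP/EZm_cycle.
exists (hclass (Kernel tP)); rewrite betaE; apply: dsum_eqP => i'.
apply: val_inj; rewrite beta_cycleE /= AWm_EZm // raddfD /= bcomp_boundary addr0.
have [e|ne] := pselect (i = i'); first by subst i'; rewrite dinj_same.
by rewrite ti' // dinj_diff.
Qed.

Theorem kunneth_exact : short_exact alpha beta.
Proof.
split; first exact: can_inj alphaK.
  by move=> z; split=> [/beta_ker //|[x <-]]; apply: beta_alpha.
exact: beta_surj.
Qed.

(** The class [z - alpha (retraction z)] only depends on [beta z]. *)
Theorem kunneth_split :
  exists sigma : {additive KTor -> MH XY n l}, forall t, beta (sigma t) = t.
Proof.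
have [|||sigma sigmaP] := @additive_choice KTor (MH XY n l)
    (fun t s => beta s = t /\ retraction s = 0).
- move=> t; have [z zt] := beta_surj t; exists (z - alpha (retraction z)).
  by rewrite !raddfB beta_alpha alphaK subr0 subrr.
- move=> t s s' [st s0] [s't s'0].
  have [|x xE] := beta_ker (z := s - s'); first by rewrite raddfB st s't subrr.
  apply/eqP; rewrite -subr_eq0 -xE -[x]alphaK xE raddfB s0 s'0 subrr.
  by rewrite raddf0.
- by move=> t t' s s' [<- s0] [<- s'0]; rewrite !raddfB s0 s'0 subrr.
by exists sigma => t; have [] := sigmaP t.
Qed.
End Assembly.

(** * Naturality of the sequence *)

Section KunnethNaturality.
Variables (R : realType) (X Y X' Y' : gmetric R) (n : nat) (l : R).
Variables (f : short_map X X') (g : short_map Y Y').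

Lemma alpha_natural x : MH_map (gprod_map f g) n l (alpha X Y n l x) =
  alpha X' Y' n l (kunneth_tensor_map n l f g x).
Proof.
have [z <-] := hh_surj x; rewrite alphaE MH_map_hclass.
pose zm (i : kunneth_index n l) : {additive zsummand X Y i -> zsummand X' Y' i} :=
  tensor_map (mcycle_map f (kj i) (kr i)) (mcycle_map g (kk i) (ks i)).
have -> : kunneth_tensor_map n l f g (dsum_map (@hh R X Y n l) z) =
    dsum_map (@hh R X' Y' n l) (dsum_map zm z).
  apply: dsum_eqP => i; rewrite /kunneth_tensor_map !dproj_map /hh /zm.
  by rewrite !tensor_map_comp; apply: tensor_map_ext => c; rewrite /= MH_map_hclass.
rewrite alphaE; congr (hclass _); apply: val_inj.
rewrite val_mcycle_map !crossE EZm_natural; congr (EZm _ _ _ _ _).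
apply: dsum_eqP => i; rewrite /TC_map !dproj_map /zincl /zm !tensor_map_comp.
exact: tensor_map_ext.
Qed.

Lemma beta_natural z : kunneth_Tor_map n l f g (beta X Y n l z) =
  beta X' Y' n l (MH_map (gprod_map f g) n l z).
Proof.
have [{}z <-] := hclass_surj z; rewrite MH_map_hclass !betaE.
apply: dsum_eqP => i; apply: val_inj; rewrite beta_cycleE val_mcycle_map.
rewrite -AWm_natural -bcomp_natural; last exact: AWm_cycle.
by rewrite -beta_cycleE.
Qed.
End KunnethNaturality.

(** * Chains of length zero on posets *)

Section LinearCombinations.
Variable T : choiceType.
Implicit Types s : seq (int * T).

Definition lin s : {freeg T} := \sum_(t <- s) << t.2 >> *~ t.1.

Definition lcoef s (x : T) : int :=
  foldr (fun t m => if t.2 == x then t.1 + m else m) 0 s.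

Lemma coeff_lin s x : coeff x (lin s) = lcoef s x.
Proof.
elim: s => [|t s IHs]; first by rewrite /lin big_nil raddf0.
rewrite /lin big_cons raddfD raddfMz /= -/(lin s) IHs coeffU mul1r.
by case: (t.2 == x); rewrite /= ?mul0rz ?add0r // intz.
Qed.

Lemma lin_eq s s' :
  all (fun t => lcoef s t.2 == lcoef s' t.2) (s ++ s') -> lin s = lin s'.
Proof.
move=> /allP ss'; apply/eqP/freeg_eqP => x; rewrite !coeff_lin.
have [|xout] := boolP (x \in [seq t.2 | t <- s ++ s']).
  by case/mapP => t ts ->; apply/eqP/ss'.
have coef0 r : x \notin [seq t.2 | t <- r] -> lcoef r x = 0.
  elim: r => //= t r IHr; rewrite inE negb_or => /andP[xt xr].
  by rewrite eq_sym (negPf xt) IHr.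
by rewrite map_cat mem_cat negb_or in xout; case/andP: xout => xs xs'; rewrite !coef0.
Qed.

Lemma lin_cat s s' : lin (s ++ s') = lin s + lin s'.
Proof. exact: big_cat. Qed.

End LinearCombinations.

Lemma lin_map (S : choiceType) (C : zmodType) (F : {additive {freeg S} -> C}) s :
  F (lin s) = \sum_(t <- s) F << t.2 >> *~ t.1.
Proof. by rewrite raddf_sum; apply: eq_bigr => t _; rewrite raddfMz. Qed.

Lemma lmap_lin (S T : choiceType) (f : S -> T) (s : seq (int * ne S)) :
  lmap f (lin s) = lin [seq (t.1, nemap f t.2) | t <- s].
Proof.
by rewrite raddf_sum /lin big_map; apply: eq_bigr => t _; rewrite raddfMz /= lmapU.
Qed.

Section SmallBoundaries.
Variable T : choiceType.

Lemma bd_edge (x y : T) : bd << (x, [:: y]) : ne T >> =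
  << (y, [::]) : ne T >> - << (x, [::]) : ne T >>.
Proof. by rewrite bdU /= raddf0 subr0 mulr1z. Qed.

Lemma bd_triangle (x y z : T) : bd << (x, [:: y; z]) : ne T >> =
  << (y, [:: z]) : ne T >> - << (x, [:: z]) : ne T >> + << (x, [:: y]) : ne T >>.
Proof.
have -> : bd << (x, [:: y; z]) : ne T >> = bd (cone x << (y, [:: z]) : ne T >>).
  by rewrite coneU.
rewrite bd_cone bd_edge augU mulr0z subr0 (raddfB (cone x)) /= !coneU.
by rewrite opprB addrA addrAC.
Qed.

Lemma bd_tetrahedron (x y z t : T) : bd << (x, [:: y; z; t]) : ne T >> =
  << (y, [:: z; t]) : ne T >> - << (x, [:: z; t]) : ne T >> +
  << (x, [:: y; t]) : ne T >> - << (x, [:: y; z]) : ne T >>.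
Proof.
have -> : bd << (x, [:: y; z; t]) : ne T >> =
    bd (cone x << (y, [:: z; t]) : ne T >>) by rewrite coneU.
rewrite bd_cone bd_triangle augU mulr0z subr0 (raddfD (cone x)) /=.
by rewrite (raddfB (cone x)) /= !coneU opprD opprB !addrA [X in X - _ = _]addrAC.
Qed.

Definition lin_faces (t : int * ne T) : seq (int * ne T) :=
  match t with
  | (c, (x, [:: y])) => [:: (c, (y, [::])); (- c, (x, [::]))]
  | (c, (x, [:: y; z])) =>
      [:: (c, (y, [:: z])); (- c, (x, [:: z])); (c, (x, [:: y]))]
  | _ => [::]
  end.

Lemma bd_lin (s : seq (int * ne T)) :
  all (fun t => (0 < nedim t.2 < 3)%N) s ->
  bd (lin s) = lin (flatten [seq lin_faces t | t <- s]).
Proof.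
have face t : (0 < nedim t.2 < 3)%N -> bd << t.2 >> *~ t.1 = lin (lin_faces t).
  case: t => c [x [|y [|z [|? ?]]]] // _; rewrite /lin !big_cons big_nil addr0 /=.
    by rewrite bd_edge mulrzBl mulrNz.
  by rewrite bd_triangle mulrzDl mulrzBl mulrNz addrA.
elim: s => [|t s IHs] /=; first by rewrite /lin !big_nil raddf0.
move=> /andP[/face tE /IHs sE]; rewrite lin_cat -tE -sE.
by rewrite /lin big_cons raddfD raddfMz.
Qed.
End SmallBoundaries.

Section PosetSpace.
Variables (R : realType) (m : nat) (le : rel nat).

Definition all2i (n : nat) (P : nat -> nat -> bool) :=
  all (fun x => all (P x) (iota 0 n)) (iota 0 n).
Definition all3i (n : nat) (P : nat -> nat -> nat -> bool) :=
  all (fun x => all2i n (P x)) (iota 0 n).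

Lemma all2iP n P : all2i n P -> forall x y : 'I_n, P x y.
Proof.
move=> /allP Pn x y; have /Pn/allP : (x : nat) \in iota 0 n by rewrite mem_iota /=.
by apply; rewrite mem_iota /=.
Qed.

Lemma all3iP n P : all3i n P -> forall x y z : 'I_n, P x y z.
Proof.
move=> /allP Pn x; have /Pn : (x : nat) \in iota 0 n by rewrite mem_iota /=.
exact: all2iP.
Qed.

Hypothesis le_refl : forall x, le x x.
Hypothesis le_trans : all3i m (fun x y z => le x y ==> le y z ==> le x z).

Definition poset_dist (x y : 'I_m) : \bar R := if le x y then 0%E else 1%E.

Fact poset_dist_ge0 x y : (0 <= poset_dist x y)%E.
Proof. by rewrite /poset_dist; case: (le x y); rewrite ?lee_fin ?ler01. Qed.

Fact poset_distxx x : poset_dist x x = 0%E.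
Proof. by rewrite /poset_dist le_refl. Qed.

Fact poset_dist_triangle x y z :
  (poset_dist x z <= poset_dist x y + poset_dist y z)%E.
Proof.
have := all3iP le_trans x y z; rewrite /poset_dist.
case: (le x y) => /=; case: (le y z) => /=; case: (le x z) => //= _;
  by rewrite ?adde0 ?add0e -?EFinD ?lee_fin ?ler01 ?lerDl ?addr_ge0 ?ler01.
Qed.

(** The magnitude chains of length zero are the chains of the nerve of the
    poset. *)
Definition poset_space : gmetric R :=
  @GMetric R 'I_m poset_dist poset_dist_ge0 poset_distxx poset_dist_triangle.

Definition chain0 (z : ne 'I_m) : bool := path (fun x y : 'I_m => le x y) z.1 z.2.

Lemma plen_chain0 (z : ne 'I_m) : chain0 z -> plen (X := poset_space) z = 0%:E.
Proof.
case: z => x s; rewrite /chain0 /plen /=; elim: s x => //= y s IHs x /andP[xy ys].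
by rewrite IHs // /poset_dist xy adde0.
Qed.

Lemma chain0_plen (z : ne 'I_m) : plen (X := poset_space) z = 0%:E -> chain0 z.
Proof.
case: z => x s; rewrite /chain0 /plen /=; elim: s x => //= y s IHs x /eqP.
rewrite padde_eq0 ?poset_dist_ge0 //; last exact: (plen_ge0 (X := poset_space) (y, s)).
move=> /andP[xy /eqP/IHs ->]; rewrite andbT.
by move: xy; rewrite /poset_dist; case: (le x y); rewrite // eqe oner_eq0.
Qed.

Local Notation L := {freeg (ne (gpoint poset_space))}.

Lemma lin_low (s : seq (int * ne poset_space)) :
  all (fun t => chain0 t.2) s -> lin s \in low (ne_wbasis poset_space) 0.
Proof.
elim: s => [|t s IHs]; first by rewrite /lin big_nil rpred0.
move=> /= /andP[t0 /IHs sl]; rewrite /lin big_cons rpredD ?rpredMz //.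
by apply: mem_span; exists t.2; rewrite ?plen_chain0.
Qed.

Lemma lin_minj n (s : seq (int * ne poset_space)) :
  all (fun t => (nedim t.2 == n) && chain0 t.2) s ->
  minj (mproj n 0 (lin s)) = lin s.
Proof.
elim: s => [|t s IHs]; first by rewrite /lin big_nil !raddf0.
move=> /= /andP[/andP[/eqP tn t0] /IHs sE].
by rewrite /lin big_cons !raddfD !raddfMz /= sE mprojK ?plen_chain0.
Qed.

(** Cochains can be checked on chains of the poset. *)
Lemma cochain_bd (C : zmodType) n (phi psi : {additive L -> C}) :
  (forall z, nedim z = n.+1 -> chain0 z -> phi (bd << z >>) = psi << z >>) ->
  forall c : MB poset_space n.+1 0, phi (minj (mbnd c)) = psi (minj c).
Proof.
move=> phi_psi c; apply: (freeg_additive_eq (g := phi \o minj \o @mbnd R _ n 0)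
  (h := psi \o minj)) => u /=.
rewrite minjU; set z := ne_of _; have zn : nedim z = n.+1 by rewrite nedim_of.
have z0 : plen z = 0%:E by rewrite plen_of; apply/eqP/(valP u).
have -> : mbnd << u >> = mproj n 0 (bd << z >>).
  rewrite mproj_bd; last by apply: lowN; rewrite z0.
  by rewrite mproj_of mbasis_val.
rewrite -phi_psi ?chain0_plen //; congr (phi _).
move: (bd << z >>) (bd_shrinks (Z := poset_space) zn); apply: span_ind.
- by rewrite !raddf0.
- by move=> v w vE wE; rewrite !raddfB /= vE wE.
move=> _ [z' [z'n [z'z _] ->]]; apply: mprojK => //.
by apply/eqP; rewrite eq_le plen_ge0 andbT -z0.
Qed.
End PosetSpace.

(** * A projective plane and a sphere *)

(** The face poset of the projective plane obtained from the octahedron by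
    identifying antipodes: vertices [0 .. 2], edges [3 .. 8], triangles
    [9 .. 12]. The edges [3] and [4], [5] and [6], [7] and [8] join the vertices
    [0] and [1], [0] and [2], [1] and [2], respectively. *)
Definition plane_lt : seq (nat * nat) :=
  [:: (0, 3); (1, 3); (0, 4); (1, 4); (0, 5); (2, 5); (0, 6); (2, 6);
      (1, 7); (2, 7); (1, 8); (2, 8);
      (3, 9); (5, 9); (7, 9); (0, 9); (1, 9); (2, 9);
      (3, 10); (6, 10); (8, 10); (0, 10); (1, 10); (2, 10);
      (4, 11); (5, 11); (8, 11); (0, 11); (1, 11); (2, 11);
      (4, 12); (6, 12); (7, 12); (0, 12); (1, 12); (2, 12)]%N.

Definition plane_le : rel nat := fun x y => (x == y) || ((x, y) \in plane_lt).

(** The six-point model of the sphere: three levels of two incomparable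
    points. *)
Definition sphere_le : rel nat := fun x y => (x == y) || (x./2 < y./2)%N.

Lemma plane_le_refl x : plane_le x x. Proof. by rewrite /plane_le eqxx. Qed.
Lemma sphere_le_refl x : sphere_le x x. Proof. by rewrite /sphere_le eqxx. Qed.

Lemma plane_le_trans :
  all3i 13 (fun x y z => plane_le x y ==> plane_le y z ==> plane_le x z).
Proof. by vm_compute. Qed.

Lemma sphere_le_trans :
  all3i 6 (fun x y z => sphere_le x y ==> sphere_le y z ==> sphere_le x z).
Proof. by vm_compute. Qed.

(** The flag [0 < 3 < 9] covers the flag [0 < 2 < 4] of the sphere once, and no
    other flag does: the degree is odd. *)
Definition pinch_val (x : nat) : nat :=
  nth 0 [:: 0; 1; 1; 2; 3; 3; 3; 3; 3; 4; 5; 5; 5]%N x.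

Lemma pinch_subproof (x : 'I_13) : (pinch_val x < 6)%N.
Proof.
have : all (fun x => (pinch_val x < 6)%N) (iota 0 13) by [].
by move/allP; apply; rewrite mem_iota /=.
Qed.

Definition pinch_fun (x : 'I_13) : 'I_6 := Ordinal (pinch_subproof x).

(** A cochain whose coboundary is twice the pull-back of [flag_val] by
    the pinch map; modulo [2] it is a cocycle that does not vanish on the
    generator of the fundamental group. *)
Definition half_val (x y : nat) : int :=
  if (x, y) == (3, 9)%N then 1
  else if (x, y) \in [:: (1, 3); (0, 5); (1, 8); (0, 9); (1, 10); (4, 11);
                         (0, 11); (1, 11)]%N then -1
  else 0.

Definition flag_val (x y z : nat) : int := ([:: x; y; z] == [:: 0; 2; 4]%N)%:Z.

Lemma half_coboundary : all3i 13 (fun x y z => plane_le x y ==> plane_le y z ==>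
  (half_val y z - half_val x z + half_val x y ==
     2%:Z * flag_val (pinch_val x) (pinch_val y) (pinch_val z))).
Proof. by vm_compute. Qed.

Lemma flag_cocycle : all (fun x => all3i 6 (fun y z t =>
  sphere_le x y ==> sphere_le y z ==> sphere_le z t ==>
  (flag_val y z t - flag_val x z t + flag_val x y t - flag_val x y z == 0)))
  (iota 0 6).
Proof. by vm_compute. Qed.

Section Counterexample.
Variable R : realType.

Definition plane : gmetric R := poset_space R plane_le_refl plane_le_trans.
Definition sphere : gmetric R := poset_space R sphere_le_refl sphere_le_trans.

Lemma pinch_mono : all2i 13 (fun x y => plane_le x y ==>
  sphere_le (pinch_val x) (pinch_val y)).
Proof. by vm_compute. Qed.

Fact pinch_short (x x' : plane) :
  (gdist (pinch_fun x : sphere) (pinch_fun x' : sphere) <= gdist x x')%E.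
Proof.
have := all2iP pinch_mono x x'; rewrite /= /poset_dist /=.
by do 2!case: ifP => //= _; rewrite ?lexx ?lee_fin ?ler01.
Qed.

Definition pinch : short_map plane sphere :=
  @ShortMap R plane sphere pinch_fun pinch_short.

Definition plane_id : short_map plane plane :=
  @ShortMap R plane plane id (fun x x' => lexx _).

Local Notation o k := (@Ordinal 13 k isT).

(* The loop through the edges [7] and [8], which avoids the flag [0 < 3 < 9]. *)
Definition loop_list : seq (int * ne plane) :=
  [:: (1, (o 1, [:: o 7])); (-1, (o 2, [:: o 7]));
      (1, (o 2, [:: o 8])); (-1, (o 1, [:: o 8]))].

(* All 24 flags, oriented so that the boundary is twice the loop. *)
Definition disk_list : seq (int * ne plane) :=
  [:: (1, (o 0, [:: o 3; o 9])); (-1, (o 1, [:: o 3; o 9]));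
      (-1, (o 0, [:: o 5; o 9])); (1, (o 2, [:: o 5; o 9]));
      (1, (o 1, [:: o 7; o 9])); (-1, (o 2, [:: o 7; o 9]));
      (-1, (o 0, [:: o 3; o 10])); (1, (o 1, [:: o 3; o 10]));
      (1, (o 0, [:: o 6; o 10])); (-1, (o 2, [:: o 6; o 10]));
      (-1, (o 1, [:: o 8; o 10])); (1, (o 2, [:: o 8; o 10]));
      (-1, (o 0, [:: o 4; o 11])); (1, (o 1, [:: o 4; o 11]));
      (1, (o 0, [:: o 5; o 11])); (-1, (o 2, [:: o 5; o 11]));
      (-1, (o 1, [:: o 8; o 11])); (1, (o 2, [:: o 8; o 11]));
      (1, (o 0, [:: o 4; o 12])); (-1, (o 1, [:: o 4; o 12]));
      (-1, (o 0, [:: o 6; o 12])); (1, (o 2, [:: o 6; o 12]));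
      (1, (o 1, [:: o 7; o 12])); (-1, (o 2, [:: o 7; o 12]))].

Definition loop : MB plane 1 0 := mproj 1 0 (lin loop_list).
Definition disk : MB plane 2 0 := mproj 2 0 (lin disk_list).

Lemma disk_low : lin disk_list \in low (ne_wbasis plane) 0.
Proof. by apply: lin_low; vm_compute. Qed.

Lemma loop_low : lin loop_list \in low (ne_wbasis plane) 0.
Proof. by apply: lin_low; vm_compute. Qed.

Lemma disk_boundary : mbnd disk = loop + loop.
Proof.
rewrite /disk -mproj_bd ?disk_low // bd_lin; last by vm_compute.
rewrite /loop -raddfD -lin_cat; congr (mproj _ _ _).
by apply: lin_eq; vm_compute.
Qed.

Lemma loop_cycle : mbnd loop = 0.
Proof.
rewrite /loop -mproj_bd ?loop_low // bd_lin; last by vm_compute.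
rewrite (_ : lin _ = lin [::]); last by apply: lin_eq; vm_compute.
by rewrite /lin big_nil raddf0.
Qed.

Lemma pinch_loop : MB_map pinch 1 0 loop = 0.
Proof.
rewrite /loop -mproj_map ?loop_low // lmap_lin.
rewrite (_ : lin _ = lin [::]); last by apply: lin_eq; vm_compute.
by rewrite /lin big_nil raddf0.
Qed.
End Counterexample.

Local Opaque alpha beta retraction.

(** * The splitting is not natural *)

(** Here [s] is the value of a splitting at [be z]. It differs from [z] by an
    element of the tensor part, whose image under the naturality square is [k]
    up to sign. *)
Lemma splitting_obstruction (K H T K' H' : zmodType)
    (al : {additive K -> H}) (be : {additive H -> T})
    (al' : {additive K' -> H'}) (fK : {additive K -> K'})
    (fH : {additive H -> H'}) (s z : H) (k : K') :
  (forall x, be x = 0 -> exists y, al y = x) -> injective al' ->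
  (forall y, fH (al y) = al' (fK y)) ->
  be s = be z -> fH s = 0 -> fH z = al' k -> exists y, fK y = k.
Proof.
move=> exact al'_inj nat sz s0 zk.
have [|y yE] := exact (z - s); first by rewrite raddfB sz subrr.
by exists y; apply: al'_inj; rewrite -nat yE raddfB s0 subr0.
Qed.

Section NoNaturalSplitting.
Variable R : realType.
Local Notation plane := (plane R).
Local Notation sphere := (sphere R).
Local Notation pinch := (pinch R).
Local Notation loop := (loop R).
Local Notation disk := (disk R).

Definition half_cochain : {additive {freeg (ne plane)} -> int} :=
  flift (fun z : ne plane => if z.2 is [:: y] then half_val z.1 y else 0).

Definition flag_cochain : {additive {freeg (ne sphere)} -> int} :=
  flift (fun z : ne sphere => if z.2 is [:: y; t] then flag_val z.1 y t else 0).

Lemma flag_pinch (c : MB plane 2 0) :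
  flag_cochain (minj (MB_map pinch 2 0 c)) = flag_cochain (lmap pinch (minj c)).
Proof.
congr (flag_cochain _); apply: (freeg_additive_eq (g := minj \o MB_map pinch 2 0)
  (h := lmap pinch \o minj)) => u; rewrite /= -{1}[<< u >>]minjK minjU.
have u0 : plen (ne_of (val u)) = 0%:E by rewrite plen_of; apply/eqP/(valP u).
rewrite -mproj_map; last by apply: lowN; rewrite u0.
rewrite lmapU mprojK ?nedim_map ?nedim_of //.
apply/eqP; rewrite eq_le plen_ge0 andbT.
by apply: le_trans (plen_map pinch _) _; rewrite u0.
Qed.

Lemma mul2z (x : int) : 2%:Z * x = x + x.
Proof. by rewrite -[2%:Z]/(1 + 1 : int) mulrDl mul1r. Qed.

Lemma half_bd (c : MB plane 2 0) :
  half_cochain (minj (mbnd c)) = 2%:Z * flag_cochain (minj (MB_map pinch 2 0 c)).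
Proof.
rewrite flag_pinch mul2z.
apply: (cochain_bd (phi := half_cochain)
  (psi := (flag_cochain \o lmap pinch) \+ (flag_cochain \o lmap pinch))) => z.
case: z => x [|y [|z [|? ?]]] // _ /and3P[xy yz _].
have := all3iP half_coboundary x y z; rewrite xy yz /= => /eqP E.
rewrite bd_triangle raddfD raddfB /= lmapU /half_cochain /flag_cochain !fliftU /= E.
by rewrite mul2z.
Qed.

Lemma flag_bd (c : MB sphere 3 0) : flag_cochain (minj (mbnd c)) = 0.
Proof.
apply: (cochain_bd (phi := flag_cochain) (psi := \0)) => z.
case: z => x [|y [|z [|t [|? ?]]]] // _ /and4P[xy yz zt _].
have /allP/(_ (x : nat)) := flag_cocycle; rewrite mem_iota /= => /(_ (ltn_ord x)).
move/all3iP/(_ y z t); rewrite xy yz zt /= => /eqP E.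
by rewrite bd_tetrahedron raddfB raddfD raddfB /= /flag_cochain !fliftU.
Qed.

Lemma half_loop : half_cochain (minj loop) = 1.
Proof.
rewrite /loop lin_minj; last by vm_compute.
by rewrite lin_map /loop_list !big_cons big_nil /= /half_cochain !fliftU.
Qed.

Lemma flag_disk : flag_cochain (minj (MB_map pinch 2 0 disk)) = 1.
Proof.
have := half_bd disk; rewrite disk_boundary !raddfD /= half_loop.
by move=> E; apply: (mulfI (isT : (2%:Z != 0))); rewrite -E.
Qed.

Fact flag_class_subproof z : z \in @mboundary R sphere 2 0 ->
  (flag_cochain \o minj \o \val) z = 0.
Proof. by move=> /asboolP[c cz]; rewrite /= -cz flag_bd. Qed.

Definition flag_class : {additive MH sphere 2 0 -> int} := qlift flag_class_subproof.

Fact half_class_subproof z : z \in @mboundary R plane 1 0 ->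
  ((intr : int -> 'F_2) \o half_cochain \o minj \o \val) z = 0.
Proof.
move=> /asboolP[c cz]; rewrite /= -cz [half_cochain _]half_bd rmorphM /=.
by rewrite [2%:~R](_ : _ = 0) ?mul0r //; apply/eqP.
Qed.

Definition half_class : {additive MH plane 1 0 -> 'F_2} := qlift half_class_subproof.

Lemma flag_classE z : flag_class (hclass z) = flag_cochain (minj (val z)).
Proof. exact: qlift_proj. Qed.

Lemma half_classE z : half_class (hclass z) = (half_cochain (minj (val z)))%:~R.
Proof. exact: qlift_proj. Qed.

(** A cycle of the plane is killed by twice the cochain pulled back from the
    sphere, since that is a coboundary. *)
Lemma flag_class_pinch h : flag_class (MH_map pinch 2 0 h) = 0.
Proof.
have [z <-] := hclass_surj h; rewrite MH_map_hclass flag_classE val_mcycle_map.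
have := half_bd (val z); rewrite mbnd_val !raddf0 => /esym/eqP.
by rewrite mulf_eq0 /= => /eqP.
Qed.

Fact pairing_Bl k : zmod_morphism (fun h => half_class k *~ flag_class h).
Proof. by move=> h h'; rewrite raddfB mulrzBr. Qed.

Fact pairing_Br h : zmod_morphism (fun k => half_class k *~ flag_class h).
Proof. by move=> k k'; rewrite raddfB mulrzBl. Qed.

Definition pairing : {additive tensor (MH sphere 2 0) (MH plane 1 0) -> 'F_2} :=
  tensor_lift (phi := fun h k => half_class k *~ flag_class h)
    pairing_Bl pairing_Br.

Lemma pairing_pinch (g : {additive MH plane 1 0 -> MH plane 1 0}) x :
  pairing (tensor_map (MH_map pinch 2 0) g x) = 0.
Proof.
move: x; apply: tensor_ind => [|x y xE yE|h k]; first by rewrite !raddf0.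
  by rewrite !raddfB xE yE subrr.
by rewrite tensor_mapE /pairing tensor_liftE flag_class_pinch mulr0z.
Qed.

Lemma MB_map_id n l c : MB_map (plane_id R) n l c = c.
Proof.
move: c; apply: (freeg_additive_eq (h := idfun)) => u.
rewrite [LHS]fliftU; apply: etrans (mbasis_val u); congr (mbasis l _).
by apply/ffunP => i; rewrite ffunE.
Qed.

Definition index11 : kunneth_index 2 (0 : R) :=
  @KunnethIndex R 2 0 0 0 1 1 (lexx 0) (lexx 0) (addr0 0) erefl.

Local Notation TC X Y := (TC X Y 3 (0 : R)).

Definition torsion_chain : TC plane plane :=
  dinj (ileft index11) (tens disk loop : tsummand plane plane (ileft index11)) +
  dinj (iright index11) (tens loop disk : tsummand plane plane (iright index11)).

Lemma torsion_chain_cycle : Tdiff plane plane 3 0 torsion_chain = 0.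
Proof.
change (Td plane plane 2 0 torsion_chain = 0); rewrite /torsion_chain raddfD /=.
rewrite Td_left; last first.
  by rewrite tensor_mapE [X in tens _ X]loop_cycle raddf0.
rewrite Td_right; last by rewrite tensor_mapE [X in tens X _]loop_cycle tens0l.
rewrite !tensor_mapE /= disk_boundary tensDl tensDr expr1 mulrN1z.
exact: subrr.
Qed.

Lemma torsion_chain_pinch :
  TC_map pinch (plane_id R) 3 0 torsion_chain =
  dinj (ileft index11) (tens (MB_map pinch 2 0 disk) loop
    : tsummand sphere plane (ileft index11)).
Proof.
rewrite /torsion_chain raddfD /= /TC_map !dsum_map_inj.
have loop0 : tensor_map (MB_map pinch 1 0) (MB_map (plane_id R) 2 0)
    (tens loop disk) = 0 by rewrite tensor_mapE pinch_loop tens0l.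
have -> : dinj (iright index11) (tensor_map (MB_map pinch 1 0)
    (MB_map (plane_id R) 2 0) (tens loop disk)
    : tsummand sphere plane (iright index11)) = 0 by rewrite loop0 raddf0.
rewrite addr0; congr (dinj _ _).
by rewrite tensor_mapE [X in tens _ X]MB_map_id.
Qed.

Fact torsion_cycle_subproof :
  EZm plane plane 3 0 torsion_chain \in kernel_pred (mdiff (gprod plane plane) 3 0).
Proof. exact/eqP/EZm_cycle/torsion_chain_cycle. Qed.

Definition torsion_class : MH (gprod plane plane) 3 0 :=
  hclass (Kernel torsion_cycle_subproof).

Lemma pinch_disk_cycle : MB_map pinch 2 0 disk \in kernel_pred (mdiff sphere 2 0).
Proof.
apply/eqP; rewrite [mdiff _ _ _ _]MB_map_bnd disk_boundary raddfD /=.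
by rewrite pinch_loop addr0.
Qed.

Lemma loop_in_kernel : loop \in kernel_pred (mdiff plane 1 0).
Proof. exact/eqP/loop_cycle. Qed.

Definition sphere_disk : kunneth_tensor 3 (0 : R) sphere plane :=
  dinj (ileft index11) (tens (hclass (Kernel pinch_disk_cycle))
                             (hclass (Kernel loop_in_kernel))).

Lemma torsion_class_pinch :
  MH_map (gprod_map pinch (plane_id R)) 3 0 torsion_class =
  alpha sphere plane 3 0 sphere_disk.
Proof.
rewrite MH_map_hclass.
have -> : sphere_disk = dsum_map (@hh R sphere plane 3 0)
    (dinj (ileft index11) (tens (Kernel pinch_disk_cycle) (Kernel loop_in_kernel)
      : zsummand sphere plane (ileft index11))).
  by rewrite dsum_map_inj /hh tensor_mapE.
rewrite alphaE; congr (hclass _); apply: val_inj.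
rewrite val_mcycle_map crossE EZm_natural torsion_chain_pinch dsum_map_inj.
by rewrite /zincl tensor_mapE.
Qed.

Lemma pairing_sphere_disk :
  pairing (dproj (ileft index11) sphere_disk) = 1.
Proof.
rewrite dinj_same /pairing tensor_liftE flag_classE half_classE.
by rewrite flag_disk half_loop.
Qed.

(** The class of [disk (x) loop + loop (x) disk] maps to a torsion element
    that the pinch map kills, while its own image is the nonzero product of the
    images of [disk] and [loop]. That product is not the image of an element
    of the tensor part, by which the value of a splitting could differ. *)
Theorem no_natural_splitting :
  ~ exists sigma : forall X Y : gmetric R,
      {additive kunneth_Tor 3 0 X Y -> MH (gprod X Y) 3 0},
    (forall X Y t, beta X Y 3 0 (sigma X Y t) = t) /\
    (forall X Y X' Y' (f : short_map X X') (g : short_map Y Y') t,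
       MH_map (gprod_map f g) 3 0 (sigma X Y t) =
       sigma X' Y' (kunneth_Tor_map 3 0 f g t)).
Proof.
case=> sigma [sigmaK sigma_nat].
pose tau := beta plane plane 3 0 torsion_class.
have tau0 : kunneth_Tor_map 3 0 pinch (plane_id R) tau = 0.
  by rewrite beta_natural torsion_class_pinch beta_alpha.
pose s := sigma plane plane tau.
have s_pinch : MH_map (gprod_map pinch (plane_id R)) 3 0 s = 0.
  exact: etrans (sigma_nat _ _ _ _ pinch (plane_id R) tau)
    (etrans (congr1 _ tau0) (raddf0 _)).
have [y yE] : exists y, kunneth_tensor_map 3 0 pinch (plane_id R) y = sphere_disk.
  exact: (splitting_obstruction (@beta_ker R plane plane 3 0)
    (can_inj (@alphaK R sphere plane 3 0)) (alpha_natural pinch (plane_id R))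
    (sigmaK _ _ tau) s_pinch torsion_class_pinch).
have := pairing_sphere_disk; rewrite -yE dproj_map pairing_pinch => /esym/eqP.
by rewrite oner_eq0.
Qed.
End NoNaturalSplitting.

Theorem theorem4p6 (R : realType) :
  exists (alpha : forall (n : nat) (l : R) (X Y : gmetric R),
            {additive kunneth_tensor n l X Y -> MH (gprod X Y) n l})
         (beta : forall (n : nat) (l : R) (X Y : gmetric R),
            {additive MH (gprod X Y) n l -> kunneth_Tor n l X Y}),
  [/\ (forall (n : nat) (l : R) (X Y : gmetric R), 0 <= l ->
         short_exact (alpha n l X Y) (beta n l X Y)),
      (forall (n : nat) (l : R) (X Y X' Y' : gmetric R)
         (f : short_map X X') (g : short_map Y Y'), 0 <= l ->
         (forall x : kunneth_tensor n l X Y,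
            MH_map (gprod_map f g) n l (alpha n l X Y x) =
            alpha n l X' Y' (kunneth_tensor_map n l f g x))
         /\
         (forall z : MH (gprod X Y) n l,
            kunneth_Tor_map n l f g (beta n l X Y z) =
            beta n l X' Y' (MH_map (gprod_map f g) n l z))),
      (forall (n : nat) (l : R) (X Y : gmetric R), 0 <= l ->
         exists sigma : {additive kunneth_Tor n l X Y -> MH (gprod X Y) n l},
           forall t, beta n l X Y (sigma t) = t)
    & exists (n : nat) (l : R), 0 <= l /\
        ~ exists sigma : forall X Y : gmetric R,
              {additive kunneth_Tor n l X Y -> MH (gprod X Y) n l},
            (forall (X Y : gmetric R) (t : kunneth_Tor n l X Y),
               beta n l X Y (sigma X Y t) = t)
            /\
            (forall (X Y X' Y' : gmetric R)
               (f : short_map X X') (g : short_map Y Y')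
               (t : kunneth_Tor n l X Y),
               MH_map (gprod_map f g) n l (sigma X Y t) =
               sigma X' Y' (kunneth_Tor_map n l f g t))].
Proof.
exists (fun n l X Y => alpha X Y n l), (fun n l X Y => beta X Y n l); split.
- by move=> n l X Y _; apply: kunneth_exact.
- move=> n l X Y X' Y' f g _; split; [exact: alpha_natural | exact: beta_natural].
- by move=> n l X Y _; apply: kunneth_split.
- by exists 3, 0; split=> //; apply: no_natural_splitting.
Qed.
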